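(* Let $C_5\in(0,\infty)$ be a constant such that $E^a_{Q,+,0}(e^{tm^a_Q})\leq e^{C_5(t+t^2)}$ for any $a>0$ and $t>0$ (there exists such a constant). Then for any $a>0$, $h\geq 0$ and $t>0$, $$\tilde{\mathbb{E}}^a_{Q,w,h}\left(e^{tA_0}\right)\leq 2 e^{C_5\left((t+h)^2+(t+h)\right)}.$$
   Context: Let $\beta_c=\frac12\log(1+\sqrt2)$, $Q=[-1/2,1/2]^2$, $Q^a=a\mathbb{Z}^2\cap Q$. $\mathscr{B}(Q^a)$ is the set of nearest neighbour edges of $a\mathbb{Z}^2$ with both endpoints in $Q^a$. $\tilde{\mathbb P}^a_{Q,w,h}$, with expectation $\tilde{\mathbb E}^a_{Q,w,h}$, is the probability measure on $\omega\in\{0,1\}^{\mathscr{B}(Q^a)}$ given by $$\tilde{\mathbb{P}}^a_{Q,w,h}(\omega)\propto(1-e^{-2\beta_c})^{o(\omega)}(e^{-2\beta_c})^{c(\omega)}\prod_{\mathcal{C}\in \mathscr{C}(Q^a,w,\omega)}\left(1+e^{-2ha^{15/8}|\mathcal{C}|}\right),$$ where $o(\omega)$, $c(\omega)$ are the numbers of open ($\omega(e)=1$) and closed edges, $\mathscr{C}(Q^a,w,\omega)$ is the set of clusters intersecting $Q^a$ of the configuration on $a\mathbb{Z}^2$ equal to $\omega$ on $\mathscr{B}(Q^a)$ and with all other nearest neighbour edges open (wired boundary conditions $w$), and $|\mathcal C|$ is the number of vertices in $\mathcal C\cap Q^a$. (This is the internal-edge marginal of the critical FK–Ising measure with external field $a^{15/8}h$.)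 $\mathcal{C}_0(\omega)$ is the boundary cluster (the cluster containing all vertices of $Q^a$ with a nearest neighbour outside $Q^a$), and $A_0(\omega):=a^{15/8}|\mathcal{C}_0(\omega)|$. $m^a_Q:=a^{15/8}\sum_{x\in Q^a}\sigma_x$, and $E^a_{Q,+,0}$ is expectation for the Ising model on $Q^a$ at inverse temperature $\beta_c$, zero external field, and plus boundary condition on the vertices of $a\mathbb{Z}^2\setminus Q^a$ adjacent to $Q^a$. The existence of $C_5$ is taken from Camia–Garban–Newman. *)

(* Defs.v *)
From HB Require Import structures.
From mathcomp Require Import all_boot all_order all_algebra finmap.
From mathcomp Require Import zify.
From mathcomp Require Import all_classical all_reals all_analysis.

Set Implicit Arguments.
Unset Strict Implicit.
Unset Printing Implicit Defensive.

Import Order.TTheory GRing.Theory Num.Theory.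
Local Open Scope ring_scope.

(* The lattice a Z^2 is indexed by Z^2: the pair (i, j) stands for the vertex
   (a i, a j). *)
Notation site := (int * int)%type.

Definition nbrs (x : site) : seq site :=
  [:: (x.1 + 1, x.2); (x.1 - 1, x.2); (x.1, x.2 + 1); (x.1, x.2 - 1)].

Definition nn (x y : site) : bool := y \in nbrs x.

Definition beta_c (R : realType) : R := 2^-1 * ln (1 + Num.sqrt 2).

Definition inQ (R : realType) (a : R) (x : site) : bool :=
  (- 2^-1 <= a * x.1%:~R <= 2^-1) && (- 2^-1 <= a * x.2%:~R <= 2^-1).

(* fset_set is only meaningful on finite sets: see finite_inQ and mem_Qa. *)
Definition Qa (R : realType) (a : R) : {fset site} :=
  fset_set [set x | inQ a x]%classic.

Lemma finite_inQ (R : realType) (a : R) :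
  0 < a -> finite_set [set x | inQ a x]%classic.
Proof.
move=> a0; pose n := Num.truncn (2^-1 / a).
pose L : seq int := [seq i%:Z - n.+1%:Z | i <- iota 0 (n.+1 + n.+1).+1].
have memL (k : int) : - 2^-1 <= a * k%:~R <= 2^-1 -> k \in L.
  move=> /andP[lek gek].
  have hk : `|k|%:~R < n.+1%:R :> R.
    have -> : `|k|%:~R = `|k%:~R| :> R by rewrite intr_norm.
    apply: le_lt_trans (truncnS_gt (2^-1 / a)).
    rewrite ler_pdivlMr // mulrC -[X in X * _](gtr0_norm a0) -normrM ler_norml.
    by rewrite lek.
  move: hk; rewrite -[n.+1%:R]/(n.+1%:~R : R) -pmulrn -[_%:R]mulrz_nat ltr_int.
  rewrite natz ltr_norml => /andP[h1 h2].
  apply/mapP; exists `|(k + n.+1%:Z)%R|%N.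
    by rewrite mem_iota; lia.
  by lia.
apply: (@sub_finite_set _ _ [set` [seq (i, j) | i <- L, j <- L]]).
  move=> [i j] /andP[/= hi hj].
  have : (i, j) \in [seq (i, j) | i <- L, j <- L].
    by apply: allpairs_f; exact: memL.
  by [].
exact: finite_seq.
Qed.

Lemma mem_Qa (R : realType) (a : R) (x : site) :
  0 < a -> (x \in Qa a) = inQ a x.
Proof.
move=> a0; rewrite in_fset_set; last exact: finite_inQ.
by apply/idP/idP; rewrite inE.
Qed.

Definition edges (R : realType) (a : R) : {fset {fset site}} :=
  [fset [fset x; y] | x in Qa a, y in Qa a & nn x y]%fset.

Definition config (R : realType) (a : R) := {ffun edges a -> bool}.

(* State, in the wired extension of w, of the edge e of a Z^2. *)
Definition wired (R : realType) (a : R) (w : config a) (e : {fset site}) :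
    bool :=
  if insub e is Some b then w b else true.

Definition open_step (R : realType) (a : R) (w : config a) : rel site :=
  fun x y => nn x y && wired w [fset x; y]%fset.

Definition connected_in (R : realType) (a : R) (w : config a) (x y : site) :
    Prop :=
  exists2 p : seq site, path (open_step w) x p & last x p = y.

(* A cluster meeting Q^a is represented by its trace on Q^a, which determines
   it; connections may use vertices outside Q^a. *)
Definition cluster (R : realType) (a : R) (w : config a) (x : site) :
    {fset site} :=
  [fset y in Qa a | `[< connected_in w x y >]]%fset.

Definition clusters (R : realType) (a : R) (w : config a) :
    {fset {fset site}} :=
  [fset cluster w x | x in Qa a]%fset.

Definition bdry (R : realType) (a : R) : {fset site} :=
  [fset x in Qa a | has (fun y => y \notin Qa a) (nbrs x)]%fset.

(* Union over all clusters containing every boundary vertex: there is exactly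
   one such cluster, see boundary_clusterP. *)
Definition boundary_cluster (R : realType) (a : R) (w : config a) :
    {fset site} :=
  (\bigcup_(C <- clusters w | (bdry a `<=` C)%fset) C)%fset.

Lemma connected_refl (R : realType) (a : R) (w : config a) x :
  connected_in w x x.
Proof. by exists [::]. Qed.

Lemma connected_trans (R : realType) (a : R) (w : config a) x y z :
  connected_in w x y -> connected_in w y z -> connected_in w x z.
Proof.
move=> [p pp <-] [q qq <-]; exists (p ++ q); last by rewrite last_cat.
by rewrite cat_path pp.
Qed.

Lemma nn_sym x y : nn x y = nn y x.
Proof.
case: x y => [i j] [k l]; rewrite /nn !inE !xpair_eqE /=.
by apply/idP/idP; lia.
Qed.

Lemma open_step_sym (R : realType) (a : R) (w : config a) x y :
  open_step w x y = open_step w y x.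
Proof. by rewrite /open_step nn_sym fsetUC. Qed.

Lemma connected_sym (R : realType) (a : R) (w : config a) x y :
  connected_in w x y -> connected_in w y x.
Proof.
move=> [p]; elim: p x => [|z p IH] x /=; first by move=> _ ->; exact: connected_refl.
move=> /andP[xz zp] e; apply: connected_trans (IH _ zp e) _.
by exists [:: x] => //=; rewrite open_step_sym xz.
Qed.

Lemma edges_sub (R : realType) (a : R) x y :
  [fset x; y]%fset \in edges a -> x \in Qa a /\ y \in Qa a.
Proof.
move=> /imfset2P[u /= uQ [v /=]]; rewrite !inE /= => /andP[vQ _] /fsetP e.
split; [move: (e x)|move: (e y)]; rewrite !inE eqxx ?orbT /=;
  by move=> /esym /orP[] /eqP ->.
Qed.

Lemma outside_step (R : realType) (a : R) (w : config a) x y :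
  nn x y -> (x \notin Qa a) || (y \notin Qa a) -> connected_in w x y.
Proof.
move=> xy out; exists [:: y] => //=; rewrite andbT /open_step xy /wired /=.
case: insubP => // e /edges_sub[xQ yQ]; by rewrite xQ yQ in out.
Qed.

Lemma inQ_box (R : realType) (a : R) : 0 < a ->
  exists n : nat, forall x, inQ a x = (`|x.1| <= n%:Z) && (`|x.2| <= n%:Z).
Proof.
move=> a0; exists (Num.truncn (2^-1 / a)).
suff H (k : int) : (- 2^-1 <= a * k%:~R <= 2^-1) =
    (`|k| <= (Num.truncn (2^-1 / a))%:Z).
  by move=> x; rewrite /inQ !H.
rewrite -ler_norml normrM gtr0_norm // mulrC -ler_pdivlMr // -intr_norm.
rewrite -abszE pmulrn -[_ <= _%:Z]/(`|k|%N <= _)%N.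
by rewrite truncn_ge_nat // divr_ge0 // ltW.
Qed.

Lemma outside_connected (R : realType) (a : R) (w : config a) x y : 0 < a ->
  x \notin Qa a -> y \notin Qa a -> connected_in w x y.
Proof.
move=> a0; have [n Hn] := inQ_box a0.
have out u : (u \notin Qa a) = (`|u.1| > n%:Z) || (`|u.2| > n%:Z).
  by rewrite mem_Qa // Hn negb_and -!ltNge.
have hor (i k j : int) : `|j| > n%:Z -> connected_in w (i, j) (k, j).
  move=> hj; have up (m : int) (d : nat) : connected_in w (m, j) (m + d%:Z, j).
    elim: d => [|d IH]; first by rewrite addr0; exact: connected_refl.
    apply: connected_trans IH _; apply: outside_step.
      by rewrite /nn !inE !xpair_eqE /=; lia.
    by rewrite out /= hj orbT.
  have [ik|ki] := leP i k.
    by have := up i `|(k - i)%R|%N; rewrite (_ : i + _ = k) //; lia.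
  apply: connected_sym.
  by have := up k `|(i - k)%R|%N; rewrite (_ : k + _ = i) //; lia.
have ver (i j k : int) : `|i| > n%:Z -> connected_in w (i, j) (i, k).
  move=> hi; have up (m : int) (d : nat) : connected_in w (i, m) (i, m + d%:Z).
    elim: d => [|d IH]; first by rewrite addr0; exact: connected_refl.
    apply: connected_trans IH _; apply: outside_step.
      by rewrite /nn !inE !xpair_eqE /=; lia.
    by rewrite out /= hi.
  have [jk|kj] := leP j k.
    by have := up j `|(k - j)%R|%N; rewrite (_ : j + _ = k) //; lia.
  apply: connected_sym.
  by have := up k `|(j - k)%R|%N; rewrite (_ : k + _ = j) //; lia.
have toM u : u \notin Qa a -> connected_in w u (n.+1%:Z, n.+1%:Z).
  rewrite out; case: u => i j /= /orP[hi|hj].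
    by apply: connected_trans (ver i j n.+1%:Z hi) _; apply: hor; lia.
  by apply: connected_trans (hor i n.+1%:Z j hj) _; apply: ver; lia.
by move=> /toM xM /toM /connected_sym; exact: connected_trans.
Qed.

Lemma bdry_connected (R : realType) (a : R) (w : config a) x y : 0 < a ->
  x \in bdry a -> y \in bdry a -> connected_in w x y.
Proof.
move=> a0; rewrite !inE => /andP[_ /hasP[u xu uQ]] /andP[_ /hasP[v yv vQ]].
have xu' : connected_in w x u by apply: outside_step => //; rewrite uQ orbT.
have vy' : connected_in w y v by apply: outside_step => //; rewrite vQ orbT.
apply: connected_trans xu' _; apply: connected_trans (connected_sym vy').
exact: outside_connected.
Qed.

Lemma bdry_neq0 (R : realType) (a : R) : 0 < a -> exists x, x \in bdry a.
Proof.
move=> a0; have [n Hn] := inQ_box a0; exists (n%:Z, 0); rewrite !inE /=.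
rewrite mem_Qa // Hn /= ger0_norm // lexx normr0 /=.
by apply/orP; left; rewrite mem_Qa // Hn /=; lia.
Qed.

Lemma boundary_clusterP (R : realType) (a : R) (w : config a) : 0 < a ->
  [/\ boundary_cluster w \in clusters w,
      (bdry a `<=` boundary_cluster w)%fset &
      forall C, C \in clusters w -> (bdry a `<=` C)%fset ->
        C = boundary_cluster w].
Proof.
move=> a0; have [x0 x0b] := bdry_neq0 a0.
have x0Q : x0 \in Qa a by move: x0b; rewrite !inE => /andP[].
have C0in : cluster w x0 \in clusters w by apply/imfsetP; exists x0.
have C0b : (bdry a `<=` cluster w x0)%fset.
  apply/fsubsetP => y yb; rewrite !inE; apply/andP; split.
    by move: yb; rewrite !inE => /andP[].
  by apply/asboolP; exact: bdry_connected.
have uniqC C : C \in clusters w -> (bdry a `<=` C)%fset -> C = cluster w x0.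
  move=> /imfsetP[z /= zQ ->] /fsubsetP /(_ _ x0b).
  rewrite !inE => /andP[_ /asboolP zx0]; apply/fsetP => y; rewrite !inE.
  congr (_ && _); apply/asboolP/asboolP; apply: connected_trans => //.
  exact: connected_sym.
have -> : boundary_cluster w = cluster w x0.
  apply/fsetP => y; apply/bigfcupP/idP => [[C /andP[CC bC] yC]|yC].
    by rewrite -(uniqC C).
  by exists (cluster w x0) => //; rewrite C0in.
by split.
Qed.

Definition magscale (R : realType) (a : R) : R := a `^ (15 / 8).

Definition fk_weight (R : realType) (a h : R) (w : config a) : R :=
  (1 - expR (- 2 * beta_c R)) ^+ #|[set e | w e]| *
  expR (- 2 * beta_c R) ^+ #|[set e | ~~ w e]| *
  \prod_(C <- clusters w) (1 + expR (- 2 * h * magscale a * #|` C|%:R)).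

Definition fk_prob (R : realType) (a h : R) (w : config a) : R :=
  fk_weight h w / \sum_(w' : config a) fk_weight h w'.

Definition fk_E (R : realType) (a h : R) (f : config a -> R) : R :=
  \sum_(w : config a) f w * fk_prob h w.

Definition A0 (R : realType) (a : R) (w : config a) : R :=
  magscale a * #|` boundary_cluster w|%:R.

Definition spins (R : realType) (a : R) := {ffun Qa a -> bool}.

(* Value in {-1, 1} of the spin at x, with plus spins outside Q^a. *)
Definition spin (R : realType) (a : R) (s : spins a) (x : site) : R :=
  if insub x is Some v then (if s v then 1 else -1) else 1.

(* Minus the Hamiltonian; the second sum runs over the edges joining x in Q^a
   to y outside Q^a, where the spin at y is 1. *)
Definition ising_interaction (R : realType) (a : R) (s : spins a) : R :=
  \sum_(e <- edges a) \prod_(x <- e) spin s x +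
  \sum_(x <- Qa a) \sum_(y <- nbrs x | y \notin Qa a) spin s x * spin s y.

Definition ising_weight (R : realType) (a : R) (s : spins a) : R :=
  expR (beta_c R * ising_interaction s).

Definition ising_prob (R : realType) (a : R) (s : spins a) : R :=
  ising_weight s / \sum_(s' : spins a) ising_weight s'.

Definition ising_E (R : realType) (a : R) (f : spins a -> R) : R :=
  \sum_(s : spins a) f s * ising_prob s.

Definition mag (R : realType) (a : R) (s : spins a) : R :=
  magscale a * \sum_(x <- Qa a) spin s x.

(* Main.v *)
Require Import Defs.
From mathcomp Require Import all_boot all_order all_algebra finmap.
From mathcomp Require Import ring lra zify.
From mathcomp Require Import all_classical all_reals all_analysis.
Import Order.TTheory GRing.Theory Num.Theory.
Import numFieldNormedType.Exports.
Local Open Scope fset_scope.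
Local Open Scope ring_scope.

(** Write s = a^(15/8), u = t + h and H = s u.  Summing the random-cluster
weight over bond configurations that keep a given set of minus sites
disconnected from its complement (the Edwards-Sokal coupling) turns the wired
expectation into an Ising quantity: up to elementary monotonicity in the field
it is at most e^(H |boundary|) times the moment generating function, at H, of
the magnetization of the inner box with plus spins around it
([fk_E_le_mgf]).  In other words, it is the moment generating function of the
magnetization of Q^a with the spins of its outermost layer forced to be plus.
The assumed bound concerns plus spins one layer further out, so the spins of
that outermost layer are still random.  Forcing them can only increase the
moment generating function, hence the assumed bound does not apply directly,
and the factor 2 has to pay for forcing one layer.

Let n = 2k + 1 be the side of the box, f the logarithm of the moment
generating function at H for the plus box, f_free the same for free boundary
conditions, and g the mean total spin of the plus box in zero field.  Four
copies of the model, rotated by a Hadamard matrix, have nonnegative moments;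
this gives a third-difference inequality of Griffiths-Hurst-Sherman type
([ghs_third_difference]).  It makes forcing sites submodular, log-mgfs of
rectangles concave in the width, and f - f_free subadditive in H.
  - By submodularity the four sides of the frame may be forced one at a time,
    and by concavity each costs at most n H - f_free / n ([frame_bound]).
    Hence the wired log-mgf is at most f + 4 (n H - f_free / n), and if this
    cost is at most ln 2 the theorem follows from f <= C5 (u + u^2).
  - Otherwise, f <= f_free + g H by subadditivity ([log_full_le_inside]), and
    the assumed bound near zero gives s g <= C5 ([mean_spin_scale]), that is
    C5 (u + u^2) >= g H + g H^2 / s.  It remains to see that
    f_free + 4 (n H - f_free / n) <= ln 2 + g H^2 / s, where s is at most
    (n - 1)^(-15/8) because the box has side at most one.

There are three ranges of n.  For n = 3 and n = 5 the trivial bound H n^2 on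
the wired log-mgf is already at most ln 2 + g H + g H^2 / s
([small_box_regime]).  For moderate n, completing a square reduces the last
inequality to n^3 s <= g ln 2 ([square_completion]), which holds because at the critical temperature the
three outer rings alone contribute a linear amount to g ([mean_spin_rings],
[ring_regime]); this stops working when (n - 1)^(1/8) is about 3, since g is
bounded below only by a multiple of n.  For large n, f_free is controlled by
smaller boxes of side r about 20 (n - 1)^(1/8): log-mgfs per site decrease
with the size of the box, Hoeffding's inequality bounds the one of side r by
its mean spin, and the mean spin of the small box is at most 2 r / n times g,
up to rounding ([tile_regime], [mean_spin_tile]).

If Q^a is a single site, the wired expectation is at most e^H, and the assumed
bound is at least e^H / 2, the contribution of the plus configuration. *)

Set Implicit Arguments.
Unset Strict Implicit.
Unset Printing Implicit Defensive.

(** * Functions with nonnegative moments *)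

Section PositiveCone.
Variables (R : realType) (T S K : finType).
Variables (v : K -> S -> R) (rho : T -> S -> R).
Hypothesis moment_ge0 : forall (i : T) (e : K -> nat),
  0 <= \sum_(s : S) rho i s * \prod_(k : K) v k s ^+ e k.

Local Notation conf := {ffun T -> S}.

Definition monomial (e : T -> K -> nat) (w : conf) : R :=
  \prod_(i : T) \prod_(k : K) v k (w i) ^+ e i k.

Definition base_weight (w : conf) : R := \prod_(i : T) rho i (w i).

Definition moments_ge0 (f : conf -> R) : Prop :=
  forall e, 0 <= \sum_(w : conf) base_weight w * (f w * monomial e w).

(** The functions by which one may multiply without losing nonnegativity of
moments form a cone, closed under products and limits, and containing every
coordinate.  Closure under products is immediate in this form, whereas it
fails in general for nonnegativity of moments itself. *)
Definition pos_mult (f : conf -> R) : Prop :=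
  forall g, moments_ge0 g -> moments_ge0 (fun w => g w * f w).

Lemma moments1_ge0 : moments_ge0 (fun=> 1).
Proof.
move=> e.
rewrite (eq_bigr (fun w : conf =>
    \prod_i (rho i (w i) * \prod_k v k (w i) ^+ e i k))); last first.
  by move=> w _; rewrite mul1r /base_weight /monomial -big_split.
rewrite -(bigA_distr_bigA (fun i s => rho i s * \prod_k v k s ^+ e i k)).
by apply: prodr_ge0 => i _; exact: moment_ge0.
Qed.

Lemma pos_mult_expect_ge0 f :
  pos_mult f -> 0 <= \sum_(w : conf) base_weight w * f w.
Proof.
move=> /(_ _ moments1_ge0) /(_ (fun _ _ => 0%N)).
rewrite (eq_bigr (fun w => base_weight w * f w)) // => w _.
rewrite /monomial big1 ?mulr1 ?mul1r // => i _.
by rewrite big1 // => k _; rewrite expr0.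
Qed.

Lemma pos_mult_ext f g : (forall w, f w = g w) -> pos_mult f -> pos_mult g.
Proof. by move=> fg; rewrite (_ : g = f) //; apply/funext => w; rewrite fg. Qed.

Lemma pos_mult_var i k : pos_mult (fun w => v k (w i)).
Proof.
move=> g pg e.
have := pg (fun i' k' => e i' k' + ((i' == i) && (k' == k)))%N.
rewrite (eq_bigr (fun w =>
  base_weight w * (g w * v k (w i) * monomial e w))) // => w _.
rewrite -[g w * _ * _]mulrA; congr (_ * (_ * _)); rewrite /monomial.
rewrite (eq_bigr (fun i' => (if i' == i then v k (w i) else 1) *
    \prod_k' v k' (w i') ^+ e i' k')); last first.
  move=> i' _; case: eqP => [->|_] /=; last first.
    by rewrite mul1r; apply: eq_bigr => k' _; rewrite addn0.
  rewrite (bigD1 k) //= [in RHS](bigD1 k) //= eqxx exprD expr1 mulrA.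
  rewrite [v _ _ * _]mulrC; congr (_ * _).
  by apply: eq_bigr => k' /negPf ->; rewrite addn0.
by rewrite big_split /= -big_mkcond big_pred1_eq.
Qed.

Lemma pos_mult_mul f g : pos_mult f -> pos_mult g ->
  pos_mult (fun w => f w * g w).
Proof.
move=> pf pg h ph; have := pg _ (pf _ ph).
by congr moments_ge0; apply/funext => w; rewrite mulrA.
Qed.

Lemma pos_mult_add f g : pos_mult f -> pos_mult g ->
  pos_mult (fun w => f w + g w).
Proof.
move=> pf pg h ph e; have := addr_ge0 (pf _ ph e) (pg _ ph e).
rewrite -big_split /= (eq_bigr (fun w =>
  base_weight w * (h w * (f w + g w) * monomial e w))) // => w _; ring.
Qed.

Lemma pos_mult_scale c f : 0 <= c -> pos_mult f ->
  pos_mult (fun w => c * f w).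
Proof.
move=> c0 pf h ph e; have := mulr_ge0 c0 (pf _ ph e).
rewrite big_distrr /= (eq_bigr (fun w =>
  base_weight w * (h w * (c * f w) * monomial e w))) // => w _; ring.
Qed.

Lemma pos_mult1 : pos_mult (fun=> 1).
Proof.
by move=> h; congr moments_ge0; apply/funext => w; rewrite mulr1.
Qed.

Lemma pos_mult_const c : 0 <= c -> pos_mult (fun=> c).
Proof.
move=> c0; apply: (pos_mult_ext (f := fun=> c * 1)); first by move=> w; rewrite mulr1.
exact: pos_mult_scale pos_mult1.
Qed.

Lemma pos_mult_sum (I : Type) (r : seq I) (P : pred I) (F : I -> conf -> R) :
  (forall i, P i -> pos_mult (F i)) ->
  pos_mult (fun w => \sum_(i <- r | P i) F i w).
Proof.
move=> pF; elim: r => [|i r IH].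
  by apply: (pos_mult_ext (f := fun=> 0)) (pos_mult_const (lexx _)) => w;
    rewrite big_nil.
case Pi: (P i); last by apply: pos_mult_ext IH => w; rewrite big_cons Pi.
apply: pos_mult_ext (pos_mult_add (pF i Pi) IH) => w.
by rewrite big_cons Pi.
Qed.

Lemma pos_mult_exprn f n : pos_mult f -> pos_mult (fun w => f w ^+ n).
Proof.
move=> pf; elim: n => [|n IH].
  by apply: pos_mult_ext pos_mult1 => w; rewrite expr0.
by apply: pos_mult_ext (pos_mult_mul pf IH) => w; rewrite exprS.
Qed.

(** Moments are finite sums, so pointwise convergence suffices. *)
Lemma pos_mult_lim (F : nat -> conf -> R) f : (forall n, pos_mult (F n)) ->
  (forall w, (F n w @[n --> \oo] --> f w)%classic) -> pos_mult f.
Proof.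
move=> pF cF g pg e.
have cv : ((\sum_w base_weight w * (g w * F n w * monomial e w)) @[n --> \oo] -->
    (\sum_w base_weight w * (g w * f w * monomial e w)))%classic.
  apply: cvg_big; first exact: add_continuous.
  move=> w _; apply: cvgMr; apply: cvgMl; apply: cvgMr; exact: cF.
rewrite -(cvg_lim _ cv) //; apply: limr_ge; first by apply/cvg_ex; eexists; exact: cv.
by apply: nearW => n; exact: (pF n _ pg).
Qed.

Lemma expR_series_cvg (x : R) : (series (exp_coeff x) n @[n --> \oo] --> expR x)%classic.
Proof. exact: is_cvg_series_exp_coeff. Qed.

Lemma pos_mult_expR f : pos_mult f -> pos_mult (fun w => expR (f w)).
Proof.
move=> pf; apply: (@pos_mult_lim (fun n w => series (exp_coeff (f w)) n)).
  move=> n; apply: pos_mult_sum => k _; rewrite /exp_coeff.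
  apply: (pos_mult_ext (f := fun w => (k`!%:R)^-1 * f w ^+ k)).
    by move=> w; rewrite mulrC.
  apply: pos_mult_scale; last exact: pos_mult_exprn.
  by rewrite invr_ge0 ler0n.
by move=> w; exact: expR_series_cvg.
Qed.

(** Twice the hyperbolic sine: its power series has nonnegative coefficients,
unlike the one of exp (- f). *)
Lemma pos_mult_expRB f : pos_mult f ->
  pos_mult (fun w => expR (f w) - expR (- f w)).
Proof.
move=> pf; apply: (@pos_mult_lim (fun n w => series (exp_coeff (f w)) n -
    series (exp_coeff (- f w)) n)).
  move=> n; apply: (pos_mult_ext (f := fun w => \sum_(0 <= k < n)
      (if odd k then 2 * (k`!%:R)^-1 else 0) * f w ^+ k)); last first.
    apply: pos_mult_sum => k _; apply: pos_mult_scale; last exact: pos_mult_exprn.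
    by case: ifP => // _; rewrite mulr_ge0 // invr_ge0 ler0n.
  move=> w; rewrite /series /= -sumrB; apply: eq_bigr => k _.
  rewrite /exp_coeff /= [(- f w) ^+ k]exprNn.
  rewrite -[(-1) ^+ k]signr_odd; case: odd => /=; ring.
by move=> w; apply: cvgB; exact: expR_series_cvg.
Qed.

Lemma pos_mult_expRD f : pos_mult f ->
  pos_mult (fun w => expR (f w) + expR (- f w)).
Proof.
move=> pf; apply: (@pos_mult_lim (fun n w => series (exp_coeff (f w)) n +
    series (exp_coeff (- f w)) n)).
  move=> n; apply: (pos_mult_ext (f := fun w => \sum_(0 <= k < n)
      (if odd k then 0 else 2 * (k`!%:R)^-1) * f w ^+ k)); last first.
    apply: pos_mult_sum => k _; apply: pos_mult_scale; last exact: pos_mult_exprn.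
    by case: ifP => // _; rewrite mulr_ge0 // invr_ge0 ler0n.
  move=> w; rewrite /series /= -big_split /=; apply: eq_bigr => k _.
  rewrite /exp_coeff /= [(- f w) ^+ k]exprNn.
  rewrite -[(-1) ^+ k]signr_odd; case: odd => /=; ring.
by move=> w; apply: cvgD; exact: expR_series_cvg.
Qed.

End PositiveCone.

(** * Four rotated copies of a spin *)

Definition sg (R : realType) (b : bool) : R := if b then 1 else -1.

Lemma sum_ffun_pair (R : realType) (T A B : finType)
    (F : {ffun T -> A} -> {ffun T -> B} -> R) :
  \sum_f \sum_g F f g =
  \sum_(w : {ffun T -> A * B}) F [ffun i => (w i).1] [ffun i => (w i).2].
Proof.
rewrite pair_big /=.
rewrite (reindex (fun w : {ffun T -> A * B} =>
    ([ffun i => (w i).1], [ffun i => (w i).2]))) //=.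
exists (fun p : {ffun T -> A} * {ffun T -> B} => [ffun i => (p.1 i, p.2 i)]) => [w _|[f g] _].
  by apply/ffunP => i; rewrite !ffunE /=; case: (w i).
by congr pair; apply/ffunP => i; rewrite !ffunE.
Qed.

Definition four := ((bool * bool) * (bool * bool))%type.

Section FourCopies.
Variable R : realType.

(** An orthogonal change of coordinates on four spins.  The last row is the
opposite of the usual Hadamard row: with this sign, four coordinates that are
all nonzero have product 1, so that the all-odd moments are positive. *)
Definition hadamard (k : bool * bool) (s : four) : R :=
  let: ((s1, s2), (s3, s4)) := s in
  match k with
  | (false, false) => (sg R s1 + sg R s2 + sg R s3 + sg R s4) / 2
  | (false, true) => (sg R s1 + sg R s2 - sg R s3 - sg R s4) / 2
  | (true, false) => (sg R s1 - sg R s2 + sg R s3 - sg R s4) / 2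
  | (true, true) => (- sg R s1 + sg R s2 + sg R s3 - sg R s4) / 2
  end.

(** The indicator that a copy is plus where it is forced: u and v tell whether
the site lies in the first and in the second set, and the copies are forced on
the union, on the first set, on the second set, and nowhere. *)
Definition forced_weight (u v : bool) (s : four) : R :=
  (((u || v) ==> s.1.1) && (u ==> s.1.2) && (v ==> s.2.1))%:R.

(** A quadruple of spins with an even number of minus signs has a single nonzero
coordinate, equal to 2 or -2; otherwise all four coordinates are 1 or -1. *)
Lemma hadamard_table k s : hadamard k s =
  match k, s with
  | (false, false), ((true, true), (true, true)) => 2
  | (false, false), ((false, false), (false, false)) => -2
  | (false, true), ((true, true), (false, false)) => 2
  | (false, true), ((false, false), (true, true)) => -2
  | (true, false), ((true, false), (true, false)) => 2
  | (true, false), ((false, true), (false, true)) => -2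
  | (true, true), ((true, false), (false, true)) => -2
  | (true, true), ((false, true), (true, false)) => 2
  | (false, false), ((a, b), (c, d)) => if (a + b + c + d == 2)%N then 0 else
        if (a + b + c + d == 3)%N then 1 else -1
  | (false, true), ((a, b), (c, d)) => if a (+) b (+) c (+) d then
      (if (3 <= a + b + ~~ c + ~~ d)%N then 1 else -1) else 0
  | (true, false), ((a, b), (c, d)) => if a (+) b (+) c (+) d then
      (if (3 <= a + ~~ b + c + ~~ d)%N then 1 else -1) else 0
  | (true, true), ((a, b), (c, d)) => if a (+) b (+) c (+) d then
      (if (3 <= ~~ a + b + c + ~~ d)%N then 1 else -1) else 0
  end.
Proof.
by case: k s => [[] []] [[[] []] [[] []]]; rewrite /hadamard /sg /=; lra.
Qed.

Variant pow_spec (e : nat) : R -> R -> R -> R -> R -> Type :=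
| PowZero : pow_spec e 1 1 1 1 1
| PowEven x of 0 < x : pow_spec e 0 1 1 x x
| PowOdd x of 0 < x : pow_spec e 0 1 (-1) x (- x).

Lemma powP e : pow_spec e (0 ^+ e) (1 ^+ e) ((-1) ^+ e) (2 ^+ e) ((-2) ^+ e).
Proof.
rewrite expr0n expr1n [(-2) ^+ e]exprNn -signr_odd; case: e => [|e] /=.
  by rewrite !expr0 mulr1; exact: PowZero.
have x0 : 0 < 2 ^+ e.+1 :> R by rewrite exprn_gt0.
by case: (odd e); rewrite /= ?expr0 ?expr1 ?mulN1r ?mul1r; constructor.
Qed.

Lemma prod_bool2 (F : bool * bool -> R) :
  \prod_k F k = F (true, true) * F (true, false) * (F (false, true) * F (false, false)).
Proof.
rewrite (eq_bigr (fun p => F (p.1, p.2))); last by case.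
by rewrite -(pair_bigA _ (fun i j => F (i, j))) /= !big_bool.
Qed.

Lemma sum_four (F : four -> R) : \sum_s F s =
  \sum_(a : bool) \sum_(b : bool) \sum_(c : bool) \sum_(d : bool)
    F ((a, b), (c, d)).
Proof.
rewrite (eq_bigr (fun p => F (p.1, p.2))); last by case.
rewrite -(pair_bigA _ (fun i j => F (i, j))) /=.
rewrite (eq_bigr (fun p => \sum_j F ((p.1, p.2), j))); last by case.
rewrite -(pair_bigA _ (fun a b => \sum_j F ((a, b), j))) /=.
apply: eq_bigr => a _; apply: eq_bigr => b _.
rewrite (eq_bigr (fun p => F ((a, b), (p.1, p.2)))); last by case.
by rewrite -(pair_bigA _ (fun c d => F ((a, b), (c, d)))).
Qed.

(** The powers of 0, 1, - 1, 2 and - 2 depend, up to positive factors, only on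
whether the exponent vanishes and on its parity, so that each of the four
forcing patterns is a finite check. *)
Lemma four_moment_ge0 u v (e : bool * bool -> nat) :
  0 <= \sum_(s : four) forced_weight u v s * \prod_k hadamard k s ^+ e k.
Proof.
rewrite (eq_bigr _ (fun s _ => congr1 _ (prod_bool2 _))) sum_four !big_bool.
rewrite !hadamard_table /forced_weight /=.
case: (powP (e (false, false))) => [|? ?|? ?];
case: (powP (e (false, true))) => [|? ?|? ?];
case: (powP (e (true, false))) => [|? ?|? ?];
case: (powP (e (true, true))) => [|? ?|? ?]; case: u; case: v => /=; lra.
Qed.

End FourCopies.

(** * A third-difference inequality for Ising models *)

Section IsingModel.
Variables (R : realType) (T : finType).
Implicit Types (J : T -> T -> R) (h a b c : T -> R) (S : {set T}).

(** Each bond is counted twice, as (i, j) and as (j, i). *)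
Definition energy J h (s : {ffun T -> bool}) : R :=
  \sum_i \sum_j J i j * (sg R (s i) * sg R (s j)) + \sum_i h i * sg R (s i).

Definition plus_on S (s : {ffun T -> bool}) : R := \prod_i ((i \in S) ==> s i)%:R.

Definition partition J h S : R :=
  \sum_(s : {ffun T -> bool}) plus_on S s * expR (energy J h s).

(** The logarithm of the partition function has nonpositive mixed third
differences in the field, where forcing spins in S or in S' counts as an
infinite increment added to a or to b.  In Hadamard coordinates the two
products of four partition functions have the same energy up to the sign of
the term containing c, so that their difference is the expectation of an
exponential times a hyperbolic sine of functions with nonnegative
coefficients. *)
Lemma ghs_third_difference J h a b c S S' :
  (forall i j, 0 <= J i j) -> (forall i, 0 <= h i) ->
  (forall i, 0 <= a i) -> (forall i, 0 <= b i) -> (forall i, 0 <= c i) ->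
  partition J (fun i => h i + a i + b i + c i) (S :|: S') *
    partition J (fun i => h i + a i) S *
    (partition J (fun i => h i + b i) S' * partition J (fun i => h i + c i) finset.set0) <=
  partition J (fun i => h i + a i + b i) (S :|: S') *
    partition J (fun i => h i + a i + c i) S *
    (partition J (fun i => h i + b i + c i) S' * partition J h finset.set0).
Proof.
move=> J0 h0 a0 b0 c0.
pose sg1 (w : {ffun T -> four}) : {ffun T -> bool} := [ffun i => (w i).1.1].
pose sg2 (w : {ffun T -> four}) : {ffun T -> bool} := [ffun i => (w i).1.2].
pose sg3 (w : {ffun T -> four}) : {ffun T -> bool} := [ffun i => (w i).2.1].
pose sg4 (w : {ffun T -> four}) : {ffun T -> bool} := [ffun i => (w i).2.2].
have prod4 (F1 F2 F3 F4 : {ffun T -> bool} -> R) :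
    (\sum_s F1 s) * (\sum_s F2 s) * ((\sum_s F3 s) * (\sum_s F4 s)) =
    \sum_w F1 (sg1 w) * F2 (sg2 w) * (F3 (sg3 w) * F4 (sg4 w)).
  have prod2 (A B : finType) (G1 : {ffun T -> A} -> R) (G2 : {ffun T -> B} -> R) :
      (\sum_s G1 s) * (\sum_s G2 s) =
      \sum_(w : {ffun T -> A * B}) G1 [ffun i => (w i).1] * G2 [ffun i => (w i).2].
    rewrite big_distrl /= -(sum_ffun_pair (fun f g => G1 f * G2 g)).
    by apply: eq_bigr => s _; rewrite big_distrr.
  rewrite !prod2; apply: eq_bigr => w _.
  by congr (F1 _ * F2 _ * (F3 _ * F4 _)); apply/ffunP => i; rewrite !ffunE.
pose V k i (w : {ffun T -> four}) := hadamard R k (w i).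
pose f00 := (false, false); pose f01 := (false, true).
pose f10 := (true, false); pose f11 := (true, true).
pose Q w := \sum_i \sum_j J i j *
    (V f00 i w * V f00 j w + V f01 i w * V f01 j w +
     V f10 i w * V f10 j w + V f11 i w * V f11 j w) +
  \sum_i ((2 * h i + a i + b i + c i) * V f00 i w + a i * V f01 i w + b i * V f10 i w).
pose Rt w := \sum_i c i * V f11 i w.
pose rho i := forced_weight R (i \in S) (i \in S').
have rhoE w : base_weight rho w =
    plus_on (S :|: S') (sg1 w) * plus_on S (sg2 w) *
    (plus_on S' (sg3 w) * plus_on finset.set0 (sg4 w)).
  rewrite /base_weight /plus_on -!big_split /=; apply: eq_bigr => i _.
  rewrite !ffunE !inE /rho /forced_weight.
  case: (i \in S); case: (i \in S');
    case: (w i) => [[[] []] [[] []]] /=; ring.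
(* The left-hand fields put - c on the fourth coordinate, the right-hand ones + c. *)
have Vsum i w : sg R (sg1 w i) * (h i + a i + b i + c i) + sg R (sg2 w i) * (h i + a i) +
    (sg R (sg3 w i) * (h i + b i) + sg R (sg4 w i) * (h i + c i)) =
    (2 * h i + a i + b i + c i) * V f00 i w + a i * V f01 i w + b i * V f10 i w -
    c i * V f11 i w.
  rewrite !ffunE /V /hadamard /=; case: (w i) => [[s1 s2] [s3 s4]] /=; by field; rewrite ?pnatr_eq0.
have Vsum2 i w : sg R (sg1 w i) * (h i + a i + b i) + sg R (sg2 w i) * (h i + a i + c i) +
    (sg R (sg3 w i) * (h i + b i + c i) + sg R (sg4 w i) * h i) =
    (2 * h i + a i + b i + c i) * V f00 i w + a i * V f01 i w + b i * V f10 i w +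
    c i * V f11 i w.
  rewrite !ffunE /V /hadamard /=; case: (w i) => [[s1 s2] [s3 s4]] /=; by field; rewrite ?pnatr_eq0.
(* Orthogonality: the pair interactions keep their form in the new coordinates. *)
have Vpair i j w : sg R (sg1 w i) * sg R (sg1 w j) + sg R (sg2 w i) * sg R (sg2 w j) +
    (sg R (sg3 w i) * sg R (sg3 w j) + sg R (sg4 w i) * sg R (sg4 w j)) =
    V f00 i w * V f00 j w + V f01 i w * V f01 j w +
    V f10 i w * V f10 j w + V f11 i w * V f11 j w.
  rewrite !ffunE /V /hadamard /=; case: (w i) => [[s1 s2] [s3 s4]];
  case: (w j) => [[t1 t2] [t3 t4]] /=; by field; rewrite ?pnatr_eq0.
have Esum (h1 h2 h3 h4 : T -> R) w :
    energy J h1 (sg1 w) + energy J h2 (sg2 w) + (energy J h3 (sg3 w) + energy J h4 (sg4 w)) =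
    \sum_i \sum_j J i j *
    (V f00 i w * V f00 j w + V f01 i w * V f01 j w +
     V f10 i w * V f10 j w + V f11 i w * V f11 j w) +
    \sum_i (sg R (sg1 w i) * h1 i + sg R (sg2 w i) * h2 i +
      (sg R (sg3 w i) * h3 i + sg R (sg4 w i) * h4 i)).
  under eq_bigr => i _ do (under eq_bigr => j _ do rewrite -Vpair !mulrDr; rewrite !big_split).
  rewrite !big_split /energy /=.
  under [X in _ = _ + (X + _ + _)]eq_bigr => i _ do rewrite mulrC.
  under [X in _ = _ + (_ + X + _)]eq_bigr => i _ do rewrite mulrC.
  under [X in _ = _ + (_ + (X + _))]eq_bigr => i _ do rewrite mulrC.
  under [X in _ = _ + (_ + (_ + X))]eq_bigr => i _ do rewrite mulrC.
  ring.
have EL w : energy J (fun i => h i + a i + b i + c i) (sg1 w) +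
    energy J (fun i => h i + a i) (sg2 w) +
    (energy J (fun i => h i + b i) (sg3 w) + energy J (fun i => h i + c i) (sg4 w))
    = Q w - Rt w.
  by rewrite Esum (eq_bigr _ (fun i _ => Vsum i w)) sumrB addrA.
have ER w : energy J (fun i => h i + a i + b i) (sg1 w) +
    energy J (fun i => h i + a i + c i) (sg2 w) +
    (energy J (fun i => h i + b i + c i) (sg3 w) + energy J h (sg4 w))
    = Q w + Rt w.
  by rewrite Esum (eq_bigr _ (fun i _ => Vsum2 i w)) big_split /= addrA.
have collect (F1 F2 F3 F4 E1 E2 E3 E4 : R) :
    F1 * expR E1 * (F2 * expR E2) * (F3 * expR E3 * (F4 * expR E4)) =
    F1 * F2 * (F3 * F4) * expR (E1 + E2 + (E3 + E4)).
  rewrite !expRD; ring.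
rewrite /partition !prod4 -subr_ge0 -sumrB.
rewrite (eq_bigr (fun w => base_weight rho w *
    (expR (Q w) * (expR (Rt w) - expR (- Rt w))))); last first.
  by move=> w _; rewrite !collect -!rhoE EL ER !expRD; ring.
have pV k i : pos_mult (hadamard R) rho (V k i) by exact: pos_mult_var.
apply: (pos_mult_expect_ge0 (v := hadamard R)).
  by move=> i e; exact: four_moment_ge0.
apply: pos_mult_mul.
  apply/pos_mult_expR/pos_mult_add; apply: pos_mult_sum => i _.
    apply: pos_mult_sum => j _; apply: pos_mult_scale => //.
    by apply: pos_mult_add; [apply: pos_mult_add; [apply: pos_mult_add|]|]; exact: pos_mult_mul.
  by apply: pos_mult_add; [apply: pos_mult_add|]; apply: pos_mult_scale;
    rewrite ?addr_ge0 ?mulr_ge0.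
apply: pos_mult_expRB; apply: pos_mult_sum => i _; exact: pos_mult_scale.
Qed.
End IsingModel.

(** * Griffiths inequalities *)

Section Griffiths.
Variables (R : realType) (T : finType).
Implicit Types (P Q E : {ffun T -> bool} -> R).

Definition half_rotation (k : bool) (s : bool * bool) : R :=
  if k then (sg R s.1 - sg R s.2) / 2 else (sg R s.1 + sg R s.2) / 2.

Arguments half_rotation : simpl never.

Lemma half_rotation_table k a b : half_rotation k (a, b) =
  if a == b (+) k then (if a then 1 else -1) else 0.
Proof. by case: k a b => [] [] []; rewrite /half_rotation /sg /=; lra. Qed.

Lemma half_rotation_moment_ge0 (e : bool -> nat) :
  0 <= \sum_(s : bool * bool) 1 * \prod_k half_rotation k s ^+ e k.
Proof.
rewrite (eq_bigr (fun s => half_rotation true (s.1, s.2) ^+ e true *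
    half_rotation false (s.1, s.2) ^+ e false)); last first.
  by move=> [a b] _; rewrite mul1r big_bool.
rewrite -(pair_bigA _ (fun a b => half_rotation true (a, b) ^+ e true *
    half_rotation false (a, b) ^+ e false)) /= !big_bool !half_rotation_table /=.
by case: (powP R (e true)) => [|? ?|? ?]; case: (powP R (e false)) => [|? ?|? ?]; lra.
Qed.

Local Notation copies := {ffun T -> bool * bool}.
Definition copy1 (w : copies) : {ffun T -> bool} := [ffun i => (w i).1].
Definition copy2 (w : copies) : {ffun T -> bool} := [ffun i => (w i).2].

Local Notation pos2 := (pos_mult half_rotation (fun (_ : T) _ => 1)).

(** Ginibre's condition: half-sum and half-difference of the two copies belong to
the cone generated by the coordinates rotated by 45 degrees.  It covers spins
and energies at once and is stable under sums, products and exponentials. *)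
Definition ferro P : Prop :=
  pos2 (fun w => P (copy1 w) + P (copy2 w)) /\
  pos2 (fun w => P (copy1 w) - P (copy2 w)).

Lemma ferro_ext P Q : (forall s, P s = Q s) -> ferro P -> ferro Q.
Proof. by move=> PQ; rewrite (_ : Q = P) //; apply/funext => s; rewrite PQ. Qed.

Lemma ferro_const c : 0 <= c -> ferro (fun=> c).
Proof.
move=> c0; split; last by rewrite subrr; exact: pos_mult_const.
by apply: pos_mult_const; rewrite addr_ge0.
Qed.

Lemma ferro_spin i : ferro (fun s => sg R (s i)).
Proof.
split.
  apply: (pos_mult_ext (f := fun w => 2 * half_rotation false (w i))).
    by move=> w; rewrite /half_rotation !ffunE; field.
  by apply: pos_mult_scale => //; exact: pos_mult_var.
apply: (pos_mult_ext (f := fun w => 2 * half_rotation true (w i))).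
  by move=> w; rewrite /half_rotation !ffunE; field.
by apply: pos_mult_scale => //; exact: pos_mult_var.
Qed.

Lemma ferro_add P Q : ferro P -> ferro Q -> ferro (fun s => P s + Q s).
Proof.
move=> [p1 p2] [q1 q2]; split.
  by apply: pos_mult_ext (pos_mult_add p1 q1) => w; ring.
by apply: pos_mult_ext (pos_mult_add p2 q2) => w; ring.
Qed.

Lemma ferro_mul P Q : ferro P -> ferro Q -> ferro (fun s => P s * Q s).
Proof.
move=> [p1 p2] [q1 q2]; split.
  apply: pos_mult_ext (pos_mult_scale (c := 2^-1) _
    (pos_mult_add (pos_mult_mul p1 q1) (pos_mult_mul p2 q2))) => [w|];
  by [field | rewrite invr_ge0].
apply: pos_mult_ext (pos_mult_scale (c := 2^-1) _
    (pos_mult_add (pos_mult_mul p1 q2) (pos_mult_mul p2 q1))) => [w|];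
by [field | rewrite invr_ge0].
Qed.

Lemma ferro_scale c P : 0 <= c -> ferro P -> ferro (fun s => c * P s).
Proof. by move=> c0; exact/ferro_mul/ferro_const. Qed.

Lemma ferro_sum (I : Type) (r : seq I) (p : pred I) (F : I -> {ffun T -> bool} -> R) :
  (forall i, p i -> ferro (F i)) -> ferro (fun s => \sum_(i <- r | p i) F i s).
Proof.
move=> pF; elim: r => [|i r IH].
  by apply: ferro_ext (ferro_const (lexx _)) => s; rewrite big_nil.
case Pi: (p i); last by apply: ferro_ext IH => s; rewrite big_cons Pi.
by apply: ferro_ext (ferro_add (pF i Pi) IH) => s; rewrite big_cons Pi.
Qed.

Lemma ferro_expR P : ferro P -> ferro (fun s => expR (P s)).
Proof.
move=> [p1 p2].
have h0 : 0 <= 2^-1 :> R by rewrite invr_ge0.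
have P1 := pos_mult_expR (pos_mult_scale h0 p1).
have E1 (a b : R) : expR a = expR (2^-1 * (a + b)) * expR (2^-1 * (a - b)).
  by rewrite -expRD; congr expR; field.
have E2 (a b : R) : expR b = expR (2^-1 * (a + b)) * expR (- (2^-1 * (a - b))).
  by rewrite -expRD; congr expR; field.
split.
  apply: pos_mult_ext (pos_mult_mul P1 (pos_mult_expRD (pos_mult_scale h0 p2))) => w.
  by rewrite mulrDr -E1 -E2.
apply: pos_mult_ext (pos_mult_mul P1 (pos_mult_expRB (pos_mult_scale h0 p2))) => w.
by rewrite mulrBr -E1 -E2.
Qed.

Lemma two_copies P Q : (\sum_s P s) * (\sum_s Q s) =
  \sum_(w : copies) P (copy1 w) * Q (copy2 w).
Proof.
rewrite big_distrl /= -(sum_ffun_pair (fun f g => P f * Q g)).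
by apply: eq_bigr => s _; rewrite big_distrr.
Qed.

Lemma pos2_ge0 f : pos2 f -> 0 <= \sum_(w : copies) f w.
Proof.
move=> pf; have := pos_mult_expect_ge0 (fun _ => half_rotation_moment_ge0) pf.
rewrite (eq_bigr f) // => w _.
by rewrite /base_weight big1 ?mul1r.
Qed.

Lemma griffiths1 E P : ferro E -> ferro P -> 0 <= \sum_s expR (E s) * P s.
Proof.
move=> fE fP; have [p _] := ferro_mul (ferro_expR fE) fP.
have : 0 <= (\sum_s expR (E s) * P s) * (\sum_(s : {ffun T -> bool}) 1) *+ 2.
  rewrite mulr2n {2}[_ * \sum__ _]mulrC !two_copies -big_split /=.
  rewrite (eq_bigr (fun w => expR (E (copy1 w)) * P (copy1 w) +
    expR (E (copy2 w)) * P (copy2 w))); last by move=> w _; rewrite mulr1 mul1r.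
  exact: pos2_ge0.
rewrite pmulrn_lge0 // pmulr_lge0 // sumr_const; by rewrite ltr0n card_ffun card_bool expn_gt0.
Qed.

(** Duplicate the system: the truncated correlation is half the expectation of
(P - P') (Q - Q'). *)
Lemma griffiths2 E P Q : ferro E -> ferro P -> ferro Q ->
  (\sum_s expR (E s) * P s) * (\sum_s expR (E s) * Q s) <=
  (\sum_s expR (E s)) * (\sum_s expR (E s) * (P s * Q s)).
Proof.
move=> [fE _] [_ fP] [_ fQ].
have := pos2_ge0 (pos_mult_mul (pos_mult_expR fE) (pos_mult_mul fP fQ)).
pose X := (\sum_s expR (E s)) * (\sum_s expR (E s) * (P s * Q s)).
pose Y := (\sum_s expR (E s) * P s) * (\sum_s expR (E s) * Q s).
rewrite (_ : \sum_ _ _ = X *+ 2 - Y *+ 2); last first.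
  rewrite {1}/X {1}/Y !mulr2n {1}[_ * \sum_s expR _ * (_ * _)]mulrC
    {1}[_ * \sum_s expR _ * Q _]mulrC !two_copies -!big_split /= -sumrB.
  by apply: eq_bigr => w _; rewrite expRD; ring.
by rewrite -mulrnBl pmulrn_lge0 // subr_ge0.
Qed.

End Griffiths.

(** * The Ising model on a region of the lattice *)

Lemma uniq_nbrs x : uniq (nbrs x).
Proof.
case: x => i j; rewrite /nbrs /= !inE !xpair_eqE.
by rewrite !negb_or !negb_and; lia.
Qed.

Lemma nn_neq x y : nn x y -> x != y.
Proof.
move=> nxy; apply/eqP => E; move: nxy; rewrite E /nn; case: y {E} => p q.
by rewrite !inE !xpair_eqE /=; lia.
Qed.

Definition minus_set (X : {fset site}) (s : {ffun X -> bool}) : {fset site} :=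
  [fset x in X | ~~ (if insub x is Some v then s v else true)].

Lemma in_minus_set (X : {fset site}) (s : {ffun X -> bool}) (i : X) :
  (val i \in minus_set s) = ~~ s i.
Proof. by rewrite !inE (valP i) valK. Qed.

Lemma minus_set_sub (X : {fset site}) (s : {ffun X -> bool}) : minus_set s `<=` X.
Proof. by apply/fsubsetP => x; rewrite !inE => /andP[]. Qed.

Lemma sum_fpowerset (R : realType) (X : {fset site}) (F : {fset site} -> R) :
  \sum_(A <- fpowerset X) F A = \sum_(s : {ffun X -> bool}) F (minus_set s).
Proof.
rewrite -[RHS](big_map (@minus_set X) xpredT F); apply: perm_big.
have inj : injective (@minus_set X).
  move=> s t /fsetP st; apply/ffunP => i; move: (st (val i)).
  by rewrite !in_minus_set => /negb_inj.
apply: uniq_perm.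
- exact: fset_uniq.
- by rewrite map_inj_uniq ?index_enum_uniq.
move=> A; rewrite fpowersetE; apply/idP/mapP => [AX|[s _ ->]]; last exact: minus_set_sub.
exists [ffun i : X => val i \notin A]; first by rewrite mem_index_enum.
apply/fsetP => x; rewrite !inE; case: insubP => [v _ <-|]; last first.
  by move=> xX; rewrite (negPf xX); apply/negP => /(fsubsetP AX); exact/negP.
by rewrite (valP v) ffunE negbK.
Qed.

Section Region.
Variables (R : realType) (b : R) (c : rel site).

(** Unsatisfied bonds, when A is the set of minus sites and every site outside
the region is plus.  The relation c selects the bonds that are present: with
all bonds this is the plus boundary condition, and with the bonds inside the
region the free one. *)
Definition disagreements (A : {fset site}) : nat :=
  (\sum_(x <- A) count (fun y => (y \notin A) && c x y) (nbrs x))%N.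

Definition weight (A : {fset site}) : R := expR (- 2 * b * (disagreements A)%:R).

Definition total_spin (X A : {fset site}) : R := #|` X|%:R - 2 * #|` A|%:R.

Definition pf (X : {fset site}) (H : R) : R :=
  \sum_(A <- fpowerset X) weight A * expR (H * total_spin X A).

Definition coupling (X : {fset site}) (i j : X) : R :=
  b / 2 * (nn (val i) (val j) && c (val i) (val j))%:R.

Definition bfield (X : {fset site}) (i : X) : R :=
  b * (count (fun y => (y \notin X) && c (val i) y) (nbrs (val i)))%:R.

(** The energy of the all-plus configuration, which the weights, normalized to be
1 there, leave out. *)
Definition base_energy (X : {fset site}) : R :=
  \sum_(i : X) \sum_(j : X) coupling i j + \sum_(i : X) bfield i.

Hypothesis c_sym : symmetric c.

Lemma sum_minus_set (X : {fset site}) (s : {ffun X -> bool}) (F : site -> R) :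
  \sum_(x <- minus_set s) F x = \sum_(i : X) (~~ s i)%:R * F (val i).
Proof.
rewrite (eq_bigr (fun i : X => if ~~ s i then F (val i) else 0)); last first.
  by move=> i _; case: (s i); rewrite /= ?mul0r ?mul1r.
rewrite -big_mkcond /= (eq_bigl (fun i : X => val i \in minus_set s)); last first.
  by move=> i; rewrite in_minus_set.
rewrite -(big_seq_fsetE _ _ (fun x => x \in minus_set s) F) -[RHS]big_filter.
apply: perm_big; apply: uniq_perm; rewrite ?filter_uniq ?fset_uniq //.
move=> x; rewrite mem_filter; apply/idP/andP => [xs|[]//].
by split=> //; exact: (fsubsetP (minus_set_sub s)).
Qed.

Lemma count_nbrs (X : {fset site}) (x : site) (p : pred site) :
  (count (fun y => (y \in X) && p y) (nbrs x))%:R =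
  \sum_(j : X) (nn x (val j) && p (val j))%:R :> R.
Proof.
rewrite -natr_sum; congr (_%:R).
rewrite -(big_seq_fsetE _ X xpredT (fun y => nat_of_bool (nn x y && p y))).
rewrite -sum1_count.
rewrite [RHS](eq_bigr (fun y => if nn x y && p y then 1 else 0)%N); last first.
  by move=> y _; case: (nn x y && p y).
rewrite -[RHS]big_mkcond -big_filter -[RHS]big_filter; apply: perm_big; apply: uniq_perm.
- by rewrite filter_uniq ?uniq_nbrs.
- by rewrite filter_uniq ?fset_uniq.
by move=> y; rewrite !mem_filter /nn; case: (y \in X); case: (p y); case: (y \in nbrs x).
Qed.

(** The indicator that x is minus and y is plus has a part symmetric in x and y,
which gives the pair energy, and an antisymmetric part, which cancels in the
sum over ordered pairs. *)
Lemma weight_energy (X : {fset site}) (s : {ffun X -> bool}) :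
  weight (minus_set s) =
  expR (- base_energy X) * expR (energy (@coupling X) (@bfield X) s).
Proof.
rewrite -expRD /weight; congr expR.
rewrite /disagreements natr_sum sum_minus_set.
pose N (i j : X) : R := (nn (val i) (val j) && c (val i) (val j))%:R.
pose D (i : X) : R := (count (fun y => (y \notin X) && c (val i) y) (nbrs (val i)))%:R.
have cnt (i : X) : (count (fun y => (y \notin minus_set s) && c (val i) y) (nbrs (val i)))%:R
    = \sum_(j : X) (s j)%:R * N i j + D i.
  rewrite (eq_bigr (fun j : X => (nn (val i) (val j) &&
      ((val j \notin minus_set s) && c (val i) (val j)))%:R)); last first.
    by move=> j _; rewrite in_minus_set negbK /N; case: (s j); case: nn; case: c;
      rewrite /= ?mul0r ?mul1r.
  rewrite -(count_nbrs _ _ (fun y => (y \notin minus_set s) && c (val i) y)) /D -natrD.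
  congr (_%:R); rewrite -count_predUI [X in (_ + X)%N](eq_count (a2 := pred0)).
    rewrite count_pred0 addn0; apply: eq_count => y /=.
    case yX: (y \in X) => //=; first by rewrite orbF.
    by rewrite (_ : y \notin _) //; apply/negP => /(fsubsetP (minus_set_sub s)); rewrite yX.
  by move=> y /=; case: (y \in X); rewrite ?andbF.
have Nsym i j : N i j = N j i by rewrite /N nn_sym c_sym.
pose sp (i : X) := sg R (s i).
have neg i : (~~ s i)%:R = (1 - sp i) / 2 by rewrite /sp /sg; case: (s i) => /=; lra.
have pos i : (s i)%:R = (1 + sp i) / 2 by rewrite /sp /sg; case: (s i) => /=; lra.
(* The product of (1 - sp i) / 2 and (1 + sp j) / 2, split into its parts symmetric and antisymmetric in i, j. *)
rewrite (eq_bigr (fun i => \sum_j ((1 - sp i * sp j) / 4 * N i j +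
    (sp j - sp i) / 4 * N i j) + (1 - sp i) / 2 * D i)); last first.
  move=> i _; rewrite cnt mulrDr big_distrr /= neg; congr (_ + _).
  by apply: eq_bigr => j _; rewrite pos; field.
rewrite big_split /=.
have -> : \sum_i \sum_j ((1 - sp i * sp j) / 4 * N i j + (sp j - sp i) / 4 * N i j) =
    \sum_i \sum_j ((1 - sp i * sp j) / 4 * N i j).
  under eq_bigr do rewrite big_split.
  rewrite big_split /= -[RHS]addr0; congr (_ + _).
  have : \sum_i \sum_j ((sp j - sp i) / 4 * N i j) =
      - \sum_i \sum_j ((sp j - sp i) / 4 * N i j).
    rewrite {1}exchange_big /= -sumrN; apply: eq_bigr => i _; rewrite -sumrN.
    by apply: eq_bigr => j _; rewrite Nsym; ring.
  by lra.
rewrite /energy /base_energy [in RHS]opprD [RHS]addrACA mulrDr; congr (_ + _).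
  rewrite -sumrN -big_split big_distrr /=; apply: eq_bigr => i _.
  rewrite -sumrN -big_split big_distrr /=; apply: eq_bigr => j _.
  by rewrite /coupling -/(N i j) -/(sp i) -/(sp j); field.
rewrite -sumrN -big_split big_distrr /=; apply: eq_bigr => i _.
by rewrite /bfield -/(D i) -/(sp i); field.
Qed.

Lemma card_minus_set (X : {fset site}) (s : {ffun X -> bool}) :
  #|` minus_set s|%:R = \sum_(i : X) (~~ s i)%:R :> R.
Proof.
rewrite card_fset_sum1 natr_sum sum_minus_set.
by apply: eq_bigr => i _; rewrite mulr1.
Qed.

Lemma total_spin_minus_set (X : {fset site}) (s : {ffun X -> bool}) :
  total_spin X (minus_set s) = \sum_(i : X) sg R (s i).
Proof.
rewrite /total_spin card_minus_set card_fset_sum1 natr_sum.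
rewrite (big_seq_fsetE _ X xpredT (fun=> 1)) big_distrr -sumrB /=.
by apply: eq_bigr => i _; rewrite /sg; case: (s i); rewrite /=; ring.
Qed.

Definition sites_in (X S : {fset site}) : {set X} := finset (fun i : X => val i \in S).

Lemma plus_on_forced (X S : {fset site}) (s : {ffun X -> bool}) : S `<=` X ->
  plus_on R (sites_in X S) s = (minus_set s `<=` X `\` S)%:R.
Proof.
move=> SX; rewrite /plus_on; case: (boolP (_ `<=` _)) => [/fsubsetP sub|].
  apply: big1 => i _; rewrite inE; case: implyP => // ns; exfalso; apply: ns => iS.
  apply/negPn/negP; rewrite -in_minus_set => /sub; rewrite inE iS //.
move=> /fsubsetPn[x xs xXS].
have xX : x \in X := fsubsetP (minus_set_sub s) _ xs.
have xS : x \in S by move: xXS; rewrite inE xX andbT negbK.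
rewrite (bigD1 [` xX]) //= inE /= xS /=.
by move: xs; rewrite -[x]/(val [` xX]) in_minus_set => /negPf ->; rewrite mul0r.
Qed.

Lemma total_spin_forced (X S A : {fset site}) : S `<=` X ->
  total_spin X A = #|` S|%:R + total_spin (X `\` S) A.
Proof.
move=> SX; rewrite /total_spin addrA -natrD; congr (_%:R - _).
by rewrite -[in LHS](cardfsID S X) (fsetIidPr SX).
Qed.

(** Forcing the sites of S to be plus amounts to working in the complement of S,
since sites outside the region are plus.  This is why a smaller box with plus
boundary is a box with a forced frame. *)
Lemma pf_partition (X S : {fset site}) H : S `<=` X ->
  expR (H * #|` S|%:R) * pf (X `\` S) H =
  expR (- base_energy X) *
    partition (@coupling X) (fun i => bfield i + H) (sites_in X S).
Proof.
move=> SX; rewrite /pf /partition !big_distrr /=.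
pose F A := (A `<=` X `\` S)%:R * (weight A * expR (H * total_spin X A)).
transitivity (\sum_(A <- fpowerset (X `\` S)) F A).
  apply: eq_big_seq => A; rewrite fpowersetE /F => ->.
  by rewrite mul1r (total_spin_forced _ SX) [in RHS]mulrDr [in RHS]expRD; ring.
rewrite (big_fset_incl _ (B := fpowerset X)); last 2 first.
- by rewrite fpowersetS fsubsetDl.
- by move=> A _; rewrite fpowersetE /F => /negPf ->; rewrite mul0r.
rewrite sum_fpowerset; apply: eq_bigr => s _.
rewrite /F plus_on_forced // weight_energy total_spin_minus_set.
have -> : energy (@coupling X) (fun i => bfield i + H) s =
    energy (@coupling X) (@bfield X) s + H * \sum_i sg R (s i).
  rewrite /energy -addrA; congr (_ + _); rewrite big_distrr -big_split /=.
  by apply: eq_bigr => i _; rewrite mulrDl.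
by rewrite expRD; ring.
Qed.

End Region.

(** * Moment generating functions of the magnetization *)

Lemma ratio_le (R : realType) (x y z w p q r s : R) :
  0 < p -> 0 < q -> 0 < r -> 0 < s ->
  x * y * (p * q) <= z * w * (r * s) -> x / r * (y / s) <= z / p * (w / q).
Proof.
move=> p0 q0 r0 s0 le; rewrite !mulf_div ler_pdivrMr ?mulr_gt0 //.
by rewrite mulrAC ler_pdivlMr ?mulr_gt0.
Qed.

Lemma le_eq2 (R : realType) (x y z w : R) : x = z -> y = w -> x <= y -> z <= w.
Proof. by move=> -> ->. Qed.

Section Mgf.
Variables (R : realType) (b : R).
Hypothesis b_ge0 : 0 <= b.
Implicit Types (c : rel site) (X S A : {fset site}).

Definition mgf c X (H : R) : R := pf b c X H / pf b c X 0.

Definition mean_spin c X : R :=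
  (\sum_(A <- fpowerset X) weight b c A * total_spin R X A) / pf b c X 0.

Definition full : rel site := fun _ _ => true.
Definition inside X : rel site := fun x y => (x \in X) && (y \in X).

Lemma full_sym : symmetric full. Proof. by []. Qed.
Lemma inside_sym X : symmetric (inside X). Proof. by move=> x y; rewrite /inside andbC. Qed.

Lemma pf_gt0 c X H : 0 < pf b c X H.
Proof.
rewrite /pf (big_fsetD1 fset0) ?fpowersetE ?fsub0set //=.
apply: ltr_wpDr; last by rewrite mulr_gt0 ?expR_gt0.
by apply: sumr_ge0 => A _; rewrite mulr_ge0 ?expR_ge0.
Qed.
Hint Resolve pf_gt0 : core.

Lemma mgf_gt0 c X H : 0 < mgf c X H.
Proof. by rewrite divr_gt0. Qed.

Lemma mgf_fset0 c H : mgf c fset0 H = 1.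
Proof.
have pfE v : pf b c fset0 v = pf b c fset0 0.
  by rewrite /pf fpowerset0 !big_seq_fset1 /total_spin cardfs0 mulr0 subr0 !mulr0.
by rewrite /mgf pfE divff // gt_eqF.
Qed.

Lemma coupling_ge0 c X (i j : X) : 0 <= coupling b c i j.
Proof. by rewrite !mulr_ge0 ?invr_ge0. Qed.

Lemma bfield_ge0 c X (i : X) : 0 <= bfield b c i.
Proof. by rewrite mulr_ge0. Qed.

Lemma partition_forced c X S H : symmetric c -> S `<=` X ->
  partition (coupling b c (X := X)) (fun i => bfield b c i + H) (sites_in X S) =
  expR (base_energy b c X) * (expR (H * #|` S|%:R) * pf b c (X `\` S) H).
Proof.
move=> cs SX; rewrite pf_partition // mulrA -expRD addrN expR0 mul1r //.
Qed.

Lemma sites_in0 X : sites_in X fset0 = finset.set0.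
Proof. by apply/setP => i; rewrite !inE. Qed.

Lemma sites_inU X S S' : sites_in X (S `|` S') = sites_in X S :|: sites_in X S'.
Proof. by apply/setP => i; rewrite !inE. Qed.

Lemma partition_free c X H : symmetric c ->
  partition (coupling b c (X := X)) (fun i => bfield b c i + H) finset.set0 =
  expR (base_energy b c X) * pf b c X H.
Proof.
move=> cs; rewrite -sites_in0 partition_forced ?fsub0set //.
by rewrite cardfs0 mulr0 expR0 mul1r fsetD0.
Qed.

Lemma eq_partition (T : finType) (J : T -> T -> R) (h h' : T -> R) (S : {set T}) : h =1 h' ->
  partition J h S = partition J h' S.
Proof. by move=> hh; congr partition; apply/funext. Qed.

(** The third-difference inequality with a uniform field as third increment: it
compares values at H with values at 0, hence moment generating functions. *)
Lemma ghs_uniform_field (T : finType) (J : T -> T -> R) (k0 k1 k2 k12 : T -> R) H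
    (S S' : {set T}) :
  (forall i j, 0 <= J i j) -> (forall i, 0 <= k0 i) -> (forall i, k0 i <= k1 i) ->
  (forall i, k0 i <= k2 i) -> (forall i, k12 i = k1 i + k2 i - k0 i) -> 0 <= H ->
  partition J (fun i => k12 i + H) (S :|: S') * partition J (fun i => k0 i + H) finset.set0 *
    (partition J (fun i => k1 i + 0) S * partition J (fun i => k2 i + 0) S') <=
  partition J (fun i => k1 i + H) S * partition J (fun i => k2 i + H) S' *
    (partition J (fun i => k12 i + 0) (S :|: S') * partition J (fun i => k0 i + 0) finset.set0).
Proof.
move=> J0 k0_ge0 k01 k02 k12E H0.
have := @ghs_third_difference R T J k0 (fun i => k1 i - k0 i) (fun i => k2 i - k0 i)
  (fun=> H) S S' J0 k0_ge0.
move=> /(_ (fun i => _)) ghs.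
have {ghs} := ghs (fun i => ltac:(by rewrite subr_ge0)) (fun i => ltac:(by rewrite subr_ge0))
  (fun=> H0).
rewrite (eq_partition J (S :|: S') (h' := fun i => k12 i + H)); last first.
  by move=> i; rewrite k12E; ring.
rewrite (eq_partition J S (h' := fun i => k1 i + 0)); last by move=> i; ring.
rewrite (eq_partition J S' (h' := fun i => k2 i + 0)); last by move=> i; ring.
rewrite [X in _ <= X * _ * _](eq_partition J _ (h' := fun i => k12 i + 0)); last first.
  by move=> i; rewrite k12E; ring.
rewrite [X in _ <= _ * X * _](eq_partition J _ (h' := fun i => k1 i + H)); last by move=> i; ring.
rewrite [X in _ <= _ * (X * _)](eq_partition J _ (h' := fun i => k2 i + H)); last by move=> i; ring.
rewrite [X in _ <= _ * (_ * X)](eq_partition J _ (h' := fun i => k0 i + 0)); last by move=> i; ring.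
set P1 := partition _ _ _; set P2 := partition _ _ _; set P3 := partition _ _ _.
set P4 := partition _ _ _; set P5 := partition _ _ _; set P6 := partition _ _ _.
set P7 := partition _ _ _; set P8 := partition _ _ _.
by move=> le; have -> : P1 * P4 * (P2 * P3) = P1 * P2 * (P3 * P4); [ring|];
  apply: le_trans le _; rewrite le_eqVlt; apply/orP; left; apply/eqP; ring.
Qed.

Lemma mgf_forced_submodular c X S S' H : symmetric c -> 0 <= H ->
  S `<=` X -> S' `<=` X ->
  expR (H * #|` S `|` S'|%:R) * mgf c (X `\` (S `|` S')) H * mgf c X H <=
  (expR (H * #|` S|%:R) * mgf c (X `\` S) H) *
  (expR (H * #|` S'|%:R) * mgf c (X `\` S') H).
Proof.
move=> cs H0 SX SX'; have UX : S `|` S' `<=` X by rewrite fsubUset SX.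
have := @ghs_uniform_field _ _ (@bfield R b c X) (@bfield R b c X)
  (@bfield R b c X) (@bfield R b c X) H (sites_in X S) (sites_in X S')
  (@coupling_ge0 c X) (@bfield_ge0 c X) (fun=> lexx _) (fun=> lexx _) _ H0.
rewrite -sites_inU !partition_forced // !partition_free //.
move=> /(_ (fun i => esym (addrK _ _))).
rewrite /mgf !mul0r !expR0 !mul1r.
set K := expR (base_energy _ _ _); have K0 : 0 < K by exact: expR_gt0.
rewrite (_ : K * _ * _ * _ = K ^+ 4 * (expR (H * #|` S `|` S'|%:R) *
   pf b c (X `\` (S `|` S')) H * pf b c X H * (pf b c (X `\` S) 0 * pf b c (X `\` S') 0))); last by ring.
rewrite (_ : K * _ * _ * _ = K ^+ 4 * (expR (H * #|` S|%:R) *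
   pf b c (X `\` S) H * (expR (H * #|` S'|%:R) * pf b c (X `\` S') H) *
    (pf b c (X `\` (S `|` S')) 0 * pf b c X 0))); last by ring.
rewrite ler_pM2l ?exprn_gt0 // => le.
by rewrite ![expR _ * (_ / _)]mulrA; apply: ratio_le.
Qed.

(** Plus boundary conditions on two complementary parts of the boundary are the
two increments; in the use below c1 keeps the bonds through the top and bottom
sides and c2 those through the left and right sides. *)
Lemma mgf_boundary_submodular c1 c2 X H : symmetric c1 -> symmetric c2 -> 0 <= H ->
  {in X &, forall x y, nn x y -> c1 x y && c2 x y} ->
  (forall x y, x \in X -> y \notin X -> nn x y -> c1 x y (+) c2 x y) ->
  mgf full X H * mgf (inside X) X H <= mgf c1 X H * mgf c2 X H.
Proof.
move=> s1 s2 H0 cin cout.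
have b0 (i : X) : bfield b (inside X) i = 0.
  rewrite /bfield (eq_count (a2 := pred0)) ?count_pred0 ?mulr0 // => y /=.
  by rewrite /inside (valP i) /=; case: (y \in X).
have bE (i : X) : bfield b full i = bfield b c1 i + bfield b c2 i - bfield b (inside X) i.
  rewrite b0 subr0 /bfield -mulrDr -natrD -count_predUI; congr (_ * _%:R).
  rewrite [X in (_ + X)%N](_ : _ = 0%N) ?addn0; last first.
    apply/eqP; rewrite -leqn0 leqNgt -has_count; apply/hasPn => y yi /=.
    case yX: (y \in X) => //=.
    by move: (cout _ _ (valP i) (negbT yX) yi); case: (c1 _ _); case: (c2 _ _).
  apply: eq_in_count => y yi /=; case yX: (y \in X) => //=.
  by move: (cout _ _ (valP i) (negbT yX) yi); case: (c1 _ _); case: (c2 _ _).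
have cpl c : {in X &, forall x y, nn x y -> c x y} ->
    coupling b c (X := X) = coupling b full (X := X).
  move=> cX; apply/funext => i; apply/funext => j; rewrite /coupling /full.
  by case nij: (nn (val i) (val j)) => //=; rewrite (cX _ _ (valP i) (valP j) nij).
have in1 : {in X &, forall x y, nn x y -> c1 x y}.
  by move=> x y xX yX /(cin _ _ xX yX) /andP[].
have in2 : {in X &, forall x y, nn x y -> c2 x y}.
  by move=> x y xX yX /(cin _ _ xX yX) /andP[].
have in0 : {in X &, forall x y, nn x y -> inside X x y}.
  by move=> x y xX yX _; rewrite /inside xX.
have := @ghs_uniform_field _ (coupling b full (X := X)) (@bfield R b (inside X) X) (@bfield R b c1 X)
  (@bfield R b c2 X) (@bfield R b full X) H finset.set0 finset.set0
  (@coupling_ge0 full X) (@bfield_ge0 _ X) _ _ bE H0.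
have le0 c : forall i : X, bfield b (inside X) i <= bfield b c i.
  by move=> i; rewrite b0; exact: bfield_ge0.
move=> /(_ (le0 _) (le0 _)); rewrite finset.setU0.
rewrite !(partition_free _ _ full_sym).
rewrite -{1 6}(cpl _ in0) -{1 3}(cpl _ in1) -(cpl _ in2).
rewrite !partition_free //; try exact: inside_sym.
set K1 := expR _; set K2 := expR _; set K3 := expR _; set K4 := expR _ => le.
rewrite /mgf; apply: ratio_le => //.
have K0 : 0 < K1 * K2 * (K3 * K4) by rewrite !mulr_gt0 ?expR_gt0.
by rewrite -(ler_pM2l K0); apply: (le_eq2 _ _ le); ring.
Qed.

(** The boundary field and a uniform field H' are the two increments here. *)
Lemma mgf_full_inside_subadditive X H H' : 0 <= H -> 0 <= H' ->
  mgf full X (H + H') * (mgf (inside X) X H * mgf (inside X) X H') <=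
  mgf full X H * mgf full X H' * mgf (inside X) X (H + H').
Proof.
move=> H0 H'0.
have b0 (i : X) : bfield b (inside X) i = 0.
  rewrite /bfield (eq_count (a2 := pred0)) ?count_pred0 ?mulr0 // => y /=.
  by rewrite /inside (valP i) /=; case: (y \in X).
have cplE : coupling b (inside X) (X := X) = coupling b full (X := X).
  apply/funext => i; apply/funext => j; rewrite /coupling /full.
  by rewrite /inside (valP i) (valP j).
have := @ghs_uniform_field _ (coupling b full (X := X)) (@bfield R b (inside X) X)
  (@bfield R b full X) (fun=> H') (fun i => bfield b full i + H') H finset.set0 finset.set0
  (@coupling_ge0 full X) (@bfield_ge0 _ X) _ _ _ H0.
have le1 (i : X) : bfield b (inside X) i <= bfield b full i by rewrite b0 bfield_ge0.
have le2 (i : X) : bfield b (inside X) i <= H' by rewrite b0.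
move=> /(_ le1 le2 (fun i => ltac:(by rewrite b0 subr0))); rewrite finset.setU0.
have addf (f : X -> R) x y : (fun i => f i + x + y) = (fun i => f i + (x + y)).
  by apply/funext => i; rewrite addrA.
have pull x : (fun=> H' + x) = (fun i : X => bfield b (inside X) i + (H' + x)).
  by apply/funext => i; rewrite b0 add0r.
rewrite !addf !pull !(partition_free _ _ full_sym) -!cplE.
rewrite !(partition_free _ _ (inside_sym _)) !addr0 [H' + H]addrC.
set K1 := expR _; set K2 := expR _ => le.
have K0 : 0 < K1 * K2 * (K1 * K2) by rewrite !mulr_gt0 ?expR_gt0.
have le' : pf b full X (H + H') * (pf b (inside X) X H * pf b (inside X) X H') *
    (pf b full X 0 * pf b full X 0 * pf b (inside X) X 0) <=
    pf b full X H * pf b full X H' * pf b (inside X) X (H + H') *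
    (pf b full X 0 * (pf b (inside X) X 0 * pf b (inside X) X 0)).
  have M0 : 0 <= pf b full X 0 * pf b (inside X) X 0 by rewrite ltW ?mulr_gt0.
  by rewrite -(ler_pM2l K0); apply: (le_eq2 _ _ (ler_wpM2r M0 le)); ring.
by rewrite /mgf !mulf_div ler_pdivrMr ?mulr_gt0 // mulrAC ler_pdivlMr ?mulr_gt0.
Qed.

End Mgf.

(** * Monotonicity and small subsystems *)

Section Correlations.
Variables (R : realType) (T : finType).
Implicit Types (J : T -> T -> R) (h : T -> R) (s : {ffun T -> bool}).

Lemma ferro_energy J h : (forall i j, 0 <= J i j) -> (forall i, 0 <= h i) ->
  ferro (energy J h).
Proof.
move=> J0 h0; apply: ferro_add.
  apply: ferro_sum => i _; apply: ferro_sum => j _; apply: ferro_scale => //.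
  by apply: ferro_mul; exact: ferro_spin.
by apply: ferro_sum => i _; apply: ferro_scale => //; exact: ferro_spin.
Qed.

Lemma energyD J J' h h' s :
  energy (fun i j => J i j + J' i j) (fun i => h i + h' i) s =
  energy J h s + energy J' h' s.
Proof.
rewrite /energy [RHS]addrACA; congr (_ + _); rewrite -big_split /=;
  apply: eq_bigr => i _; last by rewrite mulrDl.
by rewrite -big_split /=; apply: eq_bigr => j _; rewrite mulrDl.
Qed.

Definition total s : R := \sum_i sg R (s i).

Lemma energy_uniform J h H s : energy J (fun i => h i + H) s = energy J h s + H * total s.
Proof.
rewrite /energy -addrA; congr (_ + _); rewrite big_distrr -big_split /=.
by apply: eq_bigr => i _; rewrite mulrDl.
Qed.

Lemma ferro_total : ferro total.
Proof. by apply: ferro_sum => i _; exact: ferro_spin. Qed.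

Lemma partition_set0 J h : partition J h finset.set0 = \sum_s expR (energy J h s).
Proof.
apply: eq_bigr => s _; rewrite /plus_on big1 ?mul1r // => i _.
by rewrite finset.in_set0.
Qed.

(** The exponential of the added energy and the exponential of the total spin
are both ferromagnetic, hence positively correlated. *)
Lemma partition_mono J J' h h' H :
  (forall i j, 0 <= J i j) -> (forall i, 0 <= h i) -> 0 <= H ->
  (forall i j, J i j <= J' i j) -> (forall i, h i <= h' i) ->
  partition J (fun i => h i + H) finset.set0 * partition J' (fun i => h' i + 0) finset.set0 <=
  partition J' (fun i => h' i + H) finset.set0 * partition J (fun i => h i + 0) finset.set0.
Proof.
move=> J0 h0 H0 JJ hh; rewrite !partition_set0.
pose D := energy (fun i j => J' i j - J i j) (fun i => h' i - h i).
have fD : ferro D by apply: ferro_energy => *; rewrite subr_ge0.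
have ED s : energy J' h' s = energy J h s + D s.
  rewrite -energyD /energy; congr (_ + _); apply: eq_bigr => i _; last by rewrite addrC subrK.
  by apply: eq_bigr => j _; rewrite [J i j + _]addrC subrK.
have := griffiths2 (ferro_energy J0 h0) (ferro_expR (ferro_scale H0 ferro_total))
   (ferro_expR fD).
rewrite [X in _ <= X]mulrC.
congr (_ * _ <= _ * _); apply: eq_bigr => s _;
  rewrite energy_uniform ?mul0r ?addr0 ?ED !expRD //; ring.
Qed.

Definition setc (i : T) (v : bool) s : {ffun T -> bool} :=
  [ffun j => if j == i then v else s j].

(** Resampling the spin at i leaves the uniform measure invariant; iterating
this computes expectations that depend on few spins. *)
Lemma sum_setc (i : T) (G : {ffun T -> bool} -> R) :
  \sum_s G s = 2^-1 * \sum_s (G (setc i true s) + G (setc i false s)).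
Proof.
pose fl s := setc i (~~ s i) s.
have flK : involutive fl.
  move=> s; apply/ffunP => j; rewrite !ffunE eqxx negbK.
  by case: eqP => // ->.
have -> : \sum_s (G (setc i true s) + G (setc i false s)) = \sum_s (G s + G (fl s)).
  have id s : setc i (s i) s = s by apply/ffunP => j; rewrite ffunE; case: eqP => // ->.
  apply: eq_bigr => s _; rewrite /fl -{3}(id s).
  by case: (s i) => //=; rewrite addrC.
have flE : \sum_s G (fl s) = \sum_s G s by rewrite [RHS](reindex_inj (inv_inj flK)).
by rewrite big_split /= flE; field.
Qed.

Lemma sum_three_spins (i j k : T) (f : bool -> bool -> bool -> R) :
  i != j -> i != k -> j != k ->
  \sum_(s : {ffun T -> bool}) f (s i) (s j) (s k) = (2^-1) ^+ 3 * (\sum_(s : {ffun T -> bool}) 1) *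
    (f true true true + f true true false + f true false true + f true false false +
     f false true true + f false true false + f false false true + f false false false).
Proof.
move=> ij ik jk; rewrite (sum_setc i).
rewrite (eq_bigr (fun s : {ffun T -> bool} =>
    f true (s j) (s k) + f false (s j) (s k))); last first.
  by move=> s _; rewrite !ffunE !eqxx ![_ == i]eq_sym (negPf ij) (negPf ik).
rewrite (sum_setc j).
rewrite (eq_bigr (fun s : {ffun T -> bool} =>
    f true true (s k) + f false true (s k) + (f true false (s k) + f false false (s k)))); last first.
  by move=> s _; rewrite !ffunE !eqxx ![_ == j]eq_sym (negPf jk).
rewrite (sum_setc k).
rewrite (eq_bigr (fun s : {ffun T -> bool} => 1 * (
    f true true true + f false true true + (f true false true + f false false true) +
    (f true true false + f false true false + (f true false false + f false false false)))));
  last by move=> s _; rewrite !ffunE !eqxx mul1r.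
by rewrite -big_distrl /=; ring.
Qed.

Lemma sum_one_gt0 : 0 < \sum_(s : {ffun T -> bool}) 1 :> R.
Proof. by rewrite sumr_const ltr0n card_ffun card_bool expn_gt0. Qed.

Definition corr (E P : {ffun T -> bool} -> R) : R :=
  (\sum_s expR (E s) * P s) / \sum_s expR (E s).

Lemma sum_expR_gt0 (E : {ffun T -> bool} -> R) : 0 < \sum_s expR (E s).
Proof.
rewrite (bigD1 [ffun=> true]) //= ltr_wpDr ?expR_gt0 //.
by apply: sumr_ge0 => s _; exact: expR_ge0.
Qed.

Lemma corr_ge0 E P : ferro E -> ferro P -> 0 <= corr E P.
Proof. by move=> fE fP; rewrite divr_ge0 ?griffiths1 // ltW ?sum_expR_gt0. Qed.

Lemma corr_mul E P Q : ferro E -> ferro P -> ferro Q ->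
  corr E P * corr E Q <= corr E (fun s => P s * Q s).
Proof.
move=> fE fP fQ; have Z0 := sum_expR_gt0 E.
rewrite /corr mulf_div ler_pdivrMr ?mulr_gt0 //.
have -> (x : R) : x / (\sum_s expR (E s)) * ((\sum_s expR (E s)) * (\sum_s expR (E s))) =
    (\sum_s expR (E s)) * x by field; rewrite gt_eqF.
exact: griffiths2.
Qed.

Lemma corr_mono E E' P : ferro E -> ferro E' -> ferro P ->
  corr E P <= corr (fun s => E s + E' s) P.
Proof.
move=> fE fE' fP; rewrite /corr ler_pdivrMr ?sum_expR_gt0 // mulrAC.
rewrite ler_pdivlMr ?sum_expR_gt0 //.
have := griffiths2 fE fP (ferro_expR fE').
apply: le_eq2; last rewrite mulrC; congr (_ * _); apply: eq_bigr => s _; rewrite expRD //; ring.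
Qed.

Lemma sum_two_spins (i j : T) (f : bool -> bool -> R) : i != j ->
  \sum_(s : {ffun T -> bool}) f (s i) (s j) =
  (2^-1) ^+ 2 * (\sum_(s : {ffun T -> bool}) 1) *
    (f true true + f true false + f false true + f false false).
Proof.
move=> ij; rewrite (sum_setc i).
rewrite (eq_bigr (fun s : {ffun T -> bool} => f true (s j) + f false (s j))); last first.
  by move=> s _; rewrite !ffunE !eqxx ![_ == i]eq_sym (negPf ij).
rewrite (sum_setc j).
rewrite (eq_bigr (fun s : {ffun T -> bool} => 1 * (
    f true true + f false true + (f true false + f false false))));
  last by move=> s _; rewrite !ffunE !eqxx mul1r.
by rewrite -big_distrl /=; ring.
Qed.

(** A single bond has correlation tanh b. *)
Lemma bond_correlation b (i j : T) : i != j ->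
  corr (fun s => b * (sg R (s i) * sg R (s j))) (fun s => sg R (s i) * sg R (s j)) =
  (expR b - expR (- b)) / (expR b + expR (- b)).
Proof.
move=> ij; rewrite /corr.
rewrite (sum_two_spins (fun x y => expR (b * (sg R x * sg R y)) * (sg R x * sg R y)) ij).
rewrite (sum_two_spins (fun x y => expR (b * (sg R x * sg R y))) ij) /sg.
have nz : (2^-1) ^+ 2 * (\sum_(s : {ffun T -> bool}) 1) != 0 :> R.
  by rewrite mulf_neq0 ?expf_neq0 ?invr_eq0 ?pnatr_eq0 // gt_eqF ?sum_one_gt0.
rewrite -mulf_div divff // mul1r.
rewrite !(mulrN1, mulN1r, mulr1, mul1r, opprK).
have d0 : expR b + expR (- b) != 0 by rewrite gt_eqF // addr_gt0 ?expR_gt0.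
by field; rewrite d0 /= (_ : _ + _ = 2 * (expR b + expR (- b))); [rewrite mulf_neq0 ?pnatr_eq0 | ring].
Qed.

(** The mean of the middle spin of a path of three sites, each in a field b, with
bonds of strength b: the least that is present around a site on the boundary
of a box. *)
Lemma three_block b (i j k : T) : i != j -> i != k -> j != k ->
  corr (fun s => b * (sg R (s i) + sg R (s j) + sg R (s k) + sg R (s i) * sg R (s j) +
     sg R (s i) * sg R (s k))) (fun s => sg R (s i)) =
  (expR b * (expR (2 * b) + expR (- (2 * b))) ^+ 2 - 4 * expR (- b)) /
  (expR b * (expR (2 * b) + expR (- (2 * b))) ^+ 2 + 4 * expR (- b)).
Proof.
move=> ij ik jk; rewrite /corr.
pose w x y z := expR (b * (sg R x + sg R y + sg R z + sg R x * sg R y + sg R x * sg R z)).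
rewrite (sum_three_spins (fun x y z => w x y z * sg R x) ij ik jk).
rewrite (sum_three_spins w ij ik jk) /w /sg.
have nz : (2^-1) ^+ 3 * (\sum_(s : {ffun T -> bool}) 1) != 0 :> R.
  by rewrite mulf_neq0 ?expf_neq0 ?invr_eq0 ?pnatr_eq0 // gt_eqF ?sum_one_gt0.
rewrite -mulf_div divff // mul1r.
have -> : b * (1 + 1 + 1 + 1 * 1 + 1 * 1) = b + (2 * b + 2 * b) by ring.
have -> : b * (1 + 1 - 1 + 1 * 1 + 1 * -1) = b + (2 * b - 2 * b) by ring.
have -> : b * (1 - 1 + 1 + 1 * -1 + 1 * 1) = b + (2 * b - 2 * b) by ring.
have -> : b * (1 - 1 - 1 + 1 * -1 + 1 * -1) = b + (- (2 * b) - (2 * b)) by ring.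
have -> : b * (- 1 + 1 + 1 + -1 * 1 + -1 * 1) = - b by ring.
have -> : b * (- 1 + 1 - 1 + -1 * 1 + -1 * -1) = - b by ring.
have -> : b * (- 1 - 1 + 1 + -1 * -1 + -1 * 1) = - b by ring.
have -> : b * (- 1 - 1 - 1 + -1 * -1 + -1 * -1) = - b by ring.
by rewrite !expRD; congr (_ / _); ring.
Qed.

End Correlations.

(** * Comparing regions *)

Lemma perm_fsetU (K : choiceType) (A1 A2 : {fset K}) : [disjoint A1 & A2]%fset ->
  perm_eq (A1 `|` A2) (A1 ++ A2).
Proof.
move=> dis; apply: uniq_perm; first exact: fset_uniq.
  rewrite cat_uniq !fset_uniq andbT /=; apply/hasPn => x x2.
  by apply/negP => /(fdisjointP dis); rewrite x2.
by move=> x; rewrite mem_cat in_fsetU.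
Qed.

Section RegionMonotone.
Variables (R : realType) (b : R).
Hypothesis b_ge0 : 0 <= b.
Implicit Types (c : rel site) (X S A : {fset site}).

Local Notation pf_gt0 := (@pf_gt0 R b).
Local Notation mgf := (@mgf R b).
Local Notation mean_spin := (@mean_spin R b).

Definition region_energy c X : {ffun X -> bool} -> R :=
  energy (@coupling R b c X) (@bfield R b c X).

Lemma ferro_region c X : ferro (region_energy c (X := X)).
Proof.
by apply: ferro_energy => *; [exact: coupling_ge0 | exact: bfield_ge0].
Qed.

Lemma weighted_sum_energy c X (F : {fset site} -> R) : symmetric c ->
  \sum_(A <- fpowerset X) weight b c A * F A =
  expR (- base_energy b c X) *
    \sum_(s : {ffun X -> bool}) expR (region_energy c s) * F (minus_set s).
Proof.
move=> cs; rewrite sum_fpowerset big_distrr /=; apply: eq_bigr => s _.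
by rewrite weight_energy // mulrA.
Qed.

Lemma pf0E c X : pf b c X 0 = \sum_(A <- fpowerset X) weight b c A * 1.
Proof. by apply: eq_bigr => A _; rewrite mul0r expR0. Qed.

Lemma mean_spinE c X : symmetric c -> mean_spin c X =
  \sum_(i : X) corr (region_energy c (X := X)) (fun s => sg R (s i)).
Proof.
move=> cs; rewrite /mean_spin pf0E !weighted_sum_energy // -mulf_div.
rewrite divff ?gt_eqF ?expR_gt0 // mul1r /corr -[RHS]big_distrl /=; congr (_ / _).
  rewrite exchange_big /=; apply: eq_bigr => s _.
  by rewrite total_spin_minus_set big_distrr.
by apply: eq_bigr => s _; rewrite mulr1.
Qed.

Lemma mean_spin_ge0 c X : symmetric c -> 0 <= mean_spin c X.
Proof.
move=> cs; rewrite mean_spinE //; apply: sumr_ge0 => i _.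
by apply: corr_ge0; [exact: ferro_region | exact: ferro_spin].
Qed.

Lemma mgf_ge_mean c X H : 1 + H * mean_spin c X <= mgf c X H.
Proof.
rewrite /mgf /mean_spin ler_pdivlMr ?pf_gt0 // mulrDl mul1r -mulrA divfK ?gt_eqF ?pf_gt0 //.
rewrite pf0E big_distrr -big_split /=; apply: ler_sum => A _.
rewrite mulr1 -[X in X + _]mulr1 mulrCA -mulrDr ler_pM2l ?expR_gt0 //.
exact: expR_ge1Dx.
Qed.

Lemma mgf_ge1 c X H : symmetric c -> 0 <= H -> 1 <= mgf c X H.
Proof.
move=> cs H0; apply: le_trans (mgf_ge_mean _ _ _).
by rewrite lerDl mulr_ge0 ?mean_spin_ge0.
Qed.

Lemma mgf_mono c c' X H : symmetric c -> symmetric c' -> 0 <= H ->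
  subrel c c' -> mgf c X H <= mgf c' X H.
Proof.
move=> cs cs' H0 sub.
have := @partition_mono R X (@coupling R b c X) (@coupling R b c' X)
  (@bfield R b c X) (@bfield R b c' X) H (@coupling_ge0 _ _ b_ge0 _ _)
  (@bfield_ge0 _ _ b_ge0 _ _) H0.
rewrite !partition_free // => /(_ _ _) le.
have {le} := le.
have lec (i j : X) : coupling b c i j <= coupling b c' i j.
  rewrite /coupling ler_wpM2l ?divr_ge0 // ler_nat.
  case: (nn _ _) => //=; case cij: (c _ _) => //; by rewrite (sub _ _ cij).
have leb (i : X) : bfield b c i <= bfield b c' i.
  rewrite /bfield ler_wpM2l // ler_nat; apply: sub_count => y /=.
  by case/andP => -> /sub ->.
move=> /(_ lec leb).
set K1 := expR _; set K2 := expR _ => le.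
have K0 : 0 < K1 * K2 by rewrite mulr_gt0 ?expR_gt0.
rewrite /mgf ler_pdivrMr ?pf_gt0 // mulrAC ler_pdivlMr ?pf_gt0 //.
by rewrite -(ler_pM2l K0); apply: (le_eq2 _ _ le); ring.
Qed.

Lemma disagreementsU c A1 A2 : [disjoint A1 & A2]%fset ->
  (forall x y, x \in A1 -> y \in A2 -> ~~ c x y) ->
  symmetric c ->
  disagreements c (A1 `|` A2) = (disagreements c A1 + disagreements c A2)%N.
Proof.
move=> dis no cs; rewrite /disagreements (perm_big _ (perm_fsetU dis)) big_cat; congr addn;
  apply: eq_big_seq => x xA; apply: eq_count => y; rewrite in_fsetU negb_or.
  case y1: (y \in A1) => //=; case y2: (y \in A2) => //=.
  by apply/esym/negbTE; exact: no.
case y2: (y \in A2); rewrite ?andbF //=; case y1: (y \in A1) => //=.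
by apply/esym/negbTE; rewrite cs; exact: no.
Qed.

Lemma sum_fpowersetU X1 X2 (F : {fset site} -> R) : [disjoint X1 & X2]%fset ->
  \sum_(A <- fpowerset (X1 `|` X2)) F A =
  \sum_(A1 <- fpowerset X1) \sum_(A2 <- fpowerset X2) F (A1 `|` A2).
Proof.
move=> /fdisjointP dis.
rewrite -big_allpairs_dep /= -[LHS](big_map id xpredT F) map_id.
have inj : {in [seq (A1, A2) | A1 <- fpowerset X1, A2 <- fpowerset X2] &,
    injective (fun p : {fset site} * {fset site} => p.1 `|` p.2)}.
  move=> _ _ /allpairsP[[A1 A2] /= [h1 h2 ->]] /allpairsP[[B1 B2] /= [k1 k2 ->]].
  move: h1 h2 k1 k2; rewrite !fpowersetE => /fsubsetP h1 /fsubsetP h2 /fsubsetP k1 /fsubsetP k2.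
  move=> /fsetP E; congr pair; apply/fsetP => x; move: (E x); rewrite !in_fsetU => Ex.
    case xX: (x \in X1).
      have n2 (B : {fset site}) : {subset B <= X2} -> (x \in B) = false.
        by move=> BX; apply/negP => /BX; apply/negP; exact: dis.
      by move: Ex; rewrite (n2 _ h2) (n2 _ k2) !orbF.
    by apply/idP/idP => [/h1|/k1]; rewrite xX.
  case xX: (x \in X2).
    have n1 (B : {fset site}) : {subset B <= X1} -> (x \in B) = false.
      by move=> BX; apply/negP => /BX /dis; rewrite xX.
    by move: Ex; rewrite (n1 _ h1) (n1 _ k1).
  by apply/idP/idP => [/h2|/k2]; rewrite xX.
rewrite (perm_big [seq p.1 `|` p.2 |
    p <- [seq (A1, A2) | A1 <- fpowerset X1, A2 <- fpowerset X2]]) /=.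
  rewrite big_map big_allpairs_dep /= big_allpairs_dep //.
apply: uniq_perm; first exact: fset_uniq.
  by rewrite map_inj_in_uniq // allpairs_uniq ?fset_uniq // => -[? ?] [? ?].
move=> A; rewrite fpowersetE; apply/idP/mapP => [/fsubsetP sub|].
  exists (A `&` X1, A `&` X2).
    by apply: allpairs_f; rewrite fpowersetE fsubsetIr.
  apply/fsetP => x; rewrite /= !inE -andb_orr.
  by case xA: (x \in A) => //=; move: (sub _ xA); rewrite in_fsetU => ->.
by move=> [_ /allpairsP[[A1 A2] /= [h1 h2 ->]] ->] /=; apply: fsetUSS; rewrite -fpowersetE.
Qed.

Lemma mgfU c X1 X2 H : symmetric c -> [disjoint X1 & X2]%fset ->
  (forall x y, x \in X1 -> y \in X2 -> ~~ c x y) ->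
  mgf c (X1 `|` X2) H = mgf c X1 H * mgf c X2 H.
Proof.
move=> cs dis no.
have E H' : pf b c (X1 `|` X2) H' = pf b c X1 H' * pf b c X2 H'.
  rewrite /pf sum_fpowersetU // big_distrl /=; apply: eq_big_seq => A1.
  rewrite fpowersetE => sub1; rewrite big_distrr /=; apply: eq_big_seq => A2.
  rewrite fpowersetE => sub2.
  have disA : [disjoint A1 & A2]%fset.
    apply/fdisjointP => x /(fsubsetP sub1) xX; apply/negP => /(fsubsetP sub2).
    by apply/negP; exact: (fdisjointP dis).
  rewrite /weight disagreementsU //; last first.
    by move=> x y /(fsubsetP sub1) xX /(fsubsetP sub2); exact: no.
  have -> : total_spin R (X1 `|` X2) (A1 `|` A2) = total_spin R X1 A1 + total_spin R X2 A2.
    rewrite /total_spin !cardfsU (eqP dis) (eqP disA) cardfs0 !subn0 !natrD; ring.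
  by rewrite natrD !mulrDr !expRD; ring.
by rewrite /mgf !E mulf_div.
Qed.

Lemma weighted_sum_image c c' (f : site -> site) X (F : R -> R) : injective f ->
  (forall x, perm_eq (nbrs (f x)) (map f (nbrs x))) ->
  (forall x y, c (f x) (f y) = c' x y) ->
  \sum_(A <- fpowerset (f @` X)) weight b c A * F (total_spin R (f @` X) A) =
  \sum_(A <- fpowerset X) weight b c' A * F (total_spin R X A).
Proof.
move=> finj fn fc.
have dE A : disagreements c (f @` A) = disagreements c' A.
  rewrite /disagreements big_imfset; last by move=> x y _ _; exact: finj.
  apply: eq_bigr => x _; rewrite [LHS](permP (fn x)) count_map; apply: eq_count => y /=.
  by rewrite mem_imfset // fc.
rewrite (perm_big [seq f @` A | A <- fpowerset X]) /=; last first.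
  apply: uniq_perm; first exact: fset_uniq.
    rewrite map_inj_uniq ?fset_uniq // => A B /fsetP AB; apply/fsetP => x.
    by move: (AB (f x)); rewrite !mem_imfset //.
  move=> A; rewrite fpowersetE; apply/idP/mapP => [/fsubsetP sub|[B]].
    exists [fset x in X | f x \in A].
      by rewrite fpowersetE; apply/fsubsetP => x; rewrite !inE => /andP[].
    apply/fsetP => y; apply/idP/imfsetP => [yA|[x /=]].
      have /imfsetP[x /= xX yx] := sub _ yA.
      by exists x => //; rewrite !inE xX -yx.
    by rewrite !inE => /andP[_ ?] ->.
  rewrite fpowersetE => /fsubsetP BX ->; apply/fsubsetP => _ /imfsetP[x /= xB ->].
  by rewrite mem_imfset // BX.
rewrite big_map; apply: eq_bigr => A _; rewrite /weight dE; congr (_ * F _).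
by rewrite /total_spin !card_imfset.
Qed.

Lemma mgf_image c c' (f : site -> site) X H : injective f ->
  (forall x, perm_eq (nbrs (f x)) (map f (nbrs x))) ->
  (forall x y, c (f x) (f y) = c' x y) ->
  mgf c (f @` X) H = mgf c' X H.
Proof.
move=> finj fn fc; have S := fun F => @weighted_sum_image c c' f X F finj fn fc.
by rewrite /mgf /pf (S (fun t => expR (H * t))) (S (fun t => expR (0 * t))).
Qed.

Lemma mean_spin_image c c' (f : site -> site) X : injective f ->
  (forall x, perm_eq (nbrs (f x)) (map f (nbrs x))) ->
  (forall x y, c (f x) (f y) = c' x y) ->
  mean_spin c (f @` X) = mean_spin c' X.
Proof.
move=> finj fn fc; have S := fun F => @weighted_sum_image c c' f X F finj fn fc.
by rewrite /mean_spin /pf (S id) (S (fun t => expR (0 * t))).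
Qed.

Lemma eq_mgf c c' X H : (forall x y, x \in X -> c x y = c' x y) ->
  mgf c X H = mgf c' X H.
Proof.
move=> cc; have E H' : pf b c X H' = pf b c' X H'.
  apply: eq_big_seq => A; rewrite fpowersetE => /fsubsetP sub.
  congr (expR (_ * _%:R) * _); apply: eq_big_seq => x xA.
  by apply: eq_count => y; rewrite cc ?sub.
by rewrite /mgf !E.
Qed.

(** Cutting the bonds between two regions decreases the moment generating
function, and makes it a product. *)
Lemma mgf_superadditive c c1 c2 X1 X2 H : 0 <= H ->
  symmetric c -> symmetric c1 -> symmetric c2 -> [disjoint X1 & X2]%fset ->
  subrel c1 c -> subrel c2 c ->
  (forall x y, x \in X2 -> ~~ c1 x y) -> (forall x y, x \in X1 -> ~~ c2 x y) ->
  mgf c1 X1 H * mgf c2 X2 H <= mgf c (X1 `|` X2) H.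
Proof.
move=> H0 s s1 s2 dis sub1 sub2 n1 n2.
pose c' : rel site := fun x y => c1 x y || c2 x y.
have s' : symmetric c' by move=> x y; rewrite /c' s1 s2.
rewrite (@eq_mgf c1 c' X1); last by move=> x y xX; rewrite /c' (negbTE (n2 _ _ xX)) orbF.
rewrite (@eq_mgf c2 c' X2); last by move=> x y xX; rewrite /c' (negbTE (n1 _ _ xX)).
rewrite -mgfU //; first by apply: mgf_mono => // x y /orP[/sub1|/sub2].
move=> x y xX yX; rewrite /c' negb_or n2 // andbT s1; exact: n1.
Qed.

End RegionMonotone.

(** * Rectangles and concave sequences *)

Definition rect (i j : int) (w h : nat) : {fset site} :=
  [fset x in [seq (i + k%:Z, j + l%:Z) | k <- iota 0 w, l <- iota 0 h]].

Lemma in_rect i j w h x : (x \in rect i j w h) =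
  [&& i <= x.1, x.1 < i + w%:Z, j <= x.2 & x.2 < j + h%:Z].
Proof.
case: x => a b; rewrite !inE /=; apply/allpairsP/and4P => /=.
  by case=> [[k l]] /= [hk hl [-> ->]]; move: hk hl; rewrite !mem_iota => *; split; lia.
case=> h1 h2 h3 h4; exists (`|(a - i)%R|%N, `|(b - j)%R|%N); rewrite !mem_iota /=.
by split; [lia | lia | congr pair; lia].
Qed.

Lemma card_rect i j w h : #|` rect i j w h| = (w * h)%N.
Proof.
rewrite /rect card_fseq undup_id ?size_allpairs ?size_iota //.
apply: allpairs_uniq; rewrite ?iota_uniq // => -[k l] [k' l'] _ _ /= [e1 e2].
by congr pair; lia.
Qed.

Definition shift (i j : int) (x : site) : site := (i + x.1, j + x.2).
Definition transpose (x : site) : site := (x.2, x.1).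

Lemma shift_inj i j : injective (shift i j).
Proof. by move=> [a b] [a' b'] [] /addrI -> /addrI ->. Qed.

Lemma transpose_inj : injective transpose.
Proof. by move=> [a b] [a' b'] [] -> ->. Qed.

Lemma nbrs_shift i j x : perm_eq (nbrs (shift i j x)) (map (shift i j) (nbrs x)).
Proof. by rewrite /nbrs /shift /= !addrA. Qed.

Lemma nbrs_transpose x : perm_eq (nbrs (transpose x)) (map transpose (nbrs x)).
Proof. by rewrite /nbrs /transpose /= (perm_catC [:: _; _] [:: _; _]). Qed.

Lemma rect_shift i j w h : rect i j w h = shift i j @` rect 0 0 w h.
Proof.
apply/fsetP => -[a b]; apply/idP/imfsetP => [|[[a' b'] /=]].
  rewrite in_rect /= => H; exists (a - i, b - j); last by rewrite /shift /=; congr pair; lia.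
  by rewrite /= in_rect /=; lia.
by rewrite in_rect /= => H [-> ->]; rewrite in_rect /=; lia.
Qed.

Lemma rect_transpose w h : rect 0 0 w h = transpose @` rect 0 0 h w.
Proof.
apply/fsetP => -[a b]; apply/idP/imfsetP => [|[[a' b'] /=]].
  rewrite in_rect /= => H; exists (b, a) => //.
  by rewrite /= in_rect /=; lia.
by rewrite in_rect /= => H [-> ->]; rewrite in_rect /=; lia.
Qed.

(** The bonds joining sites of the same vertical strip: on a rectangle of that
strip, plus boundary on the top and bottom sides and free boundary on the left
and right ones. *)
Definition columns (i : int) (m : nat) : rel site := fun x y =>
  ((i <= x.1 < i + m%:Z) && (i <= y.1 < i + m%:Z)).
Definition rows (i : int) (m : nat) : rel site := fun x y =>
  ((i <= x.2 < i + m%:Z) && (i <= y.2 < i + m%:Z)).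

Lemma columns_sym i m : symmetric (columns i m).
Proof. by move=> x y; rewrite /columns andbC. Qed.
Lemma rows_sym i m : symmetric (rows i m).
Proof. by move=> x y; rewrite /rows andbC. Qed.

Section ConcaveSequence.
Variables (R : realType) (a : nat -> R).
Hypothesis concave : forall w, a w.+2 + a w <= 2 * a w.+1.

Lemma increment_le w m : a (w + m).+1 - a (w + m)%N <= a w.+1 - a w.
Proof.
elim: m => [|m IH]; first by rewrite addn0.
by apply: le_trans IH; rewrite addnS; have := concave (w + m); lra.
Qed.

Lemma below_tangent w m : a (w + m)%N <= a w + m%:R * (a w.+1 - a w).
Proof.
elim: m => [|m IH]; first by rewrite addn0 mul0r addr0.
rewrite addnS -natr1; have := increment_le w m; lra.
Qed.

(** A concave sequence growing at least at rate c / m along multiples of m has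
no increment below that rate. *)
Lemma increment_ge (c : R) m w : (0 < m)%N -> (forall k, k%:R * c <= a (k * m)%N) ->
  c <= m%:R * (a w.+1 - a w).
Proof.
move=> m0 low; rewrite leNgt; apply/negP => lt.
set d := a w.+1 - a w in lt *.
pose e := c - m%:R * d; have e0 : 0 < e by rewrite subr_gt0.
pose B := a w - w%:R * d.
(* So far out that a tangent with slope below c / m falls under the assumed lower bound. *)
pose k := maxn w (Num.truncn (B / e)).+1.
have kB : B / e < k%:R.
  by apply: lt_le_trans (truncnS_gt _) _; rewrite ler_nat leq_maxr.
have kw : (w <= k * m)%N by apply: leq_trans (leq_maxl _ _) (leq_pmulr _ m0).
have := below_tangent w (k * m - w); rewrite subnKC // -/d natrB // natrM => up.
have := low k; rewrite ltr_pdivrMr // in kB.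
rewrite /B in kB; rewrite /e in kB.
move=> lo; have := le_trans lo up; nra.
Qed.

Lemma ratio_nonincreasing r n : a 0%N = 0 -> (r <= n)%N -> r%:R * a n <= n%:R * a r.
Proof.
move=> a0 rn.
have back m : a m <= a 0%N + m%:R * (a 1%N - a 0%N) by have := below_tangent 0 m; rewrite add0n.
have low w : w%:R * (a w.+1 - a w) <= a w.
  elim: w => [|w IH]; first by rewrite mul0r a0.
  have := concave w; have w0 : 0 <= w%:R :> R by []; rewrite -natr1; nra.
have up := below_tangent r (n - r); rewrite subnKC // natrB // in up.
have := low r; have rn' : r%:R <= n%:R :> R by rewrite ler_nat.
have r0 : 0 <= r%:R :> R by [].
move=> lo; nra.
Qed.

End ConcaveSequence.

(** * Forcing the frame of a square *)

Lemma ler_ln_pos (R : realType) (x y : R) : 0 < x -> x <= y -> ln x <= ln y.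
Proof. by move=> x0 xy; rewrite ler_ln ?posrE // (lt_le_trans x0). Qed.

Section Frame.
Variable m : nat.
Local Notation n := m.+2.
Local Notation box := (rect 0 0 n n).
Let left_side := rect 0 0 1 n.
Let right_side := rect m.+1%:Z 0 1 n.
Let bottom_side := rect 0 0 n 1.
Let top_side := rect 0 m.+1%:Z n 1.

Lemma left_sideP : left_side `<=` box /\ box `\` left_side = rect 1 0 m.+1 n.
Proof.
split; first by apply/fsubsetP => x; rewrite !in_rect; lia.
by apply/fsetP => x; rewrite in_fsetD !in_rect; lia.
Qed.

Lemma right_sideP : right_side `<=` box /\ box `\` right_side = rect 0 0 m.+1 n.
Proof.
split; first by apply/fsubsetP => x; rewrite !in_rect; lia.
by apply/fsetP => x; rewrite in_fsetD !in_rect; lia.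
Qed.

Lemma bottom_sideP : bottom_side `<=` box /\ box `\` bottom_side = rect 0 1 n m.+1.
Proof.
split; first by apply/fsubsetP => x; rewrite !in_rect; lia.
by apply/fsetP => x; rewrite in_fsetD !in_rect; lia.
Qed.

Lemma top_sideP : top_side `<=` box /\ box `\` top_side = rect 0 0 n m.+1.
Proof.
split; first by apply/fsubsetP => x; rewrite !in_rect; lia.
by apply/fsetP => x; rewrite in_fsetD !in_rect; lia.
Qed.

Lemma frame_complement :
  box `\` (left_side `|` right_side `|` bottom_side `|` top_side) = rect 1 1 m m.
Proof. by apply/fsetP => x; rewrite in_fsetD !in_fsetU !in_rect; lia. Qed.

End Frame.

Section Rectangles.
Variables (R : realType) (b : R).
Hypothesis b_ge0 : 0 <= b.
Variable H : R.
Hypothesis H_ge0 : 0 <= H.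

Local Notation mgf := (mgf b).
Local Notation box := (rect 0 0).

Lemma mgf_rect i j w h : mgf full (rect i j w h) H = mgf full (box w h) H.
Proof.
rewrite rect_shift; apply: mgf_image => //.
  exact: shift_inj.
by move=> x; exact: nbrs_shift.
Qed.

Lemma mgf_inside_rect i j w h :
  mgf (inside (rect i j w h)) (rect i j w h) H = mgf (inside (box w h)) (box w h) H.
Proof.
rewrite {2}rect_shift; apply: mgf_image => //.
- exact: shift_inj.
- by move=> x; exact: nbrs_shift.
by move=> x y; rewrite /inside !in_rect /shift /=; congr andb; lia.
Qed.

Lemma mgf_columns_rect i w h :
  mgf (columns i w) (rect i 0 w h) H = mgf (columns 0 w) (box w h) H.
Proof.
rewrite rect_shift; apply: mgf_image => //.
- exact: shift_inj.
- by move=> x; exact: nbrs_shift.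
by move=> x y; rewrite /columns /shift /=; congr andb; lia.
Qed.

Lemma mgf_transpose w h : mgf full (box w h) H = mgf full (box h w) H.
Proof.
rewrite rect_transpose; apply: mgf_image => //.
  exact: transpose_inj.
by move=> x; exact: nbrs_transpose.
Qed.

Lemma mgf_rows_columns r : mgf (rows 0 r) (box r r) H = mgf (columns 0 r) (box r r) H.
Proof.
rewrite {1}rect_transpose; apply: mgf_image => //.
- exact: transpose_inj.
- by move=> x; exact: nbrs_transpose.
Qed.

Lemma rectU i j w w' h :
  rect i j w h `|` rect (i + w%:Z) j w' h = rect i j (w + w')%N h.
Proof. by apply/fsetP => x; rewrite in_fsetU !in_rect; lia. Qed.

Lemma rect_disjoint i j w w' h : [disjoint rect i j w h & rect (i + w%:Z) j w' h]%fset.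
Proof. by apply/fdisjointP => x; rewrite !in_rect; lia. Qed.

Lemma mgf_empty w h c : (w * h = 0)%N -> mgf c (box w h) H = 1.
Proof.
move=> wh0; rewrite (_ : box w h = fset0) ?mgf_fset0 //.
by apply/eqP; rewrite -cardfs_eq0 card_rect wh0.
Qed.

Definition log_mgf w h : R := ln (mgf full (box w h) H).

(** Submodularity, when the two forced sets are the first and the last column. *)
Lemma log_mgf_concave h w : log_mgf w.+2 h + log_mgf w h <= 2 * log_mgf w.+1 h.
Proof.
pose X := box w.+2 h; pose S := rect 0 0 1 h; pose S' := rect w.+1%:Z 0 1 h.
have SX : S `<=` X by apply/fsubsetP => x; rewrite !in_rect; lia.
have SX' : S' `<=` X by apply/fsubsetP => x; rewrite !in_rect; lia.
have := mgf_forced_submodular b_ge0 full_sym H_ge0 SX SX'.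
have -> : X `\` (S `|` S') = rect 1 0 w h.
  by apply/fsetP => x; rewrite in_fsetD in_fsetU !in_rect; lia.
have -> : X `\` S = rect 1 0 w.+1 h.
  by apply/fsetP => x; rewrite in_fsetD !in_rect; lia.
have -> : X `\` S' = rect 0 0 w.+1 h.
  by apply/fsetP => x; rewrite in_fsetD !in_rect; lia.
have -> : #|` S `|` S'| = (h + h)%N.
  rewrite cardfsU (_ : S `&` S' = fset0) ?cardfs0 ?subn0 ?card_rect ?mul1n //.
  by apply/fsetP => x; rewrite in_fsetI !in_rect !inE; lia.
rewrite !card_rect !mul1n !mgf_rect natrD mulrDr expRD /X => le.
have {}le : mgf full (box w h) H * mgf full (box w.+2 h) H <=
    mgf full (box w.+1 h) H * mgf full (box w.+1 h) H.
  have E0 : 0 < expR (H * h%:R) * expR (H * h%:R) by rewrite mulr_gt0 ?expR_gt0.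
  by rewrite -(ler_pM2l E0); apply: (le_eq2 _ _ le); ring.
rewrite /log_mgf mulr_natl mulr2n -!lnM ?posrE ?mgf_gt0 //.
by rewrite [leLHS]mulrC in le; apply: ler_ln_pos le; apply: mulr_gt0; exact: mgf_gt0.
Qed.

Lemma tile_free k m h :
  mgf (inside (box m h)) (box m h) H ^+ k <= mgf full (box (k * m)%N h) H.
Proof.
apply: (@le_trans _ _ (mgf (inside (box (k * m)%N h)) (box (k * m)%N h) H)); last first.
  by apply: mgf_mono => //; exact: inside_sym.
elim: k => [|k IH]; first by rewrite expr0 mgf_empty.
rewrite exprSr mulSn addnC; move: (k * m)%N IH => K IH.
have -> : box (K + m)%N h = box K h `|` rect K%:Z 0 m h.
  by rewrite -rectU add0r.
apply: (@le_trans _ _ (mgf (inside (box K h)) (box K h) H *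
   mgf (inside (rect K%:Z 0 m h)) (rect K%:Z 0 m h) H)).
  by rewrite mgf_inside_rect; apply: ler_wpM2r IH; apply/ltW/mgf_gt0.
apply: mgf_superadditive => //; try exact: inside_sym.
- by rewrite -[X in rect X]add0r; exact: rect_disjoint.
- by move=> x y; rewrite /inside !in_fsetU => /andP[-> ->].
- by move=> x y; rewrite /inside !in_fsetU => /andP[-> ->]; rewrite !orbT.
- by move=> x y; rewrite /inside !in_rect; lia.
- by move=> x y; rewrite /inside !in_rect; lia.
Qed.

(** Boxes placed side by side need no boundary condition on the sides where they
meet: plus boundary on the top and bottom is inherited from the long box. *)
Lemma tile_columns k m h :
  mgf (columns 0 m) (box m h) H ^+ k <= mgf full (box (k * m)%N h) H.
Proof.
apply: (@le_trans _ _ (mgf (columns 0 (k * m)%N) (box (k * m)%N h) H)); last first.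
  by apply: mgf_mono => //; exact: columns_sym.
elim: k => [|k IH]; first by rewrite expr0 mgf_empty.
rewrite exprSr mulSn addnC; move: (k * m)%N IH => K IH.
have -> : box (K + m)%N h = box K h `|` rect K%:Z 0 m h.
  by rewrite -rectU add0r.
apply: (@le_trans _ _ (mgf (columns 0 K) (box K h) H *
   mgf (columns K%:Z m) (rect K%:Z 0 m h) H)).
  by rewrite mgf_columns_rect; apply: ler_wpM2r IH; apply/ltW/mgf_gt0.
apply: mgf_superadditive => //; try exact: columns_sym.
- by rewrite -[X in rect X]add0r; exact: rect_disjoint.
- by move=> x y; rewrite /columns; lia.
- by move=> x y; rewrite /columns; lia.
- by move=> [x1 x2] [y1 y2]; rewrite /columns !in_rect /=; lia.
- by move=> [x1 x2] [y1 y2]; rewrite /columns !in_rect /=; lia.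
Qed.

(** Plus boundary splits into plus boundary on two opposite sides, in both
directions, and the two are equal on a square by reflection. *)
Lemma mgf_square_columns r :
  mgf full (box r r) H <= mgf (columns 0 r) (box r r) H ^+ 2.
Proof.
apply: (@le_trans _ _ (mgf full (box r r) H * mgf (inside (box r r)) (box r r) H)).
  rewrite ler_peMr //; first exact/ltW/mgf_gt0.
  by apply: mgf_ge1 => //; exact: inside_sym.
rewrite expr2 -{2}mgf_rows_columns.
apply: mgf_boundary_submodular => //; [exact: columns_sym | exact: rows_sym | |].
  by move=> [x1 x2] [y1 y2]; rewrite !in_rect /columns /rows /=; lia.
move=> [x1 x2] [y1 y2]; rewrite !in_rect /nn !inE !xpair_eqE /columns /rows /=.
by rewrite addbC; lia.
Qed.

Lemma log_mgf_ge0 w h : 0 <= log_mgf w h.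
Proof. by rewrite ln_ge0 // mgf_ge1. Qed.

Lemma log_mgf_mono_width w w' h : (w <= w')%N -> log_mgf w h <= log_mgf w' h.
Proof.
move=> /subnKC <-; elim: (w' - w)%N => [|m IH]; first by rewrite addn0.
apply: le_trans IH _; rewrite addnS.
have := @increment_ge _ (fun w => log_mgf w h) (log_mgf_concave h) 0 1 (w + m)%N isT.
by rewrite mul1r subr_ge0; apply => k; rewrite mulr0 log_mgf_ge0.
Qed.

Lemma log_mgf_sym w h : log_mgf w h = log_mgf h w.
Proof. by rewrite /log_mgf mgf_transpose. Qed.

Definition log_mgf_free n : R := ln (mgf (inside (box n n)) (box n n) H).

(** A long strip contains many free squares, so log-mgfs of strips grow at least
at the free rate per column; by concavity every single increment does. *)
Lemma log_mgf_increment n w : (0 < n)%N ->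
  log_mgf_free n <= n%:R * (log_mgf w.+1 n - log_mgf w n).
Proof.
move=> n0; apply: (@increment_ge _ (fun w => log_mgf w n) (log_mgf_concave n)) => // k.
rewrite /log_mgf_free /log_mgf mulrC mulr_natr -lnXn ?mgf_gt0 //.
apply: ler_ln_pos; last exact: tile_free.
by apply: exprn_gt0; exact: mgf_gt0.
Qed.

Lemma log_mgf_per_site r n : (r <= n)%N ->
  (r ^ 2)%:R * log_mgf n n <= (n ^ 2)%:R * log_mgf r r.
Proof.
move=> rn; have L0 h : log_mgf 0 h = 0 by rewrite /log_mgf mgf_empty ?ln1.
have s1 := ratio_nonincreasing (log_mgf_concave n) (L0 n) rn.
have s2 := ratio_nonincreasing (log_mgf_concave r) (L0 r) rn.
rewrite [log_mgf r n]log_mgf_sym in s1.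
rewrite !natrX !expr2 -!mulrA.
apply: le_trans (ler_wpM2l (ler0n _ r) s1) _.
by rewrite mulrCA; apply: ler_wpM2l.
Qed.

(** Boxes with plus boundary only on top and bottom carry at least half of the
log-mgf of the plus box, and they tile a long box. *)
Lemma log_mgf_square_tile k r n : (r <= n)%N -> (k * r <= n)%N ->
  k%:R * log_mgf r r <= 2 * log_mgf n n.
Proof.
move=> rn krn.
apply: (@le_trans _ _ (2 * log_mgf (k * r)%N r)).
  rewrite -[2]/(2%:R) mulr_natl [2%:R * _]mulr_natl /log_mgf -!lnXn ?mgf_gt0 //.
  apply: ler_ln_pos; first by apply: exprn_gt0; exact: mgf_gt0.
  apply: (@le_trans _ _ ((mgf (columns 0 r) (box r r) H ^+ 2) ^+ k)).
    apply: lerXn2r; last exact: mgf_square_columns; rewrite nnegrE.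
      exact/ltW/mgf_gt0.
    exact/exprn_ge0/ltW/mgf_gt0.
  rewrite -exprM mulnC exprM; apply: lerXn2r; last exact: tile_columns; rewrite nnegrE.
    exact/exprn_ge0/ltW/mgf_gt0.
  exact/ltW/mgf_gt0.
rewrite ler_pM2l //; apply: le_trans (log_mgf_mono_width _ krn) _.
by rewrite log_mgf_sym; apply: log_mgf_mono_width.
Qed.

(** The log-mgf of the n-by-n plus box with the sites of S forced to be plus. *)
Definition log_forced n (S : {fset site}) : R :=
  H * #|` S|%:R + ln (mgf full (box n n `\` S) H).

Lemma log_forced_submodular n S S' : S `<=` box n n -> S' `<=` box n n ->
  log_forced n (S `|` S') + log_mgf n n <= log_forced n S + log_forced n S'.
Proof.
move=> SX SX'; have := mgf_forced_submodular b_ge0 full_sym H_ge0 SX SX'.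
have pos3 S0 : 0 < expR (H * #|` S0|%:R) * mgf full (box n n `\` S0) H.
  by apply: mulr_gt0; [exact: expR_gt0 | exact: mgf_gt0].
move=> /(ler_ln_pos (mulr_gt0 (pos3 _) (mgf_gt0 _ _ _ _))).
rewrite (lnM (pos3 _) (mgf_gt0 _ _ _ _)) (lnM (pos3 _) (pos3 _)).
by rewrite !(lnM (expR_gt0 _) (mgf_gt0 _ _ _ _)) !expRK.
Qed.

(** Force the sides one after the other: by submodularity each of them costs at
most what it costs alone, namely n H minus the increment from a box of n - 1
columns to one of n columns. *)
Lemma forced_frame m :
  H * (m.+1 * 4)%N%:R + log_mgf m m <=
  log_mgf m.+2 m.+2 + 4 * (m.+2%:R * H - (log_mgf m.+2 m.+2 - log_mgf m.+1 m.+2)).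
Proof.
have [s1 D1] := left_sideP m; have [s2 D2] := right_sideP m.
have [s3 D3] := bottom_sideP m; have [s4 D4] := top_sideP m.
have D := frame_complement m.
move: s1 s2 s3 s4 D1 D2 D3 D4 D.
set S1 := rect 0 0 1 m.+2; set S2 := rect _ 0 1 m.+2; set S3 := rect 0 0 m.+2 1.
set S4 := rect 0 _ m.+2 1 => s1 s2 s3 s4 D1 D2 D3 D4 D.
have s12 : S1 `|` S2 `<=` box m.+2 m.+2 by rewrite fsubUset s1.
have s123 : S1 `|` S2 `|` S3 `<=` box m.+2 m.+2 by rewrite fsubUset s12.
have sub1 := log_forced_submodular s1 s2.
have sub2 := log_forced_submodular s12 s3.
have sub3 := log_forced_submodular s123 s4.
have F1 : log_forced m.+2 S1 = H * m.+2%:R + log_mgf m.+1 m.+2.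
  by rewrite /log_forced D1 card_rect mul1n mgf_rect.
have F2 : log_forced m.+2 S2 = H * m.+2%:R + log_mgf m.+1 m.+2.
  by rewrite /log_forced D2 card_rect mul1n.
have F3 : log_forced m.+2 S3 = H * m.+2%:R + log_mgf m.+1 m.+2.
  by rewrite /log_forced D3 card_rect muln1 mgf_rect log_mgf_sym.
have F4 : log_forced m.+2 S4 = H * m.+2%:R + log_mgf m.+1 m.+2.
  by rewrite /log_forced D4 card_rect muln1 log_mgf_sym.
have F : log_forced m.+2 (S1 `|` S2 `|` S3 `|` S4) = H * (m.+1 * 4)%N%:R + log_mgf m m.
  rewrite /log_forced D mgf_rect; congr (_ * _%:R + _).
  have sU : S1 `|` S2 `|` S3 `|` S4 `<=` box m.+2 m.+2 by rewrite fsubUset s123.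
  have := cardfsD (box m.+2 m.+2) (S1 `|` S2 `|` S3 `|` S4).
  have := fsubset_leq_card sU; rewrite (fsetIidPr sU) D !card_rect.
  clear; move: #|` _| => c; rewrite !(mulSn, mulnS); lia.
move: F sub1 sub2 sub3; rewrite F1 F2 F3 F4; clear.
move: (log_forced _ (S1 `|` S2)) (log_forced _ (S1 `|` S2 `|` S3)) => f2 f3.
move: (log_forced _ _) (log_mgf m.+2 _) (log_mgf m.+1 _) => f4 a c.
move: (H * (m.+1 * 4)%N%:R + log_mgf m m) (m.+2%:R) => g x -> *; lra.
Qed.

Lemma log_mgf_free_ge0 n : 0 <= log_mgf_free n.
Proof. by rewrite ln_ge0 // mgf_ge1 //; exact: inside_sym. Qed.

Lemma log_mgf_free_le n : log_mgf_free n <= log_mgf n n.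
Proof.
apply: ler_ln_pos; first exact: mgf_gt0.
by apply: mgf_mono => //; exact: inside_sym.
Qed.

Lemma frame_bound m :
  H * (m.+1 * 4)%N%:R + log_mgf m m <=
  log_mgf m.+2 m.+2 + 4 * (m.+2%:R * H - log_mgf_free m.+2 / m.+2%:R).
Proof.
apply: le_trans (forced_frame m) _.
have := log_mgf_increment m.+1 (ltn0Sn m.+1).
have n0 : 0 < m.+2%:R :> R by [].
rewrite lerD2l ler_pM2l // lerD2l lerN2 ler_pdivrMr // => inc.
by rewrite mulrC.
Qed.

End Rectangles.

(** * Bounds through the mean spin *)

Section Hoeffding.
Variable R : realType.
Implicit Types x y v : R.

Definition cosh_term y k : R := (y ^+ k + (- y) ^+ k) / k`!%:R.
Definition sinh_term y k : R := (y ^+ k - (- y) ^+ k) / k`!%:R.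

Lemma cosh_cvg y : ((\sum_(0 <= k < n) cosh_term y k) @[n --> \oo] -->
  expR y + expR (- y))%classic.
Proof.
rewrite (_ : (fun n => _) = (fun n => series (exp_coeff y) n + series (exp_coeff (- y)) n)).
  by apply: cvgD; exact: expR_series_cvg.
apply/funext => n; rewrite /series /= -big_split /=; apply: eq_bigr => k _.
by rewrite /cosh_term mulrDl.
Qed.

Lemma sinh_cvg y : ((\sum_(0 <= k < n) sinh_term y k) @[n --> \oo] -->
  expR y - expR (- y))%classic.
Proof.
rewrite (_ : (fun n => _) = (fun n => series (exp_coeff y) n - series (exp_coeff (- y)) n)).
  by apply: cvgB; exact: expR_series_cvg.
apply/funext => n; rewrite /series /= -sumrB; apply: eq_bigr => k _.
by rewrite /sinh_term mulrBl.
Qed.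

Lemma cosh_term_odd y k : odd k -> cosh_term y k = 0.
Proof. by move=> ok; rewrite /cosh_term exprNn -signr_odd ok; ring. Qed.
Lemma cosh_term_even y k : ~~ odd k -> cosh_term y k = 2 * y ^+ k / k`!%:R.
Proof. by move=> /negbTE ok; rewrite /cosh_term exprNn -signr_odd ok; ring. Qed.
Lemma sinh_term_odd y k : odd k -> sinh_term y k = 2 * y ^+ k / k`!%:R.
Proof. by move=> ok; rewrite /sinh_term exprNn -signr_odd ok; ring. Qed.
Lemma sinh_term_even y k : ~~ odd k -> sinh_term y k = 0.
Proof. by move=> /negbTE ok; rewrite /sinh_term exprNn -signr_odd ok; ring. Qed.

Lemma cosh_term_ge0 y k : 0 <= cosh_term y k.
Proof.
case ok: (odd k); first by rewrite cosh_term_odd.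
by rewrite cosh_term_even ?ok // divr_ge0 // mulr_ge0 // exprn_even_ge0 ?ok.
Qed.

Lemma double_fact_ge k : (2 ^ k * k`! <= k.*2`!)%N.
Proof.
elim: k => // k IH; rewrite doubleS !factS expnS.
have -> : (2 * 2 ^ k * (k.+1 * k`!) = k.*2.+2 * (2 ^ k * k`!))%N.
  by rewrite -doubleS -mul2n mulnACA mulnA.
by rewrite leq_mul2l /= (leq_trans IH) // leq_pmull.
Qed.

Lemma cosh_term_double y k : cosh_term y k.*2 <= 2 * exp_coeff (y ^+ 2 / 2) k.
Proof.
rewrite cosh_term_even ?odd_double // /exp_coeff /= -mulrA ler_pM2l //.
have -> : y ^+ k.*2 = (y ^+ 2) ^+ k by rewrite -exprM mul2n.
rewrite expr_div_n -[X in _ <= X]mulrA ler_wpM2l ?(exprn_ge0 _ (sqr_ge0 y)) //.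
rewrite -invfM lef_pV2 ?posrE ?mulr_gt0 ?exprn_gt0 ?ltr0n ?fact_gt0 //.
by rewrite -natrX -natrM ler_nat double_fact_ge.
Qed.

(** Termwise on the power series, by (2 k)! >= 2^k k!. *)
Lemma cosh_le y : expR y + expR (- y) <= 2 * expR (y ^+ 2 / 2).
Proof.
have cv := @cosh_cvg y; rewrite -(cvg_lim _ cv) //.
apply: limr_le; first by apply/cvg_ex; eexists; exact: cv.
apply: nearW => n.
have le1 : \sum_(0 <= k < n) cosh_term y k <= \sum_(0 <= k < n.*2) cosh_term y k.
  rewrite (@big_cat_nat _ _ _ n 0 n.*2) //=; last by rewrite -addnn leq_addr.
  by rewrite lerDl sumr_ge0 // => k _; exact: cosh_term_ge0.
apply: le_trans le1 _.
have -> : \sum_(0 <= k < n.*2) cosh_term y k = \sum_(0 <= k < n) cosh_term y k.*2.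
  elim: n => [|n IH]; first by rewrite !big_nil.
  rewrite doubleS !big_nat_recr //= -addrA IH; congr (_ + _).
  by rewrite [cosh_term y _.+1]cosh_term_odd ?addr0 //= odd_double.
apply: (@le_trans _ _ (\sum_(0 <= k < n) 2 * exp_coeff (y ^+ 2 / 2) k)).
  by apply: ler_sum => k _; exact: cosh_term_double.
rewrite -big_distrr /= ler_pM2l //.
have := @expR_series_cvg R (y ^+ 2 / 2).
move=> cv'; rewrite -(cvg_lim _ cv') //.
apply: (nondecreasing_cvgn_le (u_ := series (exp_coeff (y ^+ 2 / 2)))).
  apply: nondecreasing_series => k _ _; apply: exp_coeff_ge0.
  by rewrite divr_ge0 ?sqr_ge0.
by apply/cvg_ex; eexists; exact: cv'.
Qed.

Lemma sinh_le y : 0 <= y -> expR y - expR (- y) <= y * (expR y + expR (- y)).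
Proof.
move=> y0; have cs := @sinh_cvg y.
have cc : ((y * \sum_(0 <= k < n) cosh_term y k) @[n --> \oo] -->
    y * (expR y + expR (- y)))%classic by apply: cvgMr; exact: cosh_cvg.
rewrite -(cvg_lim _ cs) // -(cvg_lim _ cc) //; apply: ler_lim.
- by apply/cvg_ex; eexists; exact: cs.
- by apply/cvg_ex; eexists; exact: cc.
apply: nearW => -[|n]; first by rewrite !big_nil mulr0.
rewrite big_nat_recl // sinh_term_even // add0r.
rewrite big_nat_recr //= mulrDr.
apply: (@le_trans _ _ (y * \sum_(0 <= k < n) cosh_term y k)); last first.
  by rewrite lerDl mulr_ge0 // cosh_term_ge0.
rewrite big_distrr /=; apply: ler_sum => k _.
case ok: (odd k).
  by rewrite sinh_term_even /= ?ok // mulr_ge0 // cosh_term_ge0.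
rewrite sinh_term_odd /= ?ok // cosh_term_even ?ok // exprS.
rewrite factS natrM.
have f0 : 0 < k`!%:R :> R by rewrite ltr0n fact_gt0.
have k0 : 1 <= k.+1%:R :> R by rewrite ler1n.
rewrite ler_pdivrMr; last by rewrite mulr_gt0 // (lt_le_trans ltr01).
have -> : y * (2 * y ^+ k / k`!%:R) * (k.+1%:R * k`!%:R) = 2 * (y * y ^+ k) * k.+1%:R.
  by field; rewrite gt_eqF.
by rewrite ler_peMr // !mulr_ge0 // exprn_ge0.
Qed.

(** The exponential lies below its chord over [- y, y]. *)
Lemma expR_chord v y : 0 < y -> `|v| <= y ->
  expR v <= (expR y + expR (- y)) / 2 + v / y * ((expR y - expR (- y)) / 2).
Proof.
move=> y0; rewrite ler_norml => /andP[lo hi].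
(* Two tangent inequalities at v, to be weighted by the barycentric coordinates of v. *)
have t1 : expR v * (1 + (y - v)) <= expR y.
  by rewrite -[X in _ <= expR X](subrKC v) expRD ler_pM2l ?expR_gt0 // expR_ge1Dx.
have t2 : expR v * (1 + (- y - v)) <= expR (- y).
  by rewrite -[X in _ <= expR X](subrKC v) expRD ler_pM2l ?expR_gt0 // expR_ge1Dx.
have l1 : 0 <= (y + v) / (2 * y) by apply: divr_ge0; [lra | rewrite mulr_ge0 // ltW].
have l2 : 0 <= (y - v) / (2 * y) by apply: divr_ge0; [lra | rewrite mulr_ge0 // ltW].
have := lerD (ler_wpM2l l1 t1) (ler_wpM2l l2 t2).
apply: le_eq2; by field; rewrite gt_eqF.
Qed.

Lemma le_of_le_eps (x y B : R) : (forall e, 0 < e -> e <= 1 -> x <= y + e * B) -> x <= y.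
Proof.
move=> xy; rewrite leNgt; apply/negP => lt.
have d0 : 0 < x - y by rewrite subr_gt0.
have n0 : 0 < 2 * (`|B| + 1) :> R by rewrite mulr_gt0 // ltr_wpDl.
pose e := Num.min 1 ((x - y) / (2 * (`|B| + 1))).
have e0 : 0 < e by rewrite lt_min ltr01 divr_gt0.
have e1 : e <= 1 by rewrite ge_min lexx.
have := xy e e0 e1.
have eB : e * B <= (x - y) / 2.
  apply: (@le_trans _ _ (e * (`|B| + 1))).
    by rewrite ler_pM2l // (le_trans (ler_norm B)) // lerDl.
  apply: (@le_trans _ _ ((x - y) / (2 * (`|B| + 1)) * (`|B| + 1))).
    by rewrite ler_wpM2r ?ge_min ?lexx ?orbT // addr_ge0.
  by rewrite invfM mulrA -mulrA mulVf ?mulr1 // gt_eqF // ltr_wpDl.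
lra.
Qed.

Lemma ln1D_ge x : 0 <= x -> x / (1 + x) <= ln (1 + x).
Proof.
move=> x0; have p : 0 < 1 + x by rewrite ltr_pwDl.
rewrite -[X in _ <= X]opprK -lnV ?posrE // lerNr.
rewrite [X in ln X](_ : _ = 1 + (- (x / (1 + x)))); last by field; rewrite gt_eqF.
by apply: le_ln1Dx; rewrite ltrN2 ltr_pdivrMr // mul1r ltrDr.
Qed.

Variable b : R.
Hypothesis b_ge0 : 0 <= b.

Lemma ler_sum_in (I : eqType) (r : seq I) (F G : I -> R) :
  (forall i, i \in r -> F i <= G i) -> \sum_(i <- r) F i <= \sum_(i <- r) G i.
Proof. by move=> FG; rewrite big_seq [X in _ <= X]big_seq; exact: ler_sum. Qed.

Lemma total_spin_bound (X A : {fset site}) : A `<=` X -> `|total_spin R X A| <= #|` X|%:R.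
Proof.
move=> /fsubset_leq_card; rewrite -(ler_nat R) /total_spin ler_norml => le.
have : 0 <= #|` A|%:R :> R by []; lra.
Qed.

Lemma mgf_le_card c X H : 0 <= H -> mgf b c X H <= expR (H * #|` X|%:R).
Proof.
move=> H0; rewrite /mgf ler_pdivrMr ?pf_gt0 // /pf big_distrr /=.
apply: ler_sum_in => A; rewrite fpowersetE => /total_spin_bound le.
rewrite mul0r expR0 mulr1 mulrC ler_pM2r ?expR_gt0 // ler_expR.
by apply: ler_wpM2l => //; apply: le_trans (ler_norm _) le.
Qed.

(** Hoeffding's inequality, in the form that keeps the mean: convexity bounds the
mgf by cosh y + (H g / y) sinh y with y = H |X|, and sinh y <= y cosh y, cosh y <= exp (y^2 / 2). *)
Lemma mgf_hoeffding c X H : symmetric c -> 0 <= H ->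
  mgf b c X H <= expR (H * mean_spin b c X + (H * #|` X|%:R) ^+ 2 / 2).
Proof.
move=> cs H0; set g := mean_spin b c X; have g0 : 0 <= g by exact: mean_spin_ge0.
set y := H * #|` X|%:R; have y0 : 0 <= y by rewrite mulr_ge0.
have [y1|y1] := eqVneq y 0.
  rewrite y1 expr0n /= mul0r addr0.
  apply: le_trans (mgf_le_card c X H0) _; rewrite -/y y1 ler_expR.
  by rewrite mulr_ge0.
have yp : 0 < y by rewrite lt_neqAle eq_sym y1.
pose ch := (expR y + expR (- y)) / 2; pose sh := (expR y - expR (- y)) / 2.
have bound : mgf b c X H <= ch + H * g / y * sh.
  rewrite /mgf ler_pdivrMr ?pf_gt0 // mulrDl.
  have -> : H * g / y * sh * pf b c X 0 = H / y * sh *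
      \sum_(A <- fpowerset X) weight b c A * total_spin R X A.
    by rewrite /g /mean_spin; field; rewrite y1 gt_eqF ?pf_gt0.
  rewrite pf0E !big_distrr -big_split /=; apply: ler_sum_in => A.
  rewrite fpowersetE => AX; rewrite mulr1 [ch * _]mulrC [_ * (weight _ _ _ * _)]mulrCA -mulrDr.
  rewrite ler_pM2l ?expR_gt0 //.
  have := @expR_chord (H * total_spin R X A) y yp.
  rewrite normrM (ger0_norm H0) ler_wpM2l ?total_spin_bound // => /(_ isT).
  by apply: le_eq2; rewrite // /ch /sh; ring.
have ch0 : 0 < ch by rewrite divr_gt0 // addr_gt0 ?expR_gt0.
have sh_le : sh <= y * ch by rewrite /sh /ch mulrA ler_pM2r ?invr_gt0 // sinh_le.
apply: le_trans bound _; apply: (@le_trans _ _ (ch * (1 + H * g))).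
  rewrite mulrDr mulr1 lerD2l.
  apply: (@le_trans _ _ (H * g / y * (y * ch))).
    by apply: ler_wpM2l => //; rewrite divr_ge0 // mulr_ge0.
  by rewrite mulrA divfK // mulrC.
rewrite expRD mulrC; apply: ler_pM.
- by rewrite addr_ge0 // mulr_ge0.
- exact: ltW.
- exact: expR_ge1Dx.
- by rewrite /ch ler_pdivrMr // mulrC cosh_le.
Qed.

(** The difference of the two log-mgfs is subadditive in H, so it is at most its
slope at 0 times H, and that slope is at most the mean spin of the plus box,
since the free box has slope at least 0. *)
Lemma log_full_le_inside X H : 0 <= H ->
  ln (mgf b full X H) <= ln (mgf b (inside X) X H) + H * mean_spin b full X.
Proof.
move=> H0; pose D x : R := ln (mgf b full X x) - ln (mgf b (inside X) X x).
have Dsub x z : 0 <= x -> 0 <= z -> D (x + z) <= D x + D z.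
  move=> x0 z0; have := mgf_full_inside_subadditive b_ge0 X x0 z0.
  have m0 c u := mgf_gt0 b c X u.
  move=> /(ler_ln_pos (mulr_gt0 (m0 _ _) (mulr_gt0 (m0 _ _) (m0 _ _)))).
  rewrite (lnM (m0 _ _) (mulr_gt0 (m0 _ _) (m0 _ _))) (lnM (mulr_gt0 (m0 _ _) (m0 _ _)) (m0 _ _)).
  rewrite !(lnM (m0 _ _) (m0 _ _)) /D.
  move: (ln (mgf b full X (x + z))) (ln (mgf b (inside X) X (x + z))) => f1 f2.
  move: (ln (mgf b full X x)) (ln (mgf b (inside X) X x)) => f3 f4.
  by move: (ln (mgf b full X z)) (ln (mgf b (inside X) X z)) => f5 f6; clear; lra.
have Dmul x m : 0 <= x -> D (m.+1%:R * x) <= m.+1%:R * D x.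
  move=> x0; elim: m => [|m IH]; first by rewrite !mul1r.
  rewrite -[m.+2%:R]natr1 !mulrDl !mul1r; apply: le_trans (Dsub _ _ _ x0) _.
    by rewrite mulr_ge0.
  by rewrite lerD2r.
have Dle x : 0 <= x -> D x <= x * mean_spin b full X + (x * #|` X|%:R) ^+ 2 / 2.
  move=> x0; have h := mgf_hoeffding X full_sym x0.
  have := ler_ln_pos (mgf_gt0 _ _ _ _) h; rewrite expRK /D => le.
  apply: le_trans le; rewrite gerBl ln_ge0 // mgf_ge1 //; exact: inside_sym.
rewrite -lerBlDl -/(D H).
apply: (@le_of_le_eps _ _ ((H * #|` X|%:R) ^+ 2 / 2)) => e e0 _.
pose m := Num.truncn e^-1.
have em : e^-1 < m.+1%:R by exact: truncnS_gt.
have m0 : 0 < m.+1%:R :> R by [].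
have := Dmul (H / m.+1%:R) m (divr_ge0 H0 (ltW m0)).
rewrite mulrC divfK ?gt_eqF // => le; apply: le_trans le _.
apply: le_trans (ler_wpM2l (ltW m0) (Dle _ (divr_ge0 H0 (ltW m0)))) _.
rewrite mulrDr; apply: lerD.
  by rewrite !mulrA [m.+1%:R * H]mulrC mulfK // gt_eqF.
have -> : m.+1%:R * ((H / m.+1%:R * #|` X|%:R) ^+ 2 / 2) =
    m.+1%:R^-1 * ((H * #|` X|%:R) ^+ 2 / 2) by field; rewrite gt_eqF.
rewrite ler_wpM2r ?divr_ge0 ?sqr_ge0 //.
by rewrite invf_ple ?posrE // ltW.
Qed.

(** The derivative at 0 of the tiling inequality for log-mgfs. *)
Lemma mean_spin_tile k r n : (r <= n)%N -> (k * r <= n)%N ->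
  k%:R * mean_spin b full (rect 0 0 r r) <= 2 * mean_spin b full (rect 0 0 n n).
Proof.
move=> rn krn; set gr := mean_spin _ _ _; set gn := mean_spin _ _ _.
have gr0 : 0 <= gr by exact: mean_spin_ge0.
have gn0 : 0 <= gn by exact: mean_spin_ge0.
set N : R := #|` rect 0 0 n n|%:R ^+ 2; have N0 : 0 <= N by rewrite exprn_ge0.
apply: (@le_of_le_eps _ _ (2 * gn * gr + N + N * gr)) => e e0 e1.
have tile := log_mgf_square_tile b_ge0 (ltW e0) rn krn.
have up := ler_ln_pos (mgf_gt0 _ _ _ _) (mgf_hoeffding (rect 0 0 n n) full_sym (ltW e0)).
rewrite expRK -/gn in up.
have lo := ler_ln_pos _ (mgf_ge_mean b full (rect 0 0 r r) e).
have eg0 : 0 <= e * gr by rewrite mulr_ge0 // ltW.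
have p : 0 < 1 + e * gr by rewrite ltr_pwDl.
have {}lo := le_trans (ln1D_ge eg0) (lo p).
have step : k%:R * (e * gr / (1 + e * gr)) <= 2 * (e * gn + (e * #|` rect 0 0 n n|%:R) ^+ 2 / 2).
  apply: le_trans (ler_wpM2l (ler0n _ _) lo) _; apply: le_trans tile _.
  by rewrite ler_pM2l.
move: step; rewrite mulrA ler_pdivrMr // => step.
have {step} : k%:R * gr <= (2 * gn + e * N) * (1 + e * gr).
  rewrite -(ler_pM2l e0); apply: le_eq2 step; rewrite /N; first by ring.
  by field.
move=> step; apply: le_trans step _.
have eN : e * N * gr * e <= e * N * gr by rewrite ler_piMr // mulr_ge0 // mulr_ge0 // ltW.
rewrite -subr_ge0 (_ : _ - _ = e * N * gr - e * N * gr * e); last by ring.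
by rewrite subr_ge0.
Qed.

End Hoeffding.

(** * Lower bounds for the mean spin near the boundary *)

Section SubsystemEnergy.
Variables (R : realType) (T : finType).

Lemma sum_delta2 (p q : T) (F : T -> T -> R) :
  \sum_x \sum_y ((x == p) && (y == q))%:R * F x y = F p q.
Proof.
rewrite (bigD1 p) //= (bigD1 q) //= !eqxx mul1r.
rewrite big1 ?addr0; last by move=> y /negPf ->; rewrite andbF mul0r.
rewrite big1 ?addr0 // => x /negPf xp.
by rewrite big1 // => y _; rewrite xp mul0r.
Qed.

Lemma sum_delta (p : T) (F : T -> R) : \sum_x (x == p)%:R * F x = F p.
Proof.
rewrite (bigD1 p) //= eqxx mul1r big1 ?addr0 // => x /negPf ->.
by rewrite mul0r.
Qed.

Definition bond (b : R) (i j : T) (x y : T) : R :=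
  b / 2 * (((x == i) && (y == j))%:R + ((x == j) && (y == i))%:R).

Definition site_field (b : R) (i : T) (x : T) : R := b * (x == i)%:R.

Lemma energy_bond b i j s :
  energy (bond b i j) (fun=> 0) s = b * (sg R (s i) * sg R (s j)).
Proof.
rewrite /energy [X in _ + X]big1 ?addr0; last by move=> x _; rewrite mul0r.
rewrite (eq_bigr (fun x => \sum_y (b / 2 * (((x == i) && (y == j))%:R * (sg R (s x) * sg R (s y))) +
   b / 2 * (((x == j) && (y == i))%:R * (sg R (s x) * sg R (s y)))))); last first.
  by move=> x _; apply: eq_bigr => y _; rewrite /bond; ring.
under eq_bigr do rewrite big_split -!big_distrr /=.
rewrite big_split -!big_distrr /=.
by rewrite !sum_delta2; field.
Qed.

Lemma energy_site_field b i s :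
  energy (fun _ _ => 0) (site_field b i) s = b * sg R (s i).
Proof.
rewrite /energy big1 ?add0r; last first.
  by move=> x _; rewrite big1 // => y _; rewrite mul0r.
under eq_bigr do rewrite /site_field -mulrA.
by rewrite -big_distrr /= sum_delta.
Qed.

(** Monotonicity in couplings and fields: correlations of a subsystem bound
those of the system from below. *)
Lemma corr_subsystem (J J' : T -> T -> R) (h h' : T -> R) P :
  (forall x y, 0 <= J' x y) -> (forall x, 0 <= h' x) ->
  (forall x y, J' x y <= J x y) -> (forall x, h' x <= h x) ->
  ferro P -> corr (energy J' h') P <= corr (energy J h) P.
Proof.
move=> J0 h0 JJ hh fP.
have -> : energy J h = fun s => energy J' h' s +
    energy (fun x y => J x y - J' x y) (fun x => h x - h' x) s.
  apply/funext => s; rewrite -energyD /energy; congr (_ + _); apply: eq_bigr => x _;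
    last by rewrite addrC subrK.
  by apply: eq_bigr => y _; rewrite [J' x y + _]addrC subrK.
apply: corr_mono => //; first exact: ferro_energy.
by apply: ferro_energy => *; rewrite subr_ge0.
Qed.

End SubsystemEnergy.

Definition sup_norm (x : site) : nat := maxn `|x.1| `|x.2|.

Definition square (k : nat) : {fset site} := rect (- k%:Z) (- k%:Z) k.*2.+1 k.*2.+1.

Lemma in_square k x : (x \in square k) = (sup_norm x <= k)%N.
Proof. by case: x => x1 x2; rewrite in_rect /sup_norm /=; lia. Qed.

Lemma sup_norm_outward x : exists2 y, nn x y & sup_norm y = (sup_norm x).+1.
Proof.
case: x => p q; have [pq|pq] := leqP `|q|%N `|p|%N.
  exists (if 0 <= p then (p + 1, q) else (p - 1, q)).
    by case: ifP => _; rewrite /nn !inE /= !eqxx ?orbT.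
  by rewrite /sup_norm /=; case: ifP => /= ?; lia.
exists (if 0 <= q then (p, q + 1) else (p, q - 1)).
  by case: ifP => _; rewrite /nn !inE /= !eqxx ?orbT.
by rewrite /sup_norm /=; case: ifP => /= ?; lia.
Qed.

(** Every site other than the origin has two neighbours on its own ring; at a
corner they lie on two different sides. *)
Lemma sup_norm_along x : (0 < sup_norm x)%N ->
  exists y z, [/\ y != z, nn x y, nn x z, sup_norm y = sup_norm x & sup_norm z = sup_norm x].
Proof.
case: x => p q; rewrite /sup_norm /= => pos.
have [pq|pq] := ltnP `|q|%N `|p|%N.
  exists (p, q + 1), (p, q - 1); rewrite /nn !inE /= !xpair_eqE !eqxx ?orbT /=.
  by split => //; lia.
have [qp|qp] := ltnP `|p|%N `|q|%N.
  exists (p + 1, q), (p - 1, q); rewrite /nn !inE /= !xpair_eqE !eqxx ?orbT /=.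
  by split => //; lia.
exists ((if 0 <= p then p - 1 else p + 1), q), (p, (if 0 <= q then q - 1 else q + 1)).
case: ifP => ?; case: ifP => ?; rewrite /nn !inE /= !xpair_eqE !eqxx ?orbT /=;
by split => //; lia.
Qed.

Lemma card_square k : #|` square k| = (k.*2.+1 ^ 2)%N.
Proof. by rewrite card_rect. Qed.

Lemma card_ring k d : (d < k)%N ->
  (\sum_(i : square k) (sup_norm (val i) == k - d) = 8 * (k - d))%N.
Proof.
move=> dk.
rewrite -(big_seq_fsetE _ (square k) xpredT (fun x => nat_of_bool (sup_norm x == k - d)%N)) /=.
have sub j : (j <= k)%N -> (\sum_(x <- square k) (sup_norm x <= j) = j.*2.+1 ^ 2)%N.
  move=> jk; rewrite -card_square card_fset_sum1.
  have sjk : square j `<=` square k.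
    by apply/fsubsetP => x; rewrite !in_square => /leq_trans; apply.
  rewrite [RHS](eq_big_seq (fun x => nat_of_bool (sup_norm x <= j)%N)); last first.
    by move=> x; rewrite in_square => ->.
  rewrite [RHS](big_fset_incl _ sjk) // => x _; rewrite in_square => /negbTE -> //.
have := sub (k - d)%N (leq_subr _ _); have := sub (k - d).-1 _.
have -> : (\sum_(x <- square k) (sup_norm x <= k - d) =
    \sum_(x <- square k) (sup_norm x == k - d) +
    \sum_(x <- square k) (sup_norm x <= (k - d).-1))%N.
  by rewrite -big_split /=; apply: eq_bigr => x _; move: (sup_norm x) => m; lia.
move=> /(_ _) -> //; last by lia.
have : (0 < k - d)%N by lia.
case: (k - d)%N => // m _ /=; rewrite doubleS.
move: (\sum_(x <- _) _)%N => S; rewrite !expnS !expn0 !muln1 !(mulSn, mulnS); lia.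
Qed.

Section RingBounds.
Variables (R : realType) (b : R).
Hypothesis b_ge0 : 0 <= b.

Definition edge_ratio : R := (expR b - expR (- b)) / (expR b + expR (- b)).

Definition block_ratio : R :=
  (expR b * (expR (2 * b) + expR (- (2 * b))) ^+ 2 - 4 * expR (- b)) /
  (expR b * (expR (2 * b) + expR (- (2 * b))) ^+ 2 + 4 * expR (- b)).

Lemma edge_ratio_ge0 : 0 <= edge_ratio.
Proof.
apply: divr_ge0; last by rewrite addr_ge0 ?expR_ge0.
rewrite subr_ge0 ler_expR.
by apply: le_trans b_ge0; rewrite oppr_le0.
Qed.

Definition spin_mean (X : {fset site}) (i : X) : R :=
  corr (region_energy b full (X := X)) (fun s => sg R (s i)).

(** <sigma_i> = <(sigma_i sigma_j) sigma_j> >= <sigma_i sigma_j> <sigma_j>, and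
the first factor is at least the correlation across a single bond. *)
Lemma spin_mean_neighbour (X : {fset site}) (i j : X) : nn (val i) (val j) ->
  edge_ratio * spin_mean j <= spin_mean i.
Proof.
move=> nij; have ij : i != j by exact: nn_neq nij.
have fE : ferro (region_energy b full (X := X)) by exact: ferro_region.
have -> : spin_mean i = corr (region_energy b full (X := X))
    (fun s => sg R (s i) * sg R (s j) * sg R (s j)).
  congr (corr _ _); apply/funext => s; rewrite -mulrA; case: (s j); rewrite /sg; ring.
have fS := @ferro_spin R X.
apply: le_trans (corr_mul fE (ferro_mul (fS i) (fS j)) (fS j)).
apply: ler_wpM2r; first by apply: corr_ge0.
rewrite /edge_ratio -(bond_correlation b ij).
rewrite (_ : (fun s : {ffun X -> bool} => _) = energy (bond b i j) (fun=> 0)); last first.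
  by apply/funext => s; rewrite energy_bond.
apply: corr_subsystem => //.
- by move=> x y; rewrite /bond mulr_ge0 ?divr_ge0 ?addr_ge0.
- move=> x y; rewrite /bond /coupling /full andbT ler_wpM2l ?divr_ge0 //.
  rewrite -natrD ler_nat.
  case: (boolP ((x == i) && (y == j))) => [/andP[/eqP -> /eqP ->]|_].
    by rewrite nij (negPf ij).
  by case: (boolP (_ && _)) => [/andP[/eqP -> /eqP ->]|_] //=; rewrite nn_sym nij.
- by move=> x; apply: bfield_ge0.
exact: ferro_mul.
Qed.

Lemma spin_mean_block (X : {fset site}) (i j k : X) :
  j != k -> nn (val i) (val j) -> nn (val i) (val k) ->
  b <= bfield b full i -> b <= bfield b full j -> b <= bfield b full k ->
  block_ratio <= spin_mean i.
Proof.
move=> jk nij nik bi bj bk.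
have ij : i != j := nn_neq nij; have ik : i != k := nn_neq nik.
rewrite /block_ratio -(three_block b ij ik jk).
pose J x y := bond b i j x y + bond b i k x y.
pose h x := site_field b i x + site_field b j x + site_field b k x.
rewrite (_ : (fun s : {ffun X -> bool} => b * _) = energy J h); last first.
  apply/funext => s; transitivity (energy (bond b i j) (fun=> 0) s +
      energy (bond b i k) (fun=> 0) s + (energy (fun _ _ => 0) (site_field b i) s +
      energy (fun _ _ => 0) (site_field b j) s + energy (fun _ _ => 0) (site_field b k) s)).
    transitivity (b * (sg R (s i) * sg R (s j)) + b * (sg R (s i) * sg R (s k)) +
      (b * sg R (s i) + b * sg R (s j) + b * sg R (s k))).
      by move: (sg R (s i)) (sg R (s j)) (sg R (s k)) => u v w; ring.
    congr (_ + _ + (_ + _ + _)); apply/esym.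
    - exact: energy_bond.
    - exact: energy_bond.
    - exact: energy_site_field.
    - exact: energy_site_field.
    - exact: energy_site_field.
  rewrite -!energyD /energy; congr (_ + _); apply: eq_bigr => x _; last first.
    by rewrite !add0r.
  by apply: eq_bigr => y _; rewrite !addr0.
have h2 : 0 <= b / 2 by rewrite divr_ge0.
apply: corr_subsystem.
- by move=> x y; rewrite addr_ge0 // mulr_ge0 // addr_ge0.
- by move=> x; rewrite !addr_ge0 // mulr_ge0.
- move=> x y; rewrite /J /bond /coupling /full andbT -mulrDr ler_wpM2l // -!natrD ler_nat.
  case: (boolP ((x == i) && (y == j))) => [/andP[/eqP -> /eqP ->]|_].
    by rewrite nij (negPf ij) (negPf ik) (negPf jk) andbF.
  case: (boolP ((x == j) && (y == i))) => [/andP[/eqP -> /eqP ->]|_].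
    by rewrite nn_sym nij eq_sym (negPf ij) (negPf jk).
  case: (boolP ((x == i) && (y == k))) => [/andP[/eqP -> /eqP ->]|_].
    by rewrite nik (negPf ik).
  by case: (boolP (_ && _)) => [/andP[/eqP -> /eqP ->]|_] //=; rewrite nn_sym nik.
- move=> x; rewrite /h /site_field -!mulrDr -!natrD.
  have [xi|xi] := eqVneq x i; first by rewrite xi (negPf ij) (negPf ik) !addn0 mulr1.
  have [xj|xj] := eqVneq x j; first by rewrite xj (negPf jk) !addn0 mulr1.
  have [xk|xk] := eqVneq x k; first by rewrite xk mulr1.
  by rewrite mulr0; exact: bfield_ge0.
exact: ferro_spin.
Qed.

Lemma bfield_boundary k (i : square k) : sup_norm (val i) = k -> b <= bfield b full i.
Proof.
move=> ik; rewrite /bfield -{1}[b]mulr1 ler_wpM2l // ler1n -has_count; apply/hasP.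
have [y xy yk] := sup_norm_outward (val i); exists y => //.
by rewrite in_square yk ik ltnn.
Qed.

(** Induction on the depth of the ring, from the block bound on the boundary. *)
Lemma spin_mean_ring k (i : square k) d : (d < k)%N -> sup_norm (val i) = (k - d)%N ->
  edge_ratio ^+ d * block_ratio <= spin_mean i.
Proof.
elim: d i => [|d IH] i dk ik.
  rewrite subn0 in ik; rewrite expr0 mul1r.
  have [|y [z [yz iy iz yk zk]]] := @sup_norm_along (val i); first by rewrite ik.
  have yS : y \in square k by rewrite in_square yk ik.
  have zS : z \in square k by rewrite in_square zk ik.
  apply: (@spin_mean_block _ i [` yS] [` zS]) => //.
  - by apply: bfield_boundary.
  - by apply: bfield_boundary; rewrite /= yk.
  - by apply: bfield_boundary; rewrite /= zk.
have [y iy yk] := sup_norm_outward (val i).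
have yS : y \in square k by rewrite in_square yk ik; lia.
apply: le_trans (@spin_mean_neighbour _ i [` yS] iy).
rewrite exprS -mulrA ler_wpM2l ?edge_ratio_ge0 //.
by apply: IH; [exact: ltnW | rewrite /= yk ik; lia].
Qed.

Lemma mean_spin_rings k D : (D <= k)%N -> 0 <= block_ratio ->
  \sum_(0 <= d < D) edge_ratio ^+ d * block_ratio * (8 * (k - d))%N%:R <=
  mean_spin b full (square k).
Proof.
move=> Dk B0; rewrite mean_spinE //.
have pos (i : square k) : 0 <= spin_mean i.
  by apply: corr_ge0; [exact: ferro_region | exact: ferro_spin].
apply: (@le_trans _ _ (\sum_(i : square k) \sum_(0 <= d < D)
    (sup_norm (val i) == (k - d)%N)%:R * (edge_ratio ^+ d * block_ratio))).
  rewrite exchange_big /= big_nat [X in _ <= X]big_nat; apply: ler_sum => d /andP[_ dD].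
  by rewrite -big_distrl /= -natr_sum card_ring ?(leq_trans dD) // mulrC.
apply: ler_sum => i _; rewrite -/(spin_mean i).
have [/hasP[d]|/hasPn none] := boolP (has (fun d => sup_norm (val i) == k - d)%N (iota 0 D)).
  rewrite mem_iota /= add0n => dD /eqP id.
  rewrite big_mkord (bigD1 (Ordinal dD)) //= id eqxx mul1r big1 ?addr0.
    by apply: spin_mean_ring => //; exact: leq_trans dD Dk.
  move=> e ed; rewrite (_ : _ == _ = false) ?mul0r //.
  apply/negbTE; apply: contra ed => /eqP kk; apply/eqP/val_inj => /=.
  by have := ltn_ord e; lia.
rewrite big_nat big1 // => d /andP[_ dD].
by rewrite (negbTE (none d _)) ?mul0r // mem_iota.
Qed.

End RingBounds.

(** * Numerical values at the critical temperature *)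

Section Numerics.
Variable R : realType.

(** Bound the exponential at 11/128 and square three times. *)
Lemma ln2_ge : 11 / 16 <= ln (2 : R).
Proof.
have dbl (z c d : R) : 0 <= d -> c * c <= d -> expR z <= c -> expR (z + z) <= d.
  move=> d0 cd zc; rewrite expRD; apply: le_trans cd.
  by apply: ler_pM => //; exact: expR_ge0.
pose y : R := 11 / 128.
have y0 : 0 <= y by rewrite /y; lra.
have e0 : expR y <= 109 / 100.
  have ch := cosh_le y; have sh := sinh_le y0.
  have z1 : expR (y ^+ 2 / 2) <= 270 / 269.
    have N := @expR_ge1Dx R (- (y ^+ 2 / 2)).
    have P := expR_gt0 (y ^+ 2 / 2).
    have : expR (y ^+ 2 / 2) * expR (- (y ^+ 2 / 2)) = 1 by rewrite -expRD addrN expR0.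
    have : y ^+ 2 / 2 <= 1 / 270 by rewrite /y; lra.
    move: N P; move: (y ^+ 2 / 2) (expR _) (expR _) => z a c; nra.
  move: sh ch; rewrite {3 4}/y; move: (expR (- y)) (expR y) z1 => a c; lra.
have e1 : expR (y + y) <= 1189 / 1000 by apply: dbl e0; clear; lra.
have e2 : expR (y + y + (y + y)) <= 1414 / 1000 by apply: dbl e1; clear; lra.
have e3 : expR (y + y + (y + y) + (y + y + (y + y))) <= 2 by apply: dbl e2; clear; lra.
rewrite -ler_expR lnK ?posrE //.
by apply: le_eq2 e3; [congr expR; rewrite /y; lra | ].
Qed.

Lemma sqrt2_bounds : 140 / 99 <= Num.sqrt (2 : R) <= 99 / 70.
Proof.
have s0 : 0 <= Num.sqrt (2 : R) by exact: sqrtr_ge0.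
have s2 : Num.sqrt (2 : R) ^+ 2 = 2 by rewrite sqr_sqrtr.
by apply/andP; split; nra.
Qed.

Lemma expR_beta_c : expR (2 * beta_c R) = 1 + Num.sqrt 2.
Proof.
by rewrite /beta_c mulrA divff // mul1r lnK // posrE ltr_wpDr // sqrtr_ge0.
Qed.

Lemma beta_c_ge0 : 0 <= beta_c R.
Proof. by rewrite /beta_c mulr_ge0 ?invr_ge0 // ln_ge0 // lerDl sqrtr_ge0. Qed.

(** At the critical temperature this ratio is the square root of 2, minus 1. *)
Lemma edge_ratio_ge : 41 / 99 <= edge_ratio (beta_c R).
Proof.
have /andP[s1 s2] := sqrt2_bounds; have E := expR_beta_c; set b := beta_c R in E *.
have p1 := expR_gt0 b; have p2 := expR_gt0 (- b).
have EE : expR b = expR (- b) * (1 + Num.sqrt 2).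
  by rewrite -E -expRD; congr expR; ring.
rewrite /edge_ratio -/b ler_pdivlMr ?addr_gt0 // EE.
have : 0 <= expR (- b) * (Num.sqrt 2 - 41 / 99 * (2 + Num.sqrt 2)).
  by apply: mulr_ge0; [exact: ltW | lra].
lra.
Qed.

(** At the critical temperature exp (2 b) + exp (- 2 b) is twice the square root
of 2, so that this ratio is (8 r - 4) / (8 r + 4) with r = exp (2 b). *)
Lemma block_ratio_ge : 65 / 99 <= block_ratio (beta_c R).
Proof.
have /andP[s1 s2] := sqrt2_bounds; have E := expR_beta_c; set b := beta_c R in E *.
have p2 := expR_gt0 (- b); have q2 : Num.sqrt (2 : R) ^+ 2 = 2 by rewrite sqr_sqrtr.
have EE : expR b = expR (- b) * (1 + Num.sqrt 2).
  by rewrite -E -expRD; congr expR; ring.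
have EN : expR (- (2 * b)) = Num.sqrt 2 - 1.
  rewrite expRN E; apply: (@mulIf _ (1 + Num.sqrt 2)); first by lra.
  by rewrite mulVf; [nra | lra].
have EB : expR b * (expR (2 * b) + expR (- (2 * b))) ^+ 2 =
    8 * (expR (- b) * (1 + Num.sqrt 2)).
  rewrite E EN EE; have -> : 1 + Num.sqrt (2 : R) + (Num.sqrt 2 - 1) = 2 * Num.sqrt 2 by ring.
  by rewrite exprMn q2; ring.
rewrite /block_ratio -/b EB ler_pdivlMr; last first.
  by rewrite addr_gt0 // !mulr_gt0 //; lra.
have : 0 <= expR (- b) * (8 * (1 + Num.sqrt 2) - 4 - 65 / 99 * (8 * (1 + Num.sqrt 2) + 4)).
  by apply: mulr_ge0; [exact: ltW | lra].
lra.
Qed.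

End Numerics.

(** * The three ranges of the side of the box *)

Section Regimes.
Variable R : realType.
Implicit Types n s g H ff lam D x y : R.

(** With D the cost of the frame, ff = n^2 H - n D / 4 is eliminated; what
remains is a square plus (D - lam) (n / 4 - 1). *)
Lemma square_completion n s g H ff lam : 0 < lam -> 0 < s -> 4 <= n ->
  n ^+ 3 * s <= lam * g -> lam <= 4 * (n * H - ff / n) ->
  ff + H * g + 4 * (n * H - ff / n) <= lam + g * H + g * H ^+ 2 / s.
Proof.
move=> lam0 s0 n4 big D_ge; have n0 : 0 < n by lra.
have bound : n ^+ 3 * H ^+ 2 / lam <= g * H ^+ 2 / s.
  rewrite ler_pdivrMr // [leRHS]mulrAC ler_pdivlMr //.
  have := ler_wpM2r (sqr_ge0 H) big; lra.
suff : ff + 4 * (n * H - ff / n) - lam <= n ^+ 3 * H ^+ 2 / lam by lra.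
set D := 4 * (n * H - ff / n) in D_ge *.
have -> : ff = n ^+ 2 * H - n * D / 4 by rewrite /D; field; rewrite gt_eqF.
rewrite -subr_ge0.
have -> : n ^+ 3 * H ^+ 2 / lam - (n ^+ 2 * H - n * D / 4 + D - lam) =
   n / lam * (n * H - lam / 2) ^+ 2 + (D - lam) * (n / 4 - 1).
  by field; rewrite gt_eqF.
apply: addr_ge0; first by rewrite mulr_ge0 ?sqr_ge0 // divr_ge0 // ltW.
by apply: mulr_ge0; lra.
Qed.

Lemma powers8 y x : y ^+ 8 = x -> y ^+ 15 * y = x ^+ 2.
Proof. by move=> <-; ring. Qed.

Lemma pow8_gt (c c2 c4 c8 y : R) : 0 <= c -> 0 <= c2 -> 0 <= c4 ->
  c2 <= c * c -> c4 <= c2 * c2 -> c8 <= c4 * c4 -> c < y -> c8 < y ^+ 8.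
Proof.
move=> c0 c20 c40 h2 h4 h8 cy.
have sq (u v w : R) : 0 <= u -> v <= u * u -> u < w -> v < w * w.
  move=> u0 vu uw; apply: le_lt_trans vu _; apply: ltr_pM => //.
have y2 := sq _ _ _ c0 h2 cy; have y4 := sq _ _ _ c20 h4 y2.
have := sq _ _ _ c40 h8 y4; congr (_ < _); ring.
Qed.

(** With N the number of sites, g >= 2 N / 5 and s N <= 5 / 2, the difference of
the two sides is at least (2 N H / 5 - 3 / 4)^2 + 1 / 8. *)
Lemma small_box_regime (k : nat) s g H lam y : (k == 1%N) || (k == 2%N) ->
  11 / 16 <= lam -> 0 < y -> y ^+ 8 = (2 * k)%N%:R -> 0 < s -> s * y ^+ 15 <= 1 ->
  0 <= H -> 65 / 99 * (8 * k)%N%:R <= g ->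
  H * ((2 * k).+1 ^ 2)%N%:R <= lam + g * H + g * H ^+ 2 / s.
Proof.
move=> k12 lam_ge y0 y8 s0 sy H0 g_ge.
set N : R := ((2 * k).+1 ^ 2)%N%:R.
have gN : 2 / 5 * N <= g.
  by move: g_ge; rewrite /N; case/orP: k12 => /eqP -> /=; lra.
have N0 : 0 < N by rewrite ltr0n.
have y15 : 0 < y ^+ 15 by rewrite exprn_gt0.
have sN : s * N <= 5 / 2.
  have E := powers8 y8.
  have yb : y * N <= 5 / 2 * ((2 * k)%N%:R ^+ 2).
    rewrite /N; case/orP: k12 y8 => /eqP -> /= y8.
      suff : y <= 10 / 9 by lra.
      rewrite leNgt; apply/negP => /(@pow8_gt _ (12 / 10) (144 / 100) 2).
      rewrite y8 => h; have : 2 < (2 * 1)%N%:R :> R by apply: h; lra.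
      by rewrite ltr_nat.
    suff : y <= 8 / 5 by lra.
    rewrite leNgt; apply/negP => /(@pow8_gt _ 2 4 16).
    rewrite y8 => h; have : 16 < (2 * 2)%N%:R :> R by apply: h; lra.
    by rewrite ltr_nat.
  rewrite -E in yb.
  have h : y * N <= 5 / 2 * (y ^+ 15 * y) by [].
  have h2 : N <= 5 / 2 * y ^+ 15.
    by rewrite -(ler_pM2r y0); lra.
  have := ler_wpM2l (ltW s0) h2; lra.
have sg : 4 / 25 * (N * H) ^+ 2 <= g * H ^+ 2 / s.
  rewrite ler_pdivlMr //.
  have h1 : 4 / 25 * (N * H) ^+ 2 * s = 4 / 25 * (N * H ^+ 2) * (s * N) by ring.
  have h0 : 0 <= N * H ^+ 2 by rewrite mulr_ge0 ?sqr_ge0 // ltW.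
  have h2 := ler_wpM2l h0 sN.
  have h3 := ler_wpM2r (sqr_ge0 H) gN.
  lra.
have gH : 2 / 5 * (N * H) <= g * H by rewrite mulrA ler_wpM2r.
have sq := sqr_ge0 (4 / 10 * (N * H) - 3 / 4).
lra.
Qed.

(** The left-hand side is y x^3 and the right-hand side 2.86 x^3 up to lower order
terms; this is where the bound on y comes from.  The lower order terms matter
for small x, where y is far smaller than its bound. *)
Lemma ring_polynomial x y : 0 < y -> y <= 14 / 5 -> y ^+ 8 = x -> 6 <= x ->
  y * (x + 1) ^+ 3 <= 11 / 16 * (104 / 25 * x - 4) * x ^+ 2.
Proof.
move=> y0 y_le y8 x6.
have x1 : 0 <= (x + 1) ^+ 3 by rewrite exprn_ge0 // addr_ge0 // (le_trans _ x6).
have [y1|y1] := leP y (3 / 2).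
  by apply: le_trans (ler_wpM2r x1 y1) _; move: x6; clear; nra.
have x25 : 256 / 10 <= x.
  by rewrite -y8; apply/ltW/(@pow8_gt (3 / 2) (9 / 4) (81 / 16)) => //; clear; lra.
have [y2|y2] := leP y (49 / 20).
  by apply: le_trans (ler_wpM2r x1 y2) _; move: x25; clear; nra.
have x1000 : 1000 <= x.
  by rewrite -y8; apply/ltW/(@pow8_gt (49 / 20) 6 36) => //; clear; lra.
by apply: le_trans (ler_wpM2r x1 y_le) _; move: x1000; clear; nra.
Qed.

Lemma ring_regime x y s g lam : 11 / 16 <= lam -> 0 < y -> y <= 14 / 5 ->
  y ^+ 8 = x -> 6 <= x -> 0 < s -> s * y ^+ 15 <= 1 ->
  104 / 25 * x - 4 <= g -> (x + 1) ^+ 3 * s <= lam * g.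
Proof.
move=> lam_ge y0 y_le y8 x6 s0 sy g_ge.
have key := ring_polynomial y0 y_le y8 x6.
have G0 : 0 <= 104 / 25 * x - 4 by move: x6; clear; lra.
have E := powers8 y8; move: (104 / 25 * x - 4) g_ge key G0 => G g_ge key G0.
have k2 : (x + 1) ^+ 3 <= 11 / 16 * G * y ^+ 15.
  by rewrite -(ler_pM2l y0); apply: (le_eq2 erefl _ key); rewrite -E; ring.
have h : 0 <= 11 / 16 :> R by clear; lra.
have k5 : 11 / 16 * G <= lam * g by apply: ler_pM.
apply: le_trans (ler_wpM2r (ltW s0) k2) _; apply: le_trans k5.
by rewrite -[leLHS]mulrA -[leRHS]mulr1 ler_wpM2l ?mulr_ge0 // mulrC.
Qed.

(** The three terms on the left are the mean part and the Gaussian part of the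
Hoeffding bound for tiles of side r, and the frame cost; they take at most
60%, 39% and 1% of the right-hand side.  The mean part is small because r is
20 times y, the Gaussian part because r^2 is still of order y^2. *)
Lemma tile_regime x y s g gr H ff lam r m : 11 / 16 <= lam -> 14 / 5 <= y ->
  y ^+ 8 = x -> 0 < s -> s * y ^+ 15 <= 1 -> 104 / 25 * x - 4 <= g -> 0 <= gr ->
  lam <= 4 * ((x + 1) * H) -> 20 * y <= r -> r <= 20 * y + 1 -> 0 < m ->
  x + 2 - r <= m * r -> m * gr <= 2 * g ->
  r ^+ 2 * ff <= (x + 1) ^+ 2 * (H * gr + (H * r ^+ 2) ^+ 2 / 2) ->
  ff + 4 * ((x + 1) * H) <= g * H ^+ 2 / s.
Proof.
move=> lam_ge y_ge y8 s0 sy g_ge gr0 lamH r_ge r_le m0 mr mgr ffr.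
have y0 : 0 < y by apply: lt_le_trans y_ge; clear; lra.
have E := powers8 y8; set z := y ^+ 15 in sy E *.
have z0 : 0 < z by rewrite exprn_gt0.
have x_y3 : 172 * y ^+ 3 <= x.
  have -> : x = y ^+ 5 * y ^+ 3 by rewrite -y8; ring.
  rewrite ler_wpM2r ?exprn_ge0 ?(ltW y0) //.
  have y2 : 784 / 100 <= y ^+ 2 by move: y_ge; clear; nra.
  have y4 : 6146 / 100 <= y ^+ 4.
    have -> : y ^+ 4 = y ^+ 2 * y ^+ 2 by ring.
    by move: y2; clear; move: (y ^+ 2) => w; nra.
  have -> : y ^+ 5 = y ^+ 4 * y by ring.
  by move: y4 y_ge; clear; move: (y ^+ 4) => w; nra.
have x_y : 1348 * y <= x.
  have y2 : 784 / 100 <= y ^+ 2 by move: y_ge; clear; nra.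
  apply: le_trans x_y3; have -> : y ^+ 3 = y ^+ 2 * y by ring.
  by move: y2 y0; clear; move: (y ^+ 2) => w; nra.
have x3000 : 3000 <= x by move: x_y y_ge; clear; lra.
have g4 : 415 / 100 * x <= g by move: g_ge x3000; clear; lra.
have n0 : 0 < x + 1 by move: x3000; clear; lra.
have Hn : 11 / 64 <= (x + 1) * H by move: lam_ge lamH; clear; lra.
have H0 : 0 < H by rewrite -(pmulr_rgt0 _ n0); apply: lt_le_trans Hn; clear; lra.
have r0 : 0 < r by apply: lt_le_trans r_ge; rewrite mulr_gt0.
have g0 : 0 < g by apply: lt_le_trans g4; move: x3000; clear; lra.
(* The field scale enters only through 1 / s >= y^15. *)
suff main : ff + 4 * ((x + 1) * H) <= g * H ^+ 2 * z.
  apply: le_trans main _; apply: ler_wpM2l; first by rewrite mulr_ge0 ?sqr_ge0 ?(ltW g0).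
  by rewrite -[s^-1]mul1r ler_pdivlMr // mulrC.
have P1 : 5 * ((x + 1) ^+ 2 * gr) <= 3 * (g * H * z * r ^+ 2).
  rewrite -(ler_pM2l m0).
  apply: (@le_trans _ _ (10 * g * (x + 1) ^+ 2)).
    have := ler_wpM2r (sqr_ge0 (x + 1)) mgr; clear; lra.
  have rmr : 20 * y * (x + 1 - 20 * y) <= r * (m * r).
    apply: ler_pM => //; first by rewrite mulr_ge0 // ltW.
      by move: x_y y_ge; clear; lra.
    by apply: le_trans mr; move: r_le; clear; lra.
  suff : 10 * (x + 1) ^+ 2 <= 3 * (H * z * (r * (m * r))).
    move=> h; have := ler_wpM2l (ltW g0) h; clear; lra.
  rewrite -(ler_pM2l n0).
  have zz : 20 * x ^+ 2 * (x + 1 - 20 * y) <= z * (r * (m * r)).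
    by apply: (le_eq2 _ erefl (ler_wpM2l (ltW z0) rmr)); rewrite -E; ring.
  have zz0 : 0 <= z * (r * (m * r)).
    exact: mulr_ge0 (ltW z0) (mulr_ge0 (ltW r0) (mulr_ge0 (ltW m0) (ltW r0))).
  have h1 := ler_wpM2r zz0 Hn.
  apply: (@le_trans _ _ (3 * (11 / 64 * (20 * x ^+ 2 * (x + 1 - 20 * y))))); last first.
    have -> : (x + 1) * (3 * (H * z * (r * (m * r)))) =
      3 * ((x + 1) * H * (z * (r * (m * r)))) by ring.
    by move: h1 zz; clear; move: (z * (r * (m * r))) => w; lra.
  by move: x_y y_ge x3000; clear; nra.
have P2 : 50 * ((x + 1) ^+ 2 * r ^+ 2) <= 39 * (g * z).
  have r2 : r ^+ 2 <= 417 * y ^+ 2.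
    have ry : r <= 102 / 5 * y by move: r_le y_ge; clear; lra.
    apply: (@le_trans _ _ ((102 / 5 * y) ^+ 2)); last first.
      by have := sqr_ge0 y; clear; rewrite exprMn; move: (y ^+ 2) => w; lra.
    by rewrite ler_sqr ?nnegrE // ?ltW // mulr_gt0.
  have n2 : (x + 1) ^+ 2 <= 1001 / 1000 * x ^+ 2 by move: x3000; clear; nra.
  have h := ler_pM (sqr_ge0 _) (sqr_ge0 _) n2 r2.
  rewrite -(ler_pM2l y0).
  have h2 : y * ((x + 1) ^+ 2 * r ^+ 2) <= 1001 / 1000 * 417 * (x ^+ 2 * y ^+ 3).
    by apply: (le_eq2 erefl _ (ler_wpM2l (ltW y0) h)); field.
  have h3 := ler_wpM2l (sqr_ge0 x) x_y3.
  have h4 := ler_wpM2r (sqr_ge0 x) g4.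
  have -> : y * (39 * (g * z)) = 39 * (g * x ^+ 2) by rewrite -E; ring.
  have -> : y * (50 * ((x + 1) ^+ 2 * r ^+ 2)) = 50 * (y * ((x + 1) ^+ 2 * r ^+ 2)) by ring.
  have p0 : 0 <= x ^+ 2 * y ^+ 3 by rewrite mulr_ge0 ?sqr_ge0 // exprn_ge0 // ltW.
  have {}h3 : 172 * (x ^+ 2 * y ^+ 3) <= x * x ^+ 2.
    by apply: (le_eq2 _ _ h3); ring.
  have {}h4 : 415 / 100 * (x * x ^+ 2) <= g * x ^+ 2 by rewrite mulrA.
  move: h2 h3 h4 p0; clear.
  move: (x ^+ 2 * y ^+ 3) (g * x ^+ 2) (x * x ^+ 2) (y * _) => u v w a; lra.
have P3 : 400 * (x + 1) <= g * H * z.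
  have gz : 415 / 100 * x ^+ 3 <= y * (g * z).
    have -> : y * (g * z) = g * x ^+ 2 by rewrite -E; ring.
    by apply: (le_eq2 _ erefl (ler_wpM2r (sqr_ge0 x) g4)); ring.
  have gz0 : 0 <= g * z by rewrite mulr_ge0 // ltW.
  have h := ler_wpM2r gz0 Hn.
  rewrite -(ler_pM2l n0).
  suff h2 : 400 * (x + 1) ^+ 2 <= 11 / 64 * (g * z) by move: h h2; clear; lra.
  rewrite -(ler_pM2l y0).
  have n2 : (x + 1) ^+ 2 <= 1001 / 1000 * x ^+ 2 by move: x3000; clear; nra.
  have h3 := ler_wpM2l (ltW y0) n2.
  have h4 := ler_wpM2r (sqr_ge0 x) x_y.
  have h5 : 0 <= y * x ^+ 2 by rewrite mulr_ge0 ?sqr_ge0 // ltW.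
  have x3 : x ^+ 3 = x * x ^+ 2 by ring.
  rewrite x3 in gz; have -> : y * (400 * (x + 1) ^+ 2) = 400 * (y * (x + 1) ^+ 2) by ring.
  have -> : y * (11 / 64 * (g * z)) = 11 / 64 * (y * (g * z)) by ring.
  have h6 : y * (1001 / 1000 * x ^+ 2) = 1001 / 1000 * (y * x ^+ 2) by ring.
  rewrite h6 in h3; have h7 : 1348 * y * x ^+ 2 = 1348 * (y * x ^+ 2) by ring.
  rewrite h7 in h4; move: gz h3 h4 h5; clear.
  move: (y * (x + 1) ^+ 2) (y * x ^+ 2) (x * x ^+ 2) (y * (g * z)) => a b c d; lra.
have R2 : 0 < r ^+ 2 by rewrite exprn_gt0.
rewrite -(ler_pM2l R2).
have w0 : 0 <= g * H * z by rewrite !mulr_ge0 // ltW.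
have q1 := ler_wpM2l (ltW H0) P1.
have Hr0 : 0 <= H ^+ 2 * r ^+ 2 by rewrite mulr_ge0 ?sqr_ge0.
have q2 := ler_wpM2l Hr0 P2.
have Hr1 : 0 <= H * r ^+ 2 by rewrite mulr_ge0 ?sqr_ge0 // ltW.
have q3 := ler_wpM2l Hr1 P3.
have e1 : r ^+ 2 * (ff + 4 * ((x + 1) * H)) = r ^+ 2 * ff + (H * r ^+ 2 * (400 * (x + 1))) / 100.
  by field.
have e2 : (x + 1) ^+ 2 * (H * gr + (H * r ^+ 2) ^+ 2 / 2) =
  (H * (5 * ((x + 1) ^+ 2 * gr))) / 5 + (H ^+ 2 * r ^+ 2 * (50 * ((x + 1) ^+ 2 * r ^+ 2))) / 100.
  by field.
have e3 : r ^+ 2 * (g * H ^+ 2 * z) = (H * (3 * (g * H * z * r ^+ 2))) / 5 +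
   (H ^+ 2 * r ^+ 2 * (39 * (g * z))) / 100 + (H * r ^+ 2 * (g * H * z)) / 100.
  by field.
have combine (a1 a2 a3 a4 a5 a6 a7 : R) : a1 <= a2 / 5 + a4 / 100 -> a2 <= a3 -> a4 <= a5 ->
  a6 <= a7 -> a1 + a6 / 100 <= a3 / 5 + a5 / 100 + a7 / 100 by clear; lra.
by rewrite e1 e3; rewrite e2 in ffr; exact: (combine _ _ _ _ _ _ _ ffr q1 q2 q3).
Qed.

End Regimes.

(** * The wired bound for a square *)

Section WiredBound.
Variable R : realType.
Local Notation b := (beta_c R).
Local Notation b_ge0 := (beta_c_ge0 R).

Lemma mean_spin_square k :
  mean_spin b full (square k) = mean_spin b full (rect 0 0 k.*2.+1 k.*2.+1).
Proof.
rewrite /square rect_shift; apply: mean_spin_image => //.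
  exact: shift_inj.
by move=> x; exact: nbrs_shift.
Qed.

Lemma mgf_square k H :
  mgf b full (square k) H = mgf b full (rect 0 0 k.*2.+1 k.*2.+1) H.
Proof. exact: mgf_rect. Qed.

Lemma mean_spin_square_ge1 k : (0 < k)%N ->
  65 / 99 * (8 * k)%N%:R <= mean_spin b full (square k).
Proof.
move=> k0; have B := block_ratio_ge R.
have B0 : 0 <= block_ratio b by apply: le_trans B; clear; lra.
apply: le_trans (mean_spin_rings b_ge0 k0 B0).
by rewrite big_nat1 expr0 mul1r subn0 ler_wpM2r.
Qed.

(** Three rings, with weights 65/99, (41/99) 65/99 and (41/99)^2 65/99; the
constants 104/25 and 4 round down the resulting linear function. *)
Lemma mean_spin_square_ge3 k : (2 < k)%N ->
  104 / 25 * (2 * k)%N%:R - 4 <= mean_spin b full (square k).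
Proof.
move=> k3; have B := block_ratio_ge R; have E := edge_ratio_ge R.
have B0 : 0 <= block_ratio b by apply: le_trans B; clear; lra.
apply: le_trans (mean_spin_rings b_ge0 k3 B0).
rewrite !big_nat_recr //= big_nil add0r expr0 expr1 mul1r subn0.
rewrite !natrM !natrB ?(ltnW k3) //; last by apply: ltnW; apply: ltnW.
have K3 : 3 <= k%:R :> R by rewrite (ler_nat _ 3).
move: B E; move: (block_ratio b) (edge_ratio b) k%:R K3 => be e K K3 B E.
have e2 : 41 / 99 * (41 / 99) <= e ^+ 2.
  by rewrite expr2; apply: ler_pM => //; clear; lra.
have h1 : 41 / 99 * (65 / 99) <= e * be by apply: ler_pM => //; clear; lra.
have h2 : 41 / 99 * (41 / 99) * (65 / 99) <= e ^+ 2 * be.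
  by apply: ler_pM => //; clear; lra.
have k0 : 0 <= 8 * K by move: K3; clear; lra.
have k1 : 0 <= 8 * (K - 1) by move: K3; clear; lra.
have k2 : 0 <= 8 * (K - 2) by move: K3; clear; lra.
have l0 := ler_wpM2r k0 B; have l1 := ler_wpM2r k1 h1; have l2 := ler_wpM2r k2 h2.
move: l0 l1 l2 K3; clear.
move: (be * _) (e * be * _) (e ^+ 2 * be * _) => u v w; lra.
Qed.

Lemma tile_bound n r (H : R) : 0 <= H -> (r <= n)%N ->
  r%:R ^+ 2 * log_mgf_free b H n <=
  n%:R ^+ 2 * (H * mean_spin b full (rect 0 0 r r) + (H * r%:R ^+ 2) ^+ 2 / 2).
Proof.
move=> H0 rn; have ps := log_mgf_per_site b_ge0 H0 rn; rewrite !natrX in ps.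
apply: le_trans (ler_wpM2l (sqr_ge0 _) (log_mgf_free_le b_ge0 H0 n)) _.
apply: le_trans ps _; apply: ler_wpM2l; first exact: sqr_ge0.
have := ler_ln_pos (mgf_gt0 _ _ _ _) (mgf_hoeffding b_ge0 (rect 0 0 r r) full_sym H0).
by rewrite expRK card_rect natrM -expr2.
Qed.

(** The side of the tiles is the integer just above 20 y, and q of them fit along
the side of the box. *)
Lemma tile_size (y : R) n : 14 / 5 < y -> n%:R = y ^+ 8 + 1 ->
  exists r q : nat, [/\ (r <= n)%N, (q * r <= n)%N, (0 < q)%N &
    [/\ 20 * y <= r%:R, r%:R <= 20 * y + 1 & y ^+ 8 + 2 - r%:R <= q%:R * r%:R :> R]].
Proof.
move=> ygt nE; have y0 : 0 < y by apply: lt_trans ygt; clear; lra.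
pose r := (Num.truncn (20 * y)).+1.
have y20 : 0 <= 20 * y by rewrite mulr_ge0 // ltW.
have /andP[r_lo r_hi] := truncn_itv y20.
have r_ge : 20 * y <= r%:R by exact: ltW.
have r_le : r%:R <= 20 * y + 1 :> R by rewrite /r -natr1 lerD2r.
have rn : (r <= n)%N.
  rewrite -(ler_nat R); apply: le_trans r_le _; rewrite nE lerD2r.
  have -> : y ^+ 8 = y ^+ 7 * y by ring.
  apply: ler_wpM2r; first exact: ltW.
  have y4 : 4 <= y ^+ 2 by move: ygt; clear; nra.
  have y6 : 64 <= y ^+ 6.
    have -> : y ^+ 6 = y ^+ 2 * y ^+ 2 * y ^+ 2 by ring.
    by move: y4; clear; move: (y ^+ 2) => w h; nra.
  have -> : y ^+ 7 = y ^+ 6 * y by ring.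
  by move: y6 ygt; clear; move: (y ^+ 6) => w; nra.
have r0 : (0 < r)%N by [].
exists r, (n %/ r)%N; split => //; first exact: leq_trunc_div.
  by rewrite divn_gt0.
split => //; rewrite lerBlDr -natrM -natrD.
have -> : y ^+ 8 + 2 = (n + 1)%N%:R by rewrite natrD nE; ring.
rewrite ler_nat; move: (divn_eq n r) (ltn_pmod n r0); move: (n %/ r * r)%N (n %% r)%N (r) => u v w.
by clear; lia.
Qed.

(** Compare both sides to first order as v tends to 0. *)
Lemma mean_spin_scale k (s C : R) : 0 < s -> 0 <= C ->
  (forall v, 0 < v -> mgf b full (square k) (s * v) <= expR (C * (v + v ^+ 2))) ->
  s * mean_spin b full (square k) <= C.
Proof.
move=> s0 C0 hyp; set g := mean_spin _ _ _.
have g0 : 0 <= g by apply: mean_spin_ge0 => //; exact: beta_c_ge0.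
apply: (@le_of_le_eps _ _ _ (C * (1 + 2 * (s * g)))) => e e0 e1.
have le1 := le_trans (mgf_ge_mean b full (square k) (s * e)) (hyp e e0).
rewrite -/g in le1.
have x0 : 0 <= s * e * g by rewrite mulr_ge0 // mulr_ge0 // ltW.
have p : 0 < 1 + s * e * g by rewrite ltr_pwDl.
have := ler_ln_pos p le1; rewrite expRK => le2.
have := le_trans (ln1D_ge x0) le2; rewrite ler_pdivrMr // => le3.
have le4 : s * g <= C * (1 + e) * (1 + s * e * g).
  by rewrite -(ler_pM2l e0); apply: (le_eq2 _ _ le3); ring.
apply: le_trans le4 _.
have sg0 : 0 <= s * g by rewrite mulr_ge0 // ltW.
have q : 0 <= C * (s * g) * (e * (1 - e)).
  by apply: mulr_ge0; [rewrite mulr_ge0 | rewrite mulr_ge0 ?(ltW e0) // subr_ge0].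
by rewrite -subr_ge0; apply: (le_eq2 erefl _ q); ring.
Qed.

Lemma wired_log_bound k m n (y s u C : R) : n = m.+2 -> n = k.*2.+1 -> (0 < k)%N ->
  0 < y -> y ^+ 8 = (2 * k)%N%:R -> 0 < s -> s * y ^+ 15 <= 1 -> 0 < u -> 0 <= C ->
  (forall v, 0 < v -> mgf b full (square k) (s * v) <= expR (C * (v + v ^+ 2))) ->
  s * u * (8 * k)%N%:R + log_mgf b (s * u) m m <= ln 2 + C * (u + u ^+ 2).
Proof.
move=> nm nk k0 y0 y8 s0 sy u0 C0 hyp; set H : R := s * u.
have H0 : 0 < H by rewrite mulr_gt0.
have H0' := ltW H0.
have lam_ge := ln2_ge R; move: (ln 2) lam_ge => lam lam_ge.
have lam0 : 0 < lam by apply: lt_le_trans lam_ge; clear; lra.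
have sgC := mean_spin_scale s0 C0 hyp.
have n0 : 0 < n%:R :> R by rewrite nm.
have n0' : (n%:R : R) != 0 by rewrite gt_eqF.
have ff0 := log_mgf_free_ge0 b_ge0 H0' n.
have T1 : H * (8 * k)%N%:R + log_mgf b H m m <=
    log_mgf b H n n + 4 * (n%:R * H - log_mgf_free b H n / n%:R).
  have -> : (8 * k = m.+1 * 4)%N by move: nm nk; clear; lia.
  by rewrite nm; have X := frame_bound b_ge0 H0' m; exact X.
have fC : log_mgf b H n n <= C * (u + u ^+ 2).
  have := ler_ln_pos (mgf_gt0 _ _ _ _) (hyp u u0).
  by rewrite expRK mgf_square -nk.
have fff : log_mgf b H n n <= log_mgf_free b H n + H * mean_spin b full (square k).
  have := log_full_le_inside b_ge0 (rect 0 0 n n) H0'.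
  by rewrite mean_spin_square -nk.
have fin_le : H * (8 * k)%N%:R + log_mgf b H m m <= H * ((2 * k).+1 ^ 2)%N%:R.
  have Lm : log_mgf b H m m <= H * (m * m)%N%:R.
    have := ler_ln_pos (mgf_gt0 _ _ _ _) (mgf_le_card b full (rect 0 0 m m) H0').
    by rewrite expRK card_rect.
  apply: (@le_trans _ _ (H * (8 * k)%N%:R + H * (m * m)%N%:R)); first by rewrite lerD2l.
  rewrite -mulrDr -natrD ler_wpM2l // ler_nat.
  have -> : ((2 * k).+1 = m.+2)%N by move: nm nk; clear; lia.
  have -> : (8 * k = m.+1 * 4)%N by move: nm nk; clear; lia.
  by clear; rewrite -mulnn !(mulSn, mulnS); lia.
have nE : n%:R = (2 * k)%N%:R + 1 :> R by rewrite natr1 nk mul2n.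
have rings1 := mean_spin_square_ge1 k0.
have rings3 := @mean_spin_square_ge3 k.
have tileM r q : (r <= n)%N -> (q * r <= n)%N ->
    q%:R * mean_spin b full (rect 0 0 r r) <= 2 * mean_spin b full (square k).
  by rewrite mean_spin_square -nk; apply: mean_spin_tile; exact: beta_c_ge0.
have tileB r := @tile_bound n r H H0'.
have gr0 r : 0 <= mean_spin b full (rect 0 0 r r).
  by apply: mean_spin_ge0 => //; exact: beta_c_ge0.
have g0 : 0 <= mean_spin b full (square k).
  by apply: mean_spin_ge0 => //; exact: beta_c_ge0.
move: T1 fC fff fin_le ff0 tileB sgC rings1 rings3 tileM g0.
move: (log_mgf_free b H n) (log_mgf b H n n) (H * (8 * k)%N%:R + log_mgf b H m m).
move: (mean_spin b full (square k)) => g ff f fin.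
move=> T1 fC fff fin_le ff0 tileB sgC rings1 rings3 tileM g0.
have gC : g * H + g * H ^+ 2 / s <= C * (u + u ^+ 2).
  have -> : g * H + g * H ^+ 2 / s = s * g * (u + u ^+ 2) by rewrite /H; field; rewrite gt_eqF.
  by apply: ler_wpM2r => //; rewrite addr_ge0 ?sqr_ge0 // ltW.
(* Either the factor 2 alone pays for the frame, or H is at least of order 1 / n. *)
have [D_le|D_gt] := leP (4 * (n%:R * H - ff / n%:R)) lam.
  by apply: le_trans T1 _; rewrite addrC; apply: lerD.
have [k2|k3] := ltnP k 3.
  apply: le_trans fin_le _.
  have k12 : (k == 1%N) || (k == 2%N) by move: k0 k2; clear; lia.
  have le := small_box_regime k12 lam_ge y0 y8 s0 sy H0' rings1.
  by apply: le_trans le _; rewrite -addrA lerD2l.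
have g_ge := rings3 k3.
have x6 : 6 <= (2 * k)%N%:R :> R by rewrite (ler_nat _ 6); move: k3; clear; lia.
apply: le_trans T1 _.
have [yle|ygt] := leP y (14 / 5).
  have big := ring_regime lam_ge y0 yle y8 x6 s0 sy g_ge; rewrite -nE in big.
  have n4 : 4 <= n%:R :> R by rewrite (ler_nat _ 4); move: nk k3; clear; lia.
  have le := square_completion lam0 s0 n4 big (ltW D_gt).
  apply: (@le_trans _ _ (ff + H * g + 4 * (n%:R * H - ff / n%:R))); first by rewrite lerD2r.
  by apply: le_trans le _; rewrite -addrA lerD2l.
have ff_n : 0 <= ff / n%:R by rewrite divr_ge0 // ltW.
have lamH : lam <= 4 * (n%:R * H) by move: D_gt ff_n; clear; lra.
rewrite -y8 in nE.
have [r [q [rn qr q0 [r_ge r_le mr]]]] := tile_size ygt nE.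
have q0' : 0 < q%:R :> R by rewrite ltr0n.
have ffr := tileB r rn; rewrite y8 in nE mr; rewrite nE in lamH ffr.
have fin_ := tile_regime lam_ge (ltW ygt) y8 s0 sy g_ge (gr0 r) lamH r_ge r_le q0' mr
  (tileM r q rn qr) ffr.
rewrite -nE in fin_.
apply: (@le_trans _ _ (g * H + g * H ^+ 2 / s)); last first.
  by apply: le_trans gC _; rewrite lerDr ltW.
have -> : g * H = H * g by rewrite mulrC.
move: fff fin_ ff_n; clear.
move: (n%:R * H) (ff / n%:R) (g * H ^+ 2 / s) (H * g) => a c d e; lra.
Qed.

Lemma wired_square_bound k (y s u C : R) : 0 < y -> y ^+ 8 = (2 * k.+1)%N%:R ->
  0 < s -> s * y ^+ 15 <= 1 -> 0 < u -> 0 <= C ->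
  (forall v, 0 < v -> mgf b full (square k.+1) (s * v) <= expR (C * (v + v ^+ 2))) ->
  expR (s * u * (8 * k.+1)%N%:R) * mgf b full (square k) (s * u) <=
  2 * expR (C * (u + u ^+ 2)).
Proof.
move=> y0 y8 s0 sy u0 C0 hyp.
have bound := @wired_log_bound k.+1 k.*2.+1 k.+1.*2.+1 y s u C erefl erefl (ltn0Sn k)
  y0 y8 s0 sy u0 C0 hyp.
have p2 : 0 < expR (s * u * (8 * k.+1)%N%:R) * mgf b full (square k) (s * u).
  by apply: mulr_gt0; [exact: expR_gt0 | exact: mgf_gt0].
have tw : 0 < 2 :> R by [].
have p3 : 0 < 2 * expR (C * (u + u ^+ 2)) by rewrite mulr_gt0 ?expR_gt0.
rewrite -ler_ln ?posrE //; move: bound.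
by rewrite (lnM (expR_gt0 _) (mgf_gt0 _ _ _ _)) (lnM tw (expR_gt0 _)) !expRK mgf_square.
Qed.

End WiredBound.

(** * The Ising expectation as a moment generating function *)

Section EdgeSums.
Variables (R : realType) (a : R).

Lemma mem_edges x y : x != y -> ([fset x; y] \in edges a) = [&& nn x y, x \in Qa a & y \in Qa a].
Proof.
move=> xy; apply/idP/and3P => [h|[nxy xQ yQ]]; last first.
  by apply/imfset2P; exists x => //; exists y => //; rewrite !inE yQ.
have [xQ yQ] := edges_sub h; split => //.
move: h => /imfset2P[u /= uQ [v]]; rewrite !inE /= => /andP[vQ nuv] E.
move/fsetP: E => E; have := E x; have := E y; rewrite !inE !eqxx orbT /=.
move=> /esym/orP[/eqP yu|/eqP yv] /esym/orP[/eqP xu|/eqP xv].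
- by rewrite xu yu eqxx in xy.
- by rewrite xv yu nn_sym.
- by rewrite xu yv.
- by rewrite xv yv eqxx in xy.
Qed.

Lemma edgeP e : e \in edges a -> exists x y, [/\ e = [fset x; y], nn x y, x \in Qa a & y \in Qa a].
Proof.
move=> /imfset2P[u /= uQ [v]]; rewrite !inE /= => /andP[vQ nuv] ->.
by exists u, v.
Qed.

(** Unordered bonds against ordered pairs of neighbours: an edge, being a
two-element set, yields both orders. *)
Lemma sum_edges (F : site -> site -> R) :
  \sum_(e <- edges a) \sum_(x <- e) \sum_(y <- e | x != y) F x y =
  \sum_(x <- Qa a) \sum_(y <- Qa a | nn x y) F x y.
Proof.
transitivity (\sum_(e <- edges a) \sum_(x <- Qa a) \sum_(y <- Qa a)
    ([&& x \in e, y \in e & x != y])%:R * F x y).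
  apply: eq_big_seq => e eE.
  have eQ : e `<=` Qa a.
    have [u [v [-> _ uQ vQ]]] := edgeP eE.
    by apply/fsubsetP => z; rewrite !inE => /orP[] /eqP ->.
  pose G x y := ([&& x \in e, y \in e & x != y])%:R * F x y.
  transitivity (\sum_(x <- e) \sum_(y <- Qa a) G x y).
    apply: eq_big_seq => x xe; rewrite big_mkcond /=.
    transitivity (\sum_(y <- e) G x y).
      by apply: eq_big_seq => y ye; rewrite /G xe ye /=; case: (x != y); rewrite ?mul1r ?mul0r.
    by apply: (big_fset_incl _ eQ) => y _ /negbTE ye; rewrite /G ye andbF mul0r.
  apply: (big_fset_incl _ eQ) => x _ /negbTE xe.
  by rewrite big1 // => y _; rewrite /G xe mul0r.
rewrite exchange_big /=; apply: eq_big_seq => x xQ.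
rewrite exchange_big /= [RHS]big_mkcond /=; apply: eq_big_seq => y yQ.
rewrite -big_distrl /=.
have [nxy|nxy] := boolP (nn x y).
  have xy := nn_neq nxy.
  have eE : [fset x; y] \in edges a by rewrite mem_edges // nxy xQ yQ.
  rewrite (bigD1_seq [fset x; y]) ?fset_uniq //= !inE !eqxx orbT xy /=.
  rewrite big1_seq ?addr0 ?mul1r // => e /andP[eN eE'].
  have [u [v [E _ _ _]]] := edgeP eE'; case: and3P => // -[xe ye _].
  move: xe ye eN; rewrite E !inE => /orP[]/eqP xu /orP[]/eqP yu; rewrite xu yu ?eqxx // in xy *.
  by rewrite fsetUC eqxx.
rewrite big1_seq ?mul0r // => e /andP[_ eE].
have [u [v [E nuv _ _]]] := edgeP eE; case: and3P => // -[xe ye xy].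
move: xe ye nxy xy; rewrite E !inE => /orP[]/eqP -> /orP[]/eqP ->; rewrite ?eqxx ?nuv //.
by rewrite nn_sym nuv.
Qed.

Lemma sum_pair (x y : site) (G : site -> R) : x != y ->
  \sum_(z <- [fset x; y]) G z = G x + G y.
Proof.
by move=> xy; rewrite big_fsetU1 ?inE //= big_seq_fset1.
Qed.

End EdgeSums.

Section IsingBridge.
Variables (R : realType) (a : R).
Local Notation b := (beta_c R).
Local Notation X := (Qa a).

Lemma spin_in (s : spins a) (i : X) : spin s (val i) = sg R (s i).
Proof. by rewrite /spin valK /sg. Qed.

Lemma spin_out (s : spins a) x : x \notin X -> spin s x = 1.
Proof. by move=> xX; rewrite /spin insubF //; apply/negbTE. Qed.

Lemma interaction_energy (s : spins a) :
  b * ising_interaction s = energy (@coupling R b full X) (@bfield R b full X) s.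
Proof.
rewrite /ising_interaction mulrDr /energy; congr (_ + _).
  have -> : \sum_(e <- edges a) \prod_(x <- e) spin s x =
      2^-1 * \sum_(e <- edges a) \sum_(x <- e) \sum_(y <- e | x != y) spin s x * spin s y.
    rewrite big_distrr /=; apply: eq_big_seq => e eE.
    have [u [v [-> nuv _ _]]] := edgeP eE; have uv := nn_neq nuv.
    rewrite big_fsetU1 ?inE //= big_seq_fset1 sum_pair //.
    rewrite [X in _ * (X + _)]big_mkcond [X in _ * (_ + X)]big_mkcond !sum_pair //= !eqxx uv.
    by rewrite eq_sym uv /=; field.
  rewrite sum_edges (big_seq_fsetE _ X xpredT (fun x => \sum_(y <- X | nn x y) _)) /=.
  rewrite mulrA big_distrr /=; apply: eq_bigr => i _.
  rewrite (big_seq_fsetE _ X (fun y => nn (val i) y) (fun y => spin s (val i) * spin s y)) /=.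
  rewrite big_mkcond big_distrr /=; apply: eq_bigr => j _.
  rewrite !spin_in /coupling /full andbT.
  by case: nn; rewrite /= ?mulr1 ?mulr0 ?mul0r.
rewrite (big_seq_fsetE _ X xpredT (fun x => \sum_(y <- nbrs x | y \notin X) _)) /=.
rewrite big_distrr /=; apply: eq_bigr => i _.
rewrite (eq_bigr (fun=> sg R (s i))); last first.
  by move=> y yX; rewrite spin_in spin_out // mulr1.
rewrite big_const_seq iter_addr_0 /bfield -mulrA -[in LHS]mulr_natl.
by congr (_ * (_%:R * _)); apply: eq_count => y; rewrite /full andbT.
Qed.

Lemma ising_E_mgf t : ising_E (fun s : spins a => expR (t * mag s)) =
  mgf b full X (magscale a * t).
Proof.
have E H : expR (base_energy b full X) * pf b full X H =
    \sum_(s : spins a) expR (H * \sum_(i : X) sg R (s i)) * ising_weight s.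
  rewrite -partition_free ?partition_set0; last exact: full_sym.
  apply: eq_bigr => s _; rewrite energy_uniform expRD mulrC /ising_weight.
  by rewrite interaction_energy.
have K0 := expR_gt0 (base_energy b full X).
rewrite /ising_E /ising_prob /mgf.
have -> : \sum_(s' : spins a) ising_weight s' = expR (base_energy b full X) * pf b full X 0.
  by rewrite E; apply: eq_bigr => s _; rewrite mul0r expR0 mul1r.
rewrite (eq_bigr (fun s : spins a => expR (magscale a * t * \sum_(i : X) sg R (s i)) *
   ising_weight s / (expR (base_energy b full X) * pf b full X 0))); last first.
  move=> s _; rewrite mulrA; congr (expR _ * _ / _); rewrite /mag.
  rewrite (big_seq_fsetE _ X xpredT (spin s)) /= (eq_bigr (fun i : X => sg R (s i))).
    by rewrite mulrA [t * _]mulrC.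
  by move=> i _; exact: spin_in.
by rewrite -big_distrl /= -E -mulf_div divff ?gt_eqF // mul1r.
Qed.

End IsingBridge.

(** * Summing over unions of blocks *)

Section Blocks.
Variable R : realType.
Implicit Types (L : seq {fset site}) (A B C D : {fset site}) (z : R).

Definition saturated L A : bool := all (fun C => (C `<=` A) || [disjoint C & A]%fset) L.

Definition separated L : Prop :=
  [/\ uniq L, forall C, C \in L -> C != fset0 &
      forall C D, C \in L -> D \in L -> C != D -> [disjoint C & D]%fset].

Lemma separated_cons C L : separated (C :: L) ->
  [/\ separated L, C != fset0 & [disjoint C & \bigcup_(D <- L) D]%fset].
Proof.
move=> [/= /andP[CL uL] ne dis]; split.
- split=> // [D DL|D E DL EL]; [apply: ne|apply: dis];
    by rewrite inE ?DL ?EL orbT.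
- by apply: ne; rewrite mem_head.
apply/fdisjointP => x xC; apply/negP => /bigfcupP[D /andP[DL _] xD].
have CD : C != D by apply: contraNneq CL => ->.
by have /fdisjointP/(_ _ xC) := dis C D (mem_head _ _) (mem_behead (s := C :: L) DL) CD;
  rewrite xD.
Qed.

Lemma card_blocks L : separated L ->
  #|` \bigcup_(C <- L) C| = (\sum_(C <- L) #|` C|)%N.
Proof.
elim: L => [|C L IH]; first by rewrite !big_nil cardfs0.
move=> /separated_cons[sL _ dis]; rewrite !big_cons cardfsU -IH //.
by move/eqP: dis => ->; rewrite cardfs0 subn0.
Qed.

(** Expanding the product chooses a subset of the blocks, and such choices are
the saturated subsets of the union. *)
Lemma prod_blocks L z : separated L ->
  \prod_(C <- L) (1 + z ^+ #|` C|) =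
  \sum_(A <- fpowerset (\bigcup_(C <- L) C)) (saturated L A)%:R * z ^+ #|` A|.
Proof.
elim: L => [|C L IH].
  move=> _; rewrite !big_nil fpowerset0 big_seq_fset1.
  by rewrite cardfs0 expr0 mulr1.
move=> /separated_cons[sL Cn dis]; rewrite !big_cons IH // sum_fpowersetU //.
set U := \bigcup_(D <- L) D in dis *.
have split (A1 A2 : {fset site}) : A1 `<=` C -> A2 `<=` U ->
    (saturated (C :: L) (A1 `|` A2))%:R * z ^+ #|` A1 `|` A2| =
    (((A1 == fset0) || (A1 == C))%:R * z ^+ #|` A1|) *
    ((saturated L A2)%:R * z ^+ #|` A2|).
  move=> /fsubsetP A1C /fsubsetP A2U; move/fdisjointP: dis => dis.
  have disA : [disjoint A1 & A2]%fset.
    by apply/fdisjointP => x /A1C /dis; apply: contra => /A2U.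
  rewrite cardfsU (eqP disA) cardfs0 subn0 exprD.
  rewrite [_%:R * _ * (_ * _)]mulrACA -natrM mulnb; congr (_%:R * _).
  rewrite /saturated /=; congr (_ && _); last first.
    apply: eq_in_all => D DL.
    have DU x : x \in D -> x \in U by move=> xD; apply/bigfcupP; exists D; rewrite ?DL.
    congr (_ || _).
      apply/fsubsetP/fsubsetP => sub x xD; have := sub x xD; rewrite !inE.
        by case/orP=> // /A1C /dis; rewrite DU.
      by move=> ->; rewrite orbT.
    apply/fdisjointP/fdisjointP => sub x xD; have := sub x xD; rewrite !inE negb_or.
      by case/andP.
    move=> ->; rewrite andbT; apply/negP => /A1C /dis.
    by rewrite DU.
  apply/idP/idP.
    case/orP=> [/fsubsetP CA|/fdisjointP CA].
      apply/orP; right; rewrite eqEfsubset; apply/andP; split; apply/fsubsetP => x //.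
        exact: A1C.
      move=> xC; have := CA x xC; rewrite inE => /orP[//|/A2U xU].
      by have := dis x xC; rewrite xU.
    apply/orP; left; apply/eqP/fsetP => x; rewrite inE; apply/negP => xA.
    by have := CA x (A1C x xA); rewrite inE xA.
  case/orP=> /eqP E; apply/orP; [right|left].
    apply/fdisjointP => x xC; rewrite E fset0U; apply/negP => /A2U xU.
    by have := dis x xC; rewrite xU.
  by rewrite E fsubsetUl.
transitivity (\sum_(A1 <- fpowerset C) \sum_(A2 <- fpowerset U)
   (((A1 == fset0) || (A1 == C))%:R * z ^+ #|` A1|) *
    ((saturated L A2)%:R * z ^+ #|` A2|)); last first.
  apply: eq_big_seq => A1; rewrite fpowersetE => h1.
  by apply: eq_big_seq => A2; rewrite fpowersetE => h2; rewrite split.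
rewrite -big_distrlr /=; congr (_ * _).
rewrite (big_fsetD1 fset0) ?fpowersetE ?fsub0set //.
rewrite (big_fsetD1 C) ?in_fsetD1 ?Cn ?fpowersetE ?fsubset_refl //.
rewrite !eqxx orbT cardfs0 expr0 !mul1r -[z ^+ #|` C| in LHS]addr0.
congr (1 + (_ + _)); apply/esym/big1_seq => A /andP[_].
by rewrite !in_fsetD1 => /and3P[/negPf -> /negPf -> _]; rewrite mul0r.
Qed.

End Blocks.

(** * The Edwards-Sokal coupling *)

Section RandomCluster.
Variables (R : realType) (a : R).
Hypothesis a_gt0 : 0 < a.
Implicit Types (w : config a) (A C : {fset site}).
Local Notation b := (beta_c R).
Local Notation q := (expR (- 2 * b)).
Local Notation X := (Qa a).

Definition inner : {fset site} := X `\` bdry a.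

Lemma nbrs_inner x : x \in inner -> {subset nbrs x <= X}.
Proof.
rewrite !inE => /andP[xb xX] y xy; apply: contraNT xb => yX.
by rewrite xX; apply/hasP; exists y.
Qed.

Lemma inner_sub x : x \in inner -> x \in X.
Proof. by rewrite !inE => /andP[]. Qed.

Definition cut A (e : {fset site}) : bool := ~~ (e `<=` A) && ~~ [disjoint e & A]%fset.

Lemma cut_pair A x y : cut A [fset x; y] = (x \in A) (+) (y \in A).
Proof.
rewrite /cut fsubUset !fsub1set fdisjointUX !fdisjoint1X negb_and negb_and !negbK.
by case: (x \in A); case: (y \in A).
Qed.

(** A minus set inside the inner box has all its neighbours in Q^a, so no
unsatisfied bond leaves Q^a. *)
Lemma cut_edges A : A `<=` inner ->
  \sum_(e <- edges a) (cut A e)%:R = (disagreements full A)%:R :> R.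
Proof.
move=> /fsubsetP AI.
transitivity (\sum_(e <- edges a) \sum_(x <- e) \sum_(y <- e | x != y)
    (x \in A)%:R * (y \notin A)%:R : R).
  apply: eq_big_seq => e eE; have [x [y [-> nxy _ _]]] := edgeP eE.
  have xy := nn_neq nxy; rewrite cut_pair sum_pair //.
  rewrite [X in X + _]big_mkcond [X in _ + X]big_mkcond !sum_pair // !eqxx xy eq_sym xy /=.
  rewrite add0r addr0.
  by case: (x \in A); case: (y \in A); rewrite /= ?mul0r ?mul1r ?addr0 ?add0r.
rewrite sum_edges /disagreements natr_sum.
have AX : A `<=` X by apply/fsubsetP => x /AI /inner_sub.
pose G x : R := (x \in A)%:R * (count (fun y => (y \notin A) && full x y) (nbrs x))%:R.
transitivity (\sum_(x <- A) G x); last first.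
  by apply: eq_big_seq => x xA; rewrite /G xA mul1r.
rewrite [RHS](big_fset_incl _ AX); last by move=> x _ /negbTE xA; rewrite /G xA mul0r.
apply: eq_big_seq => x xX; rewrite -big_distrr /= /G.
case xA: (x \in A); rewrite ?mul0r // !mul1r.
rewrite -natr_sum; congr (_%:R).
rewrite -sum1_count [RHS]big_mkcond -big_filter.
rewrite (perm_big (nbrs x)).
  by apply: eq_bigr => y _; rewrite /full andbT; case: (y \notin A).
apply: uniq_perm; rewrite ?filter_uniq ?fset_uniq ?uniq_nbrs // => y.
rewrite mem_filter /nn; case yn: (y \in nbrs x) => //=.
by apply: nbrs_inner yn; exact: AI.
Qed.

Definition respects w A : bool := [forall e : edges a, w e ==> ~~ cut A (val e)].

Definition bond_weight w : R := \prod_(e : edges a) (if w e then 1 - q else q).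

Lemma bond_weightE w :
  (1 - q) ^+ #|[set e | w e]%SET| * q ^+ #|[set e | ~~ w e]%SET| = bond_weight w.
Proof.
rewrite /bond_weight (bigID (fun e => w e)) /=; congr (_ * _).
  rewrite (eq_bigr (fun=> 1 - q)); last by move=> e ->.
  by rewrite prodr_const; congr (_ ^+ _); apply: eq_card => e; rewrite inE.
rewrite (eq_bigr (fun=> q)); last by move=> e /negPf ->.
by rewrite prodr_const; congr (_ ^+ _); apply: eq_card => e; rewrite inE.
Qed.

(** Edges are independent: an edge in the cut must be closed, which has weight
exp (- 2 b), and any other edge has total weight 1. *)
Lemma sum_respects A : A `<=` inner ->
  \sum_(w : config a) bond_weight w * (respects w A)%:R = weight b full A.
Proof.
move=> AI.
transitivity (\sum_(w : config a) \prod_(e : edges a)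
    ((if w e then 1 - q else q) * (w e ==> ~~ cut A (val e))%:R)).
  apply: eq_bigr => w _; rewrite big_split /=; congr (_ * _).
  rewrite /respects; case: (boolP [forall e, _]) => [/forallP h|].
    by rewrite big1 // => e _; rewrite h.
  by rewrite negb_forall => /existsP[e /negPf he]; rewrite (bigD1 e) //= he mul0r.
rewrite -(bigA_distr_bigA (fun (e : edges a) (v : bool) =>
  (if v then 1 - q else q) * (v ==> ~~ cut A (val e))%:R)) /=.
rewrite (eq_bigr (fun e : edges a => expR ((- 2 * b) * (cut A (val e))%:R))); last first.
  move=> e _; rewrite big_bool /=; case: cut; rewrite /= ?mulr0 ?mulr1 ?add0r ?expR0 //.
  by rewrite addrNK.
rewrite -expR_sum /weight -big_distrr /= -(cut_edges AI).
by rewrite (big_seq_fsetE _ (edges a) xpredT (fun e => (cut A e)%:R)).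
Qed.

End RandomCluster.

Section Clusters.
Variables (R : realType) (a : R).
Hypothesis a_gt0 : 0 < a.
Implicit Types (w : config a) (A C : {fset site}).
Local Notation b := (beta_c R).
Local Notation X := (Qa a).

Lemma mem_cluster w x y : (y \in Defs.cluster w x) = (y \in X) && `[< connected_in w x y >].
Proof. by rewrite !inE. Qed.

Lemma cluster_eq w x y z : z \in Defs.cluster w x -> z \in Defs.cluster w y ->
  Defs.cluster w x = Defs.cluster w y.
Proof.
rewrite !mem_cluster => /andP[_ /asboolP xz] /andP[_ /asboolP yz].
have xy := connected_trans xz (connected_sym yz).
apply/fsetP => t; rewrite !mem_cluster; congr (_ && _).
by apply/asboolP/asboolP; apply: connected_trans => //; exact: connected_sym.
Qed.

Lemma separated_clusters w : separated (clusters w).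
Proof.
split; first exact: fset_uniq.
  move=> C /imfsetP[x /= xX ->]; apply/fset0Pn; exists x.
  by rewrite mem_cluster xX; apply/asboolP; exact: connected_refl.
move=> C D /imfsetP[x _ ->] /imfsetP[y _ ->]; apply: contraNT => /fset0Pn[z].
by rewrite in_fsetI => /andP[zx zy]; apply/eqP; exact: cluster_eq zx zy.
Qed.

Lemma separated_sub L L' : separated L -> uniq L' -> {subset L' <= L} -> separated L'.
Proof.
move=> [_ ne dis] uL' sub; split=> // [C /sub|C D /sub CL /sub]; [exact: ne|exact: dis].
Qed.

Lemma inner_clusters_separated w : separated (clusters w `\ boundary_cluster w).
Proof.
by apply: separated_sub (separated_clusters w) _ _; rewrite ?fset_uniq // => C /fsetD1P[].
Qed.

Lemma bigcup_clusters w : \bigcup_(C <- clusters w) C = X.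
Proof.
apply/fsetP => x; apply/bigfcupP/idP => [[C /andP[/imfsetP[y _ ->] _]]|xX].
  by rewrite mem_cluster => /andP[].
exists (Defs.cluster w x).
  by rewrite andbT; apply/imfsetP; exists x.
by rewrite mem_cluster xX; apply/asboolP; exact: connected_refl.
Qed.

Lemma bigcup_inner_clusters w :
  \bigcup_(C <- clusters w `\ boundary_cluster w) C = X `\` boundary_cluster w.
Proof.
have [C0in _ _] := boundary_clusterP w a_gt0.
have [_ _ dis] := separated_clusters w.
apply/fsetP => x; rewrite in_fsetD -[in RHS](bigcup_clusters w).
apply/bigfcupP/andP => [[C]|[xC0 /bigfcupP[C /andP[Cin _] xC]]].
  rewrite in_fsetD1 andbT => /andP[CC0 Cin] xC; split.
    by have /fdisjointP/(_ _ xC) := dis _ _ Cin C0in CC0.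
  by apply/bigfcupP; exists C => //; rewrite Cin.
exists C => //; rewrite in_fsetD1 Cin !andbT.
by apply: contraNneq xC0 => <-.
Qed.

Lemma respects_step w A x y : A `<=` inner a -> respects w A ->
  x \in A -> open_step w x y -> y \in A.
Proof.
move=> /fsubsetP AI /forallP rA xA /andP[nxy].
have xX := inner_sub (AI _ xA); have yX := nbrs_inner (AI _ xA) nxy.
have eE : [fset x; y] \in edges a by rewrite mem_edges ?nn_neq // nxy xX yX.
rewrite /wired; case: insubP => [e _ ee we|]; last by rewrite eE.
by have := rA e; rewrite we ee cut_pair xA /= negbK.
Qed.

Lemma respects_connected w A x y : A `<=` inner a -> respects w A ->
  x \in A -> connected_in w x y -> y \in A.
Proof.
move=> AI rA xA [p]; elim: p x xA => [|z p IH] x xA /=; first by move=> _ <-.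
by move=> /andP[xz]; apply: IH; exact: respects_step xz.
Qed.

(** Unions of clusters other than the boundary cluster are exactly the subsets of
the inner box that no open edge leaves: a subset meeting the boundary cluster
would contain boundary sites. *)
Lemma sum_saturated w (z : R) :
  \sum_(A <- fpowerset (X `\` boundary_cluster w))
     (saturated (clusters w `\ boundary_cluster w) A)%:R * z ^+ #|` A| =
  \sum_(A <- fpowerset (inner a)) (respects w A)%:R * z ^+ #|` A|.
Proof.
have [C0in bC0 _] := boundary_clusterP w a_gt0.
have sub : X `\` boundary_cluster w `<=` inner a by exact: fsetDS.
have [x0 x0b] := bdry_neq0 a_gt0.
transitivity (\sum_(A <- fpowerset (X `\` boundary_cluster w))
    (respects w A)%:R * z ^+ #|` A|).
  apply: eq_big_seq => A; rewrite fpowersetE => AX; congr ((nat_of_bool _)%:R * _).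
  have AI := fsubset_trans AX sub; apply/allP/idP => [sat|rA C].
    apply/forallP => e; apply/implyP => we.
    have [x [y [E nxy xX yX]]] := edgeP (valP e).
    have step : open_step w x y.
      by rewrite /open_step nxy -E /wired valK we.
    have half (u v : site) : connected_in w u v -> u \in X -> v \in X -> u \in A -> v \in A.
      move=> uv uX vX uA.
      have uu : u \in Defs.cluster w u.
        by rewrite mem_cluster uX; apply/asboolP; exact: connected_refl.
      have : Defs.cluster w u \in clusters w `\ boundary_cluster w.
        rewrite in_fsetD1; apply/andP; split; last by apply/imfsetP; exists u.
        apply: contraTneq uu => ->; move/fsubsetP/(_ _ uA): AX.
        by rewrite in_fsetD => /andP[].
      move=> /sat/orP[/fsubsetP h|/fdisjointP/(_ _ uu)]; last by rewrite uA.
      by apply: h; rewrite mem_cluster vX; exact/asboolP.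
    have xy : connected_in w x y by exists [:: y] => //=; rewrite step.
    rewrite E cut_pair; have h1 := half _ _ xy xX yX.
    have h2 := half _ _ (connected_sym xy) yX xX.
    by apply/negP; case xA: (x \in A) h1 h2; case: (y \in A) => //= h1 h2 _;
      [have := h1 isT|have := h2 isT].
  rewrite in_fsetD1 => /andP[_ /imfsetP[x /= xX ->]].
  have [|/fset0Pn[y]] := boolP [disjoint Defs.cluster w x & A]%fset; first by rewrite orbT.
  rewrite in_fsetI mem_cluster orbF => /andP[/andP[_ /asboolP xy] yA].
  apply/fsubsetP => t; rewrite mem_cluster => /andP[_ /asboolP xt].
  exact: respects_connected AI rA yA (connected_trans (connected_sym xy) xt).
apply: big_fset_incl; first by rewrite fpowersetS.
move=> A; rewrite !fpowersetE => AI /fsubsetPn[x xA xC].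
have [rA|] := boolP (respects w A); last by rewrite mul0r.
have xX : x \in X by apply: inner_sub; exact: (fsubsetP AI).
have xC0 : x \in boundary_cluster w by move: xC; rewrite in_fsetD xX andbT negbK.
have x0C0 := fsubsetP bC0 _ x0b.
have xx0 : connected_in w x x0.
  move: C0in xC0 x0C0 => /imfsetP[y _ ->]; rewrite !mem_cluster.
  move=> /andP[_ /asboolP yx] /andP[_ /asboolP yx0].
  exact: connected_trans (connected_sym yx) yx0.
have := fsubsetP AI _ (respects_connected AI rA xA xx0).
by rewrite in_fsetD x0b.
Qed.

Lemma sum_bond_weight (z : R) :
  \sum_(w : config a) bond_weight w *
    \prod_(C <- clusters w `\ boundary_cluster w) (1 + z ^+ #|` C|) =
  \sum_(A <- fpowerset (inner a)) weight b full A * z ^+ #|` A|.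
Proof.
transitivity (\sum_(w : config a) \sum_(A <- fpowerset (inner a))
    bond_weight w * (respects w A)%:R * z ^+ #|` A|).
  apply: eq_bigr => w _; rewrite prod_blocks; last exact: inner_clusters_separated.
  rewrite bigcup_inner_clusters sum_saturated big_distrr /=.
  by apply: eq_bigr => A _; rewrite mulrA.
rewrite exchange_big /=; apply: eq_big_seq => A; rewrite fpowersetE => AI.
by rewrite -big_distrl sum_respects.
Qed.

Lemma bond_weight_ge0 w : 0 <= bond_weight w.
Proof.
apply: prodr_ge0 => e _; case: (w e); last exact: expR_ge0.
rewrite subr_ge0 -expR0 ler_expR mulNr oppr_le0 mulr_ge0 //.
exact: beta_c_ge0.
Qed.

End Clusters.

(** * Comparing wired and forced moment generating functions *)

(** Both sides are 2 exp (- h m) times a hyperbolic cosine, at h m and at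
(t + h) m. *)
Lemma cluster_factor_le (R : realType) (h t m : R) : 0 <= h -> 0 <= t -> 0 <= m ->
  1 + expR (- 2 * h * m) <= expR (t * m) * (1 + expR (- 2 * (t + h) * m)).
Proof.
move=> h0 t0 m0.
have -> : - 2 * (t + h) * m = - (t * m) - (t * m) - 2 * h * m by ring.
rewrite !expRD mulrDr mulr1 !mulrA -expRD addrN expR0 mul1r expRN.
have x1 : 1 <= expR (t * m) by rewrite -expR0 ler_expR mulr_ge0.
have g1 : expR (- (2 * h * m)) <= 1 by rewrite -expR0 ler_expR oppr_le0 !mulr_ge0.
have g0 := expR_gt0 (- (2 * h * m)).
rewrite -!mulNr in g1 g0 *.
set x := expR (t * m) in x1 *; set g := expR _ in g1 g0 *.
have x0 : 0 < x by lra.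
rewrite -subr_ge0; have -> : x + x^-1 * g - (1 + g) = (x - 1) * (1 - g / x).
  by field; rewrite gt_eqF.
apply: mulr_ge0; first by rewrite subr_ge0.
by rewrite subr_ge0 ler_pdivrMr // mul1r (le_trans g1).
Qed.

Lemma cluster_factor_ge (R : realType) (h m : R) :
  2 * expR (- h * m) <= 1 + expR (- 2 * h * m).
Proof.
have -> : - 2 * h * m = - h * m + - h * m by ring.
rewrite expRD; set x := expR _; have := sqr_ge0 (x - 1); rewrite expr2; clear; lra.
Qed.

Section Comparison.
Variables (R : realType) (a : R).
Hypothesis a_gt0 : 0 < a.
Local Notation b := (beta_c R).
Local Notation X := (Qa a).
Local Notation s := (magscale a).

Definition inner_factor (v : R) (w : config a) : R :=
  \prod_(C <- clusters w `\ boundary_cluster w) (1 + expR (- 2 * v * s * #|` C|%:R)).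

Lemma magscale_ge0 : 0 <= s.
Proof. exact: powR_ge0. Qed.

Lemma sum_inner_factor v :
  \sum_(w : config a) bond_weight w * inner_factor v w =
  expR (- (s * v * #|` inner a|%:R)) * pf b full (inner a) (s * v).
Proof.
have -> : \sum_(w : config a) bond_weight w * inner_factor v w =
    \sum_(w : config a) bond_weight w *
    \prod_(C <- clusters w `\ boundary_cluster w) (1 + expR (- 2 * v * s) ^+ #|` C|).
  apply: eq_bigr => w _; congr (_ * _); apply: eq_bigr => C _.
  by rewrite -expRM_natr.
rewrite sum_bond_weight // /pf big_distrr /=; apply: eq_bigr => A _.
rewrite mulrCA -expRD -expRM_natr; congr (_ * expR _).
by rewrite /total_spin; ring.
Qed.

Lemma card_inner_clusters (w : config a) :
  #|` boundary_cluster w|%:R + \sum_(C <- clusters w `\ boundary_cluster w) #|` C|%:R =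
  #|` X|%:R :> R.
Proof.
have [C0in _ _] := boundary_clusterP w a_gt0.
rewrite -natr_sum -natrD -(big_fsetD1 _ C0in) /=.
by rewrite -card_blocks ?bigcup_clusters //; exact: separated_clusters.
Qed.

Lemma fk_weightE h (w : config a) : fk_weight h w =
  bond_weight w * ((1 + expR (- 2 * h * s * #|` boundary_cluster w|%:R)) * inner_factor h w).
Proof.
have [C0in _ _] := boundary_clusterP w a_gt0.
by rewrite /fk_weight bond_weightE (big_fsetD1 _ C0in).
Qed.

Lemma inner_factor_ge0 v (w : config a) : 0 <= inner_factor v w.
Proof. by apply: prodr_ge0 => C _; rewrite addr_ge0 ?expR_ge0. Qed.

Lemma inner_factor_le h t (w : config a) : 0 <= h -> 0 <= t ->
  inner_factor h w <=
  expR (t * s * (#|` X|%:R - #|` boundary_cluster w|%:R)) * inner_factor (t + h) w.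
Proof.
move=> h0 t0; rewrite -(card_inner_clusters w) addrAC subrr add0r.
rewrite big_distrr expR_sum -big_split /=; apply: ler_prod => C _.
rewrite addr_ge0 ?expR_ge0 //=.
rewrite -![_ * s * _]mulrA; apply: cluster_factor_le => //.
by rewrite mulr_ge0 // magscale_ge0.
Qed.

(** Raising the field from h to t + h in the other clusters costs a factor
exp (t s |C|) each, which together with the factor of the boundary cluster
gives exp (t s |Q|). *)
Lemma fk_numerator h t : 0 <= h -> 0 <= t ->
  \sum_(w : config a) expR (t * A0 w) * fk_weight h w <=
  2 * expR (t * s * #|` X|%:R) *
    (expR (- (s * (t + h) * #|` inner a|%:R)) * pf b full (inner a) (s * (t + h))).
Proof.
move=> h0 t0; rewrite -sum_inner_factor big_distrr /=; apply: ler_sum => w _.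
rewrite fk_weightE mulrCA [leRHS]mulrCA ler_wpM2l ?bond_weight_ge0 //.
set c := #|` boundary_cluster w|%:R.
have -> : t * s * #|` X|%:R = t * A0 w + t * s * (#|` X|%:R - c).
  by rewrite /A0 -/c; ring.
rewrite expRD -!mulrA mulrCA ler_wpM2l ?expR_ge0 //.
apply: ler_pM; rewrite ?inner_factor_ge0 ?addr_ge0 ?expR_ge0 //.
  rewrite -[2]/(1 + 1) lerD2l -expR0 ler_expR !mulNr oppr_le0 !mulr_ge0 //.
  exact: magscale_ge0.
by rewrite mulrA; exact: inner_factor_le.
Qed.

(** In each cluster, the boundary one included, 1 + exp (- 2 m) >= 2 exp (- m),
where the right-hand side is the factor without field, up to scaling. *)
Lemma fk_denominator h : 0 <= h ->
  2 * expR (- (h * s * #|` X|%:R)) * pf b full (inner a) 0 <=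
  \sum_(w : config a) fk_weight h w.
Proof.
move=> h0.
have -> : pf b full (inner a) 0 = \sum_(w : config a) bond_weight w * inner_factor 0 w.
  by rewrite sum_inner_factor mulr0 mul0r oppr0 expR0 mul1r.
rewrite big_distrr /=; apply: ler_sum => w _.
rewrite fk_weightE mulrCA ler_wpM2l ?bond_weight_ge0 //.
rewrite -(card_inner_clusters w) mulrDr opprD expRD -!mulrA mulrA.
apply: ler_pM; rewrite ?mulr_ge0 ?inner_factor_ge0 ?expR_ge0 //.
  by rewrite -mulNr mulrA; exact: cluster_factor_ge.
rewrite mulrA big_distrr -sumrN expR_sum -big_split /=; apply: ler_prod => C _.
rewrite mulr_ge0 ?addr_ge0 ?expR_ge0 //= mulr0 !mul0r expR0.
rewrite mulrC -!mulrA -mulNr [-2 * _]mulrA; exact: cluster_factor_ge.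
Qed.

Lemma fk_E_le_mgf h t : 0 <= h -> 0 <= t ->
  fk_E h (fun w : config a => expR (t * A0 w)) <=
  expR (s * (t + h) * (#|` X|%:R - #|` inner a|%:R)) * mgf b full (inner a) (s * (t + h)).
Proof.
move=> h0 t0.
have pf0 := pf_gt0 b full (inner a) 0.
have den := fk_denominator h0; have num := fk_numerator h0 t0.
have d0 : 0 < 2 * expR (- (h * s * #|` X|%:R)) * pf b full (inner a) 0.
  by rewrite !mulr_gt0 ?expR_gt0.
have Z0 := lt_le_trans d0 den.
have -> : fk_E h (fun w : config a => expR (t * A0 w)) =
    (\sum_(w : config a) expR (t * A0 w) * fk_weight h w) / \sum_(w : config a) fk_weight h w.
  by rewrite /fk_E /fk_prob big_distrl /=; apply: eq_bigr => w _; rewrite mulrA.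
rewrite ler_pdivrMr //; apply: le_trans num _.
apply: le_trans (ler_wpM2l _ den); last by rewrite mulr_ge0 ?expR_ge0 // ltW // mgf_gt0.
have -> : s * (t + h) * (#|` X|%:R - #|` inner a|%:R) =
  t * s * #|` X|%:R + (h * s * #|` X|%:R + - (s * (t + h) * #|` inner a|%:R)) by ring.
rewrite expRD expRD /mgf expRN [expR (- (h * _ * _))]expRN.
rewrite le_eqVlt; apply/orP; left; apply/eqP; field.
by rewrite !gt_eqF ?expR_gt0.
Qed.

End Comparison.

(** * The box Q^a and the conclusion *)

Lemma inner_squareE (R : realType) (a : R) n : Qa a = square n ->
  forall x, (x \in inner a) = (sup_norm x < n)%N.
Proof.
move=> QE x; rewrite !inE QE in_square.
case: (leqP (sup_norm x) n) => [xn|nx]; last by rewrite andbF ltnNge ltnW.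
rewrite andbT; apply/idP/idP => [|xn'].
  move=> /hasPn out; rewrite ltn_neqAle xn andbT; apply/eqP => E.
  have [y xy yE] := sup_norm_outward x.
  by have := out y xy; rewrite in_square yE E ltnn.
apply/hasPn => y; rewrite in_square negbK => xy.
have : (sup_norm y <= (sup_norm x).+1)%N.
  clear xn xn' QE; move: xy; case: x y => [x1 x2] [y1 y2].
  by rewrite !inE !xpair_eqE /sup_norm /=; lia.
by move=> le; exact: leq_trans le xn'.
Qed.

Lemma Qa_square (R : realType) (a : R) : 0 < a ->
  exists2 n : nat, Qa a = square n & a * (2 * n)%N%:R <= 1.
Proof.
move=> a0; have [n Hn] := inQ_box a0; exists n.
  by apply/fsetP => x; rewrite mem_Qa // Hn in_square /sup_norm; lia.
have : inQ a (n%:Z, 0) by rewrite Hn /=; lia.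
rewrite /inQ /= => /andP[/andP[_ h] _]; move: h; rewrite -pmulrn natrM.
set z := n%:R; move=> h; have -> : a * (2 * z) = 2 * (a * z) by ring.
have : 0 < 2 :> R by [].
by move=> two; rewrite -ler_pdivlMl // mulr1.
Qed.

(** Keep the all-plus configuration in the numerator; each of the other
2^|Y| - 1 weights in the denominator is at most its weight 1. *)
Lemma mgf_ge_ground (R : realType) (b : R) (c : rel site) (Y : {fset site}) (H : R) :
  0 <= b -> expR (H * #|` Y|%:R) / 2 ^+ #|` Y| <= mgf b c Y H.
Proof.
move=> b0; apply: ler_pM; rewrite ?expR_ge0 ?invr_ge0 ?exprn_ge0 //.
  rewrite /pf (big_fsetD1 fset0) ?fpowersetE ?fsub0set //.
  rewrite /weight /disagreements big_seq_fset0 mulr0 expR0 mul1r.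
  rewrite /total_spin cardfs0 mulr0 subr0 lerDl.
  by apply: sumr_ge0 => A _; rewrite mulr_ge0 ?expR_ge0.
rewrite lef_pV2 ?posrE ?pf_gt0 ?exprn_gt0 // /pf.
rewrite -natrX -card_fpowerset card_fset_sum1 natr_sum; apply: ler_sum => A _.
rewrite mul0r expR0 mulr1 /weight -expR0 ler_expR !mulNr oppr_le0.
by rewrite !mulr_ge0.
Qed.

(** The box has side at most 1, so 2 (n + 1) a <= 1, and y is the eighth root of
2 (n + 1), which makes both the critical exponent 15/8 and the tile size
polynomial in y. *)
Lemma magscale_le (R : realType) (a : R) n : 0 < a -> a * (2 * n.+1)%N%:R <= 1 ->
  exists y : R, [/\ 0 < y, y ^+ 8 = (2 * n.+1)%N%:R & magscale a * y ^+ 15 <= 1].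
Proof.
move=> a0; set N := (2 * n.+1)%N%:R => aN.
have N0 : 0 < N :> R by rewrite ltr0n.
exists (N `^ 8^-1); split; first exact: powR_gt0.
  by rewrite -powR_mulrn ?powR_ge0 // -powRrM mulVf // powRr1 // ltW.
rewrite -powR_mulrn ?powR_ge0 // -powRrM [8^-1 * _]mulrC /magscale -powRM ?(ltW a0) ?(ltW N0) //.
rewrite [leRHS](_ : 1 = 1 `^ (15 / 8)); last by rewrite powR1.
by apply: ge0_ler_powR; rewrite ?nnegrE ?mulr_ge0 ?(ltW a0) ?(ltW N0).
Qed.

Lemma magscale_gt0 (R : realType) (a : R) : 0 < a -> 0 < magscale a.
Proof. exact: powR_gt0. Qed.

Theorem proposition6 (R : realType) (D : set R) (C5 : R)
    (D_pos : forall a : R, D a -> 0 < a)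
    (C5_pos : 0 < C5)
    (C5_bound : forall a t : R, D a -> 0 < t ->
      ising_E (fun s : spins a => expR (t * mag s)) <=
      expR (C5 * (t + t ^+ 2))) :
  forall a h t : R, D a -> 0 <= h -> 0 < t ->
    fk_E h (fun w : config a => expR (t * A0 w)) <=
    2 * expR (C5 * ((t + h) ^+ 2 + (t + h))).
Proof.
move=> a h t Da h0 t0; have a0 := D_pos a Da.
have u0 : 0 < t + h by rewrite ltr_wpDr.
have s0 := magscale_gt0 a0.
apply: le_trans (fk_E_le_mgf a0 h0 (ltW t0)) _.
rewrite [(t + h) ^+ 2 + _]addrC; set u := t + h in u0 *.
have hyp v : 0 < v -> mgf (beta_c R) full (Qa a) (magscale a * v) <= expR (C5 * (v + v ^+ 2)).
  by move=> v0; rewrite -ising_E_mgf; exact: C5_bound.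
(* A one-site box has empty inner box; otherwise the inner box is a smaller square. *)
have [[|k] QE aN] := Qa_square a0; have inE' := inner_squareE QE.
  have I0 : inner a = fset0 by apply/fsetP => x; rewrite inE' inE.
  have ground := le_trans (mgf_ge_ground full (Qa a) (magscale a * u) (beta_c_ge0 R)) (hyp u u0).
  have Q1 : #|` Qa a| = 1%N by rewrite QE card_square.
  move: ground; rewrite I0 cardfs0 subr0 mgf_fset0 mulr1 Q1 expr1 mulr1.
  by rewrite ler_pdivrMr // [leRHS]mulrC.
have IE : inner a = square k by apply/fsetP => x; rewrite inE' in_square.
have [y [y0 y8 sy]] := magscale_le a0 aN.
have := @wired_square_bound R k y (magscale a) u C5 y0 y8 s0 sy u0 (ltW C5_pos).
rewrite -QE IE => /(_ hyp); rewrite QE !card_square -natrB; last by rewrite leq_exp2r //; lia.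
by have -> : (k.+1.*2.+1 ^ 2 - k.*2.+1 ^ 2 = 8 * k.+1)%N by rewrite doubleS; nia.
Qed.
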